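(* Let $u_0(x)=x(1-x)$ on $[0,1]$, and let $[\alpha,\beta]\subseteq(0,1)$. For all $t_0$ large enough and all intervals $[t_0,t_1]\subseteq[0,+\infty)$, $u_0$ is an admissible initial value on $[\alpha,\beta]\times[t_0,t_1]$. Moreover, there is a constant $C>0$ such that $$|a_2-a_1|\le C\,|\partial_xu^{a_2}(1,t)-\partial_xu^{a_1}(1,t)|\qquad\text{for all } a_1,a_2\in[\alpha,\beta]\text{ and all } t\in[t_0,t_1].$$
   Context: For $a\in[0,1)$, $u^a$ is the solution of $\partial_t u-\partial_x((x-a)\partial_x u)=0$ in $(a,1)\times(0,\infty)$, $u(1,t)=0$, $(x-a)\partial_xu(x,t)|_{x=a}=0$, $u(x,0)=u_0(x)$ for $x\in(a,1)$; that is, $u^a(\cdot,t)=e^{tA}u_0$, where $A u=\partial_x((x-a)\partial_x u)$ on $L^2(a,1)$ has domain consisting of those $u\in L^2(a,1)$ with $\int_a^1(x-a)|\partial_xu|^2dx<\infty$, $u(1)=0$ and $(x-a)\partial_x u\in H^1(a,1)$. Set $\mu_{u_0}(a,t)=\partial_xu^a(1,t)$. A function $u_0\in C^1([0,1])$ is an admissible initial value on $K\times I$, with $K=[\alpha,\beta]\subseteq[0,1)$ and $I=[t_0,t_1]\subseteq[0,+\infty)$, if there is a constant $c>0$ with $|\mu_{u_0}(a_1,t)-\mu_{u_0}(a_2,t)|\ge c|a_1-a_2|$ for all $a_1,a_2\in K$ and $t\in I$. ''For all $t_0$ large enough'' means: there is $T_0>0$ (which may depend on $[\alpha,\beta]$)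 such that the assertion holds for all $t_0\ge T_0$; the constant $C$ may depend on $\alpha,\beta,t_0,t_1$. *)

(* Defs.v *)
From mathcomp Require Import all_boot all_order all_algebra.
From mathcomp Require Import all_classical all_reals all_analysis.

Set Implicit Arguments.
Unset Strict Implicit.
Unset Printing Implicit Defensive.

Import Order.TTheory GRing.Theory Num.Theory.
Import numFieldNormedType.Exports.

Local Open Scope classical_set_scope.
Local Open Scope ring_scope.

Section degenerate_parabolic_problem.
Context {R : realType}.
Implicit Types (a s t : R) (f g h v w : R -> R) (S : R -> (R -> R) -> R -> R).

(* Lebesgue measure on (a, 1), as a measure on R carried by (a, 1).
   Elements of L^2(a, 1) are represented by functions on R, and their values
   outside (a, 1) are irrelevant. *)
Definition leb1 a : {measure set (measurableTypeR R) -> \bar R} :=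
  mrestr (@lebesgue_measure R) (measurable_itv `]a, 1[).

Definition L2 a f : Prop := f \in Lfun (leb1 a) 2%:E.

Definition L2norm a f : \bar R := Lnorm (leb1 a) 2%:E (EFin \o f).

Definition C1_test a (phi : R -> R) : Prop :=
  [/\ forall x : R, derivable phi x 1,
      continuous (derive1 phi)
    & exists c d : R, [/\ a < c, d < 1 &
        forall x : R, x \notin `[c, d] -> phi x = 0]].

(* Weak derivative on (a, 1), tested against C^1_c(a, 1) as in Brezis. *)
Definition weak_derivative a f g : Prop :=
  [/\ locally_integrable `]a, 1%R[ f,
      locally_integrable `]a, 1%R[ g
    & forall phi, C1_test a phi ->
        \int[lebesgue_measure]_(x in `]a, 1%R[) (f x * derive1 phi x) =
        - \int[lebesgue_measure]_(x in `]a, 1%R[) (g x * phi x)].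

(* The graph of A f = ((x - a) f')': f lies in the domain of A and A f = h.
   The trace condition f(1) = 0 is read on the representative of f which is
   continuous on (a, 1], and the last three conditions say that (x - a) f' is
   in H^1(a, 1) with derivative h. *)
Definition degenerate_op a f h : Prop :=
  L2 a f /\
  exists g, [/\ weak_derivative a f g,
    (\int[lebesgue_measure]_(x in `]a, 1%R[)
       ((x - a) * `|g x| ^+ 2)%:E < +oo)%E,
    exists v, [/\ v = f %[ae leb1 a],
                  {within `]a, 1%R], continuous v} & v 1 = 0],
    L2 a (fun x => (x - a) * g x)
  & weak_derivative a (fun x => (x - a) * g x) h /\ L2 a h].

(* S induces a strongly continuous semigroup of bounded linear operators on
   L^2(a, 1); identities in L^2(a, 1) are almost everywhere identities. *)
Record C0_semigroup a S : Prop := MkC0Semigroup {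
  C0_L2 : forall t f, 0 <= t -> L2 a f -> L2 a (S t f) ;
  C0_linear : forall t (k : R) f g, 0 <= t -> L2 a f -> L2 a g ->
    S t (fun x => k * f x + g x) = (fun x => k * S t f x + S t g x)
      %[ae leb1 a] ;
  C0_bounded : forall t, 0 <= t -> exists2 M : R, 0 <= M &
    forall f, L2 a f -> (L2norm a (S t f) <= M%:E * L2norm a f)%E ;
  C0_id : forall f, L2 a f -> S 0 f = f %[ae leb1 a] ;
  C0_add : forall s t f, 0 <= s -> 0 <= t -> L2 a f ->
    S (s + t) f = S s (S t f) %[ae leb1 a] ;
  C0_continuous : forall f s, L2 a f -> 0 <= s ->
    L2norm a (S t f \- S s f) @[t --> within `[0, +oo[ (nbhs s)] --> 0%E
}.

(* f is in the domain of the infinitesimal generator of S, with image h. *)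
Definition infinitesimal_generator a S f h : Prop :=
  [/\ L2 a f, L2 a h
    & L2norm a (fun x => t^-1 * (S t f x - f x) - h x) @[t --> 0^'+] --> 0%E].

(* S t = e^{tA} for A = degenerate_op a. *)
Definition is_exp_semigroup a S : Prop :=
  C0_semigroup a S /\
  forall f h, infinitesimal_generator a S f h <-> degenerate_op a f h.

(* v x t = (e^{tA} u0)(x), where for each t >= 0 the representative v(., t) is
   the one which is continuous on (a, 1]; this pins down v(., t) on (a, 1]. *)
Definition is_solution a (u0 : R -> R) (v : R -> R -> R) : Prop :=
  exists2 S, is_exp_semigroup a S & forall t, 0 <= t ->
    v^~ t = S t (u0 \_ `]a, 1%R[) %[ae leb1 a] /\
    {within `]a, 1%R], continuous (v^~ t)}.

(* u a x t = u^a(x, t) for all a in [0, 1). *)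
Definition is_solution_family (u0 : R -> R) (u : R -> R -> R -> R) : Prop :=
  forall a, 0 <= a < 1 -> is_solution a u0 (u a).

(* mu_{u0}(a, t), the one-sided derivative at x = 1 of u^a(., t). *)
Definition boundary_flux (u : R -> R -> R -> R) a t : R :=
  lim ((u a x t - u a 1 t) / (x - 1) @[x --> 1^'-]).

Definition C1_unit_interval (f : R -> R) : Prop :=
  exists g, {within `[0, 1], continuous g} /\
    forall x : R, x \in `[0, 1] ->
      (f y - f x) / (y - x) @[y --> within `[0, 1] (x^')] --> g x.

(* u0 is an admissible initial value on [alpha, beta] x [t0, t1]; the solution
   family u of u0 is unique on (a, 1] x [0, +oo[, so that quantifying over it
   amounts to naming it. *)
Definition admissible (u0 : R -> R) (alpha beta t0 t1 : R) : Prop :=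
  C1_unit_interval u0 /\
  exists2 c : R, 0 < c & forall u, is_solution_family u0 u ->
    forall a1 a2 t, a1 \in `[alpha, beta] -> a2 \in `[alpha, beta] ->
      t \in `[t0, t1] ->
      `|boundary_flux u a1 t - boundary_flux u a2 t| >= c * `|a1 - a2|.

End degenerate_parabolic_problem.

(* Main.v *)
Require Import Defs.
From mathcomp Require Import all_boot all_order all_algebra.
From mathcomp Require Import all_classical all_reals all_analysis.
From mathcomp Require Import measurable_realfun.
From mathcomp Require Import ring lra.
Import Order.TTheory GRing.Theory Num.Theory.
Import numFieldNormedType.Exports.
Local Open Scope classical_set_scope.
Local Open Scope ring_scope.
Set Implicit Arguments.
Unset Strict Implicit.
Unset Printing Implicit Defensive.

(** Write A for the operator f |-> ((x - a) f')' on (a, 1) and b = 1 - a. The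
    substitution x = a + b y, t = b s turns d_t u = A u into d_s f = L f, where
    L f = (y f')' on (0, 1) with f(1) = 0 and no flux at 0. So a single
    semigroup T = e^{sL} on L^2(0, 1) governs all values of a, and a enters
    only through the time t / b and through the initial value.

    The derivative at x = 1. As (x - a) u' vanishes at a, its value at 1 is the
    integral of A S_t u0 over (a, 1), where A S_t u0 = S_t A u0. Now
    A u0 = 1 + 2 a - 4 x becomes - (1 + 2 b) + 4 b (1 - y). With the heat
    content P(s) = <T_s 1, 1> and with R(s) = <T_s (1 - y), 1> this gives
      d_x u^a(1, t) = - (1 + 2 b) P(t / b) + 4 b R(t / b)     [flux_content].

    Comparison of two fluxes. Since L (1 - y) = - 1, one has R' = - P. By
    symmetry of L, P(s) = |T_{s/2} 1|^2, and the energy inequality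
    <L f, f> <= - (4/3) |f|^2 yields P' <= - (4/3) P. Hence P - (4/3) R is
    nonincreasing; as it tends to 0, P >= (4/3) R. For b1 <= b2 the earlier time
    s = t / b2 and the later time r = t / b1 satisfy r - s >= t (b2 - b1), so
    R(s) - R(r) >= t (b2 - b1) P(r). If b2 <= 1 - alpha, it follows that the
    fluxes at the two parameters differ by at least
      (b2 - b1) P(r) ((4/3) alpha t - 1)                       [flux_gap],
    and the last factor is at least 1 as soon as t >= 3 / (2 alpha). Finally P
    is bounded below on bounded intervals, because P(1/4) >= 1/3 and
    P(2 s) >= P(s)^2 by the Cauchy-Schwarz inequality [content_gt0_bound].

    The operator. By the du Bois-Reymond lemma, (x - a) f' = c + V with
    V(x) the integral of A f over (a, x), for every f in the domain; the
    constant c vanishes because otherwise (x - a) |f'|^2 would not be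
    integrable at a. So f is the potential - int_x^1 V(z) / (z - a) dz
    [degenerate_op_potential]. On (0, 1) Fubini's theorem then shows
    <L f, g> = - int V_f V_g / z dz, which is symmetric in f and g, and a
    weighted Cauchy-Schwarz inequality shows the energy inequality
    [hardy_energy]. Conversely 1 - y lies in the domain, and so does the
    restriction of u0 [degenerate_op_smooth].

    The hypotheses provide one semigroup for each a, and they become semigroups
    on L^2(0, 1) whose generators are symmetric to each other. Such semigroups
    satisfy <T_s f, g> = <f, T'_s g> on the closure of the domain [domain_closure_sym],
    so that P and R do not depend on a. *)

(** * Monotonicity from one-sided derivatives *)

Lemma within_itv_continuousP (R : realType) (k : R -> R) (a b : R) :
  {within `[a, b], continuous k} <->
  forall t, a <= t <= b -> forall e, 0 < e -> exists2 d, 0 < d &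
     forall x, a <= x <= b -> `|x - t| < d -> `|k x - k t| < e.
Proof.
rewrite subspace_continuousP; split=> h t.
  move=> tab e e0; have := h t; rewrite /= in_itv/= => /(_ tab).
  move=> /cvgrPdist_lt /(_ e e0); rewrite near_withinE.
  move=> /nbhs_ballP [d /= d0 hd]; exists d => // x xab xt.
  have := hd x; rewrite /ball/= distrC [`|k x - _|]distrC in_itv/=; exact.
rewrite /= in_itv/= => tab; apply/cvgrPdist_lt => e e0; rewrite near_withinE.
have [d d0 hd] := h t tab e e0; apply/nbhs_ballP; exists d => //= x.
rewrite /ball/= distrC in_itv/= => xt xab; rewrite distrC; exact: hd.
Qed.

(** One inequality on the right Dini derivative suffices: for every slope
    e > 0 the set of points up to which k stays below the line of slope e is
    closed and can be prolonged to the right, hence it reaches the end. Orbits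
    of a semigroup are differentiated from the right only, which is why the
    hypothesis is one-sided. *)
Lemma dini_nonincreasing (R : realType) (k : R -> R) (s r : R) : s <= r ->
  {within `[s, r], continuous k} ->
  (forall t, s <= t < r -> forall e, 0 < e -> exists2 d, 0 < d &
     forall x, 0 < x < d -> k (t + x) - k t <= e * x) ->
  k r <= k s.
Proof.
move=> sr /within_itv_continuousP hc hd.
suff H e : 0 < e -> k r - k s <= e * (r - s).
  apply/ler_addgt0Pr => e e0.
  have H1 : 0 < e / (r - s + 1) by apply: divr_gt0 => //; lra.
  have H2 := H _ H1.
  have : e / (r - s + 1) * (r - s) <= e.
    rewrite mulrAC ler_pdivrMr; last by lra.
    by rewrite ler_pM2l//; lra.
  lra.
move=> e0.
pose E := [set x | s <= x <= r /\ k x - k s <= e * (x - s)].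
have Es : E s by split; [rewrite lexx|lra].
have ubE : ubound E r by move=> x [/andP[]].
have hE : has_sup E by split; [exists s|exists r].
pose z := sup E.
have sz : s <= z by exact: (sup_upper_bound hE).
have zr : z <= r by apply: ge_sup ubE; exists s.
have szr : s <= z <= r by rewrite sz zr.
have Ez : E z.
  split; first exact: szr.
  rewrite leNgt; apply/negP => h.
  pose n := k z - k s - e * (z - s).
  have n0 : 0 < n by rewrite /n; lra.
  have [d d0 hdz] := hc z szr n n0.
  have [x Ex zx] := sup_adherent d0 hE.
  have xz : x <= z by exact: (sup_upper_bound hE).
  have [/andP[sx xr] kx] := Ex.
  have := hdz x; rewrite sx xr => /(_ erefl).
  rewrite ler0_norm ?subr_le0// opprB => /(_ _).
  rewrite -/z in zx.
  have -> : (z - x < d) = true by apply/idP; lra.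
  move=> /(_ erefl); rewrite ltr_norml => /andP[k1 _].
  have : e * (x - s) <= e * (z - s) by rewrite ler_pM2l//; lra.
  rewrite /n in k1; lra.
move: zr; rewrite le_eqVlt => /orP[/eqP <-|zr]; first by case: Ez.
have szr' : s <= z < r by rewrite sz zr.
have [d d0 hdz] := hd z szr' e e0.
pose x := Num.min (d / 2) (r - z).
have x0 : 0 < x by rewrite /x lt_min; apply/andP; split; lra.
have xd : x < d by rewrite /x gt_min; apply/orP; left; lra.
have xr : x <= r - z by rewrite /x ge_min lexx orbT.
have /hdz kx : 0 < x < d by rewrite x0 xd.
have : E (z + x).
  split; first by apply/andP; split; lra.
  have [_ kz] := Ez; lra.
by move/(sup_upper_bound hE); rewrite -/z; lra.
Qed.

Lemma dini_constant (R : realType) (k : R -> R) (s r : R) : s <= r ->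
  {within `[s, r], continuous k} ->
  (forall t, s <= t < r -> forall e, 0 < e -> exists2 d, 0 < d &
     forall x, 0 < x < d -> `|k (t + x) - k t| <= e * x) ->
  k r = k s.
Proof.
move=> sr hc hd; apply/eqP; rewrite eq_le; apply/andP; split.
  apply: dini_nonincreasing => // t tsr e e0.
  have [d d0 h] := hd t tsr e e0; exists d => // x xd.
  by rewrite (le_trans _ (h x xd))// ler_norm.
rewrite -lerN2; apply: (@dini_nonincreasing _ (fun x => - k x)) => //.
  by move=> x; apply: cvgN; apply: hc.
move=> t tsr e e0; have [d d0 h] := hd t tsr e e0; exists d => // x xd.
by rewrite (le_trans _ (h x xd))// -opprD -normrN ler_norm.
Qed.

(** * Dissipative semigroups on a semi-inner product space *)

(** The form [ip] is only required to behave well on [H]. In the application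
    [V] is the space of all functions, [H] is L^2, and [ip f f = 0] does not
    force [f = 0]. *)
Record semi_inner (R : realType) (V : lmodType R) (H : V -> Prop)
    (ip : V -> V -> R) : Prop := SemiInner {
  sipD : forall f g, H f -> H g -> H (f + g) ;
  sipZ : forall a f, H f -> H (a *: f) ;
  ipC : forall f g, ip f g = ip g f ;
  ipDl : forall f g k, H f -> H g -> H k -> ip (f + g) k = ip f k + ip g k ;
  ipZl : forall a f k, H f -> H k -> ip (a *: f) k = a * ip f k ;
  ip_ge0 : forall f, 0 <= ip f f }.

Section SemiInner.
Variables (R : realType) (V : lmodType R) (H : V -> Prop) (ip : V -> V -> R).
Hypothesis S : semi_inner H ip.
Implicit Types (f g h : V) (a s t x e : R).

Definition ipnorm f := Num.sqrt (ip f f).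
Local Notation nm := ipnorm.

Lemma sipN f : H f -> H (- f).
Proof. by move=> Hf; rewrite -scaleN1r; apply: (sipZ S). Qed.

Lemma sipB f g : H f -> H g -> H (f - g).
Proof. by move=> Hf Hg; apply: (sipD S) => //; apply: sipN. Qed.

Lemma ipDr f g k : H f -> H g -> H k -> ip k (f + g) = ip k f + ip k g.
Proof. by move=> *; rewrite (ipC S) (ipDl S)// !(ipC S k). Qed.

Lemma ipZr a f k : H f -> H k -> ip k (a *: f) = a * ip k f.
Proof. by move=> *; rewrite (ipC S) (ipZl S)// (ipC S k). Qed.

Lemma ipBl f g k : H f -> H g -> H k -> ip (f - g) k = ip f k - ip g k.
Proof.
move=> Hf Hg Hk; rewrite (ipDl S)//; last exact: sipN.
by rewrite -scaleN1r (ipZl S)// mulN1r.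
Qed.

Lemma ipBr f g k : H f -> H g -> H k -> ip k (f - g) = ip k f - ip k g.
Proof. by move=> *; rewrite (ipC S) ipBl// !(ipC S k). Qed.

Lemma ipnorm_ge0 f : 0 <= nm f. Proof. exact: sqrtr_ge0. Qed.

Lemma ipnorm2 f : nm f ^+ 2 = ip f f.
Proof. by rewrite sqr_sqrtr//; apply: (ip_ge0 S). Qed.

Lemma ipnormZ a f : H f -> nm (a *: f) = `|a| * nm f.
Proof.
move=> Hf; rewrite /nm (ipZl S)//; last exact: (sipZ S).
by rewrite ipZr// mulrA -expr2 sqrtrM ?sqr_ge0// sqrtr_sqr.
Qed.

Lemma ipnormN f : H f -> nm (- f) = nm f.
Proof. by move=> Hf; rewrite -scaleN1r ipnormZ// normrN normr1 mul1r. Qed.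

Lemma cauchy_schwarz f g : H f -> H g -> `|ip f g| <= nm f * nm g.
Proof.
move=> Hf Hg.
(* The discriminant argument; when [ip g g = 0] the quadratic is affine,
   and it would change sign unless [ip f g = 0]. *)
have quad x : 0 <= ip f f + 2 * x * ip f g + x ^+ 2 * ip g g.
  have := ip_ge0 S (f + x *: g).
  have Hxg := sipZ S x Hg.
  rewrite (ipDl S)//; last exact: (sipD S).
  rewrite !ipDr// !(ipZl S)// !ipZr// (ipC S g f); lra.
have H1 : ip f g ^+ 2 <= ip f f * ip g g.
  have := ip_ge0 S g; rewrite le_eqVlt => /orP[/eqP g0|g0].
    suff -> : ip f g = 0 by rewrite -g0 expr2 !mul0r mulr0.
    apply/eqP; apply: contraT => n0.
    have := quad (- (ip f f + 1) / (2 * ip f g)); rewrite -g0.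
    have -> : ip f f + 2 * (- (ip f f + 1) / (2 * ip f g)) * ip f g +
      (- (ip f f + 1) / (2 * ip f g)) ^+ 2 * 0 = -1.
      by field.
    by rewrite ler0N1.
  have := quad (- ip f g / ip g g).
  have -> : ip f f + 2 * (- ip f g / ip g g) * ip f g +
     (- ip f g / ip g g) ^+ 2 * ip g g =
     (ip f f * ip g g - ip f g ^+ 2) / ip g g.
    by field; rewrite gt_eqF.
  by rewrite pmulr_lge0 ?invr_gt0// subr_ge0.
rewrite -(@ler_pXn2r _ 2)// ?nnegrE ?mulr_ge0 ?ipnorm_ge0//.
by rewrite real_normK ?num_real// exprMn !ipnorm2.
Qed.

Lemma ipnormD f g : H f -> H g -> nm (f + g) <= nm f + nm g.
Proof.
move=> Hf Hg; rewrite -(@ler_pXn2r _ 2)// ?nnegrE ?addr_ge0 ?ipnorm_ge0//.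
rewrite ipnorm2 sqrrD !ipnorm2 (ipDl S)//; last exact: (sipD S).
rewrite !ipDr// (ipC S g f).
have := cauchy_schwarz Hf Hg; rewrite ler_norml => /andP[_].
rewrite -mulr_natr; lra.
Qed.

Lemma ipnormD2 f g : H f -> H g ->
  nm (f + g) ^+ 2 = nm f ^+ 2 + 2 * ip f g + nm g ^+ 2.
Proof.
move=> Hf Hg; rewrite !ipnorm2 (ipDl S)//; last exact: (sipD S).
by rewrite !ipDr// (ipC S g f); ring.
Qed.

Lemma ipnorm_distC f g : H f -> H g -> nm (f - g) = nm (g - f).
Proof. by move=> Hf Hg; rewrite -opprB ipnormN//; apply: sipB. Qed.

Lemma ipnorm_dist_norm f g : H f -> H g -> `|nm f - nm g| <= nm (f - g).
Proof.
move=> Hf Hg; rewrite ler_norml; apply/andP; split.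
  rewrite lerNl opprB ipnorm_distC// lerBlDl -[X in nm X <= _](subrK f) addrC.
  by apply: ipnormD => //; apply: sipB.
rewrite lerBlDl -[X in nm X <= _](subrK g) addrC.
by apply: ipnormD => //; apply: sipB.
Qed.

Lemma ipnorm_dist_tri f g h : H f -> H g -> H h ->
  nm (f - h) <= nm (f - g) + nm (g - h).
Proof.
move=> Hf Hg Hh.
have -> : f - h = (f - g) + (g - h) by rewrite addrA subrK.
by apply: ipnormD; apply: sipB.
Qed.

Lemma ipnorm_le_dist f g : H f -> H g -> nm f <= nm g + nm (f - g).
Proof.
move=> Hf Hg; rewrite -{1}(subrK g f) [leRHS]addrC.
by apply: ipnormD => //; apply: sipB.
Qed.

Lemma ip_close f g f' g' : H f -> H g -> H f' -> H g' ->
  `|ip f g - ip f' g'| <= nm (f - f') * nm g + nm f' * nm (g - g').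
Proof.
move=> Hf Hg Hf' Hg'.
have -> : ip f g - ip f' g' = ip (f - f') g + ip f' (g - g').
  by rewrite ipBl// ipBr//; ring.
apply: le_trans (ler_normD _ _) _.
by apply: lerD; apply: cauchy_schwarz => //; apply: sipB.
Qed.

(** In L^2 this is equality almost everywhere. The vectors are functions and
    not classes of functions, so semigroup identities are stated up to it. *)
Definition eqv f g := [/\ H f, H g & nm (f - g) = 0].
Local Notation "f ~~ g" := (eqv f g) (at level 70).

Lemma eqv_refl f : H f -> f ~~ f.
Proof.
move=> Hf; split=> //; rewrite subrr -(scale0r f) ipnormZ//.
by rewrite normr0 mul0r.
Qed.

Lemma eqv_sym f g : f ~~ g -> g ~~ f.
Proof. by move=> [Hf Hg e]; split=> //; rewrite ipnorm_distC. Qed.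

Lemma eqv_of_le f g : H f -> H g -> nm (f - g) <= 0 -> f ~~ g.
Proof.
by move=> Hf Hg h; split=> //; apply/eqP; rewrite eq_le h ipnorm_ge0.
Qed.

Lemma eqv_trans g f h : f ~~ g -> g ~~ h -> f ~~ h.
Proof.
move=> [Hf Hg e1] [_ Hh e2]; apply: eqv_of_le => //.
by rewrite (le_trans (ipnorm_dist_tri Hf Hg Hh))// e1 e2 addr0.
Qed.

Lemma eqvD f g f' g' : f ~~ f' -> g ~~ g' -> f + g ~~ f' + g'.
Proof.
move=> [Hf Hf' e1] [Hg Hg' e2].
apply: eqv_of_le; try exact: (sipD S).
rewrite opprD addrACA (le_trans (ipnormD (sipB Hf Hf') (sipB Hg Hg')))//.
by rewrite e1 e2 addr0.
Qed.

Lemma eqvZ a f g : f ~~ g -> a *: f ~~ a *: g.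
Proof.
move=> [Hf Hg e1]; apply: eqv_of_le; try exact: (sipZ S).
by rewrite -scalerBr ipnormZ ?e1 ?mulr0//; apply: sipB.
Qed.

Lemma eqvB f g f' g' : f ~~ f' -> g ~~ g' -> f - g ~~ f' - g'.
Proof.
by move=> ff gg; rewrite -(scaleN1r g) -(scaleN1r g'); apply: eqvD => //; apply: eqvZ.
Qed.

Lemma eqv_ip f f' g g' : f ~~ f' -> g ~~ g' -> ip f g = ip f' g'.
Proof.
move=> [Hf Hf' e1] [Hg Hg' e2]; apply/eqP; rewrite -subr_eq0 -normr_le0.
by rewrite (le_trans (ip_close Hf Hg Hf' Hg'))// e1 e2 mul0r mulr0 addr0.
Qed.

Lemma eqv_ipnorm f f' : f ~~ f' -> nm f = nm f'.
Proof. by move=> e; rewrite /nm (eqv_ip e e). Qed.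

(** The axioms are those of a strongly continuous semigroup on the quotient of
    [H] by vectors of norm 0. *)
Record sgroup (T : R -> V -> V) : Prop := Sgroup {
  sgH : forall t f, 0 <= t -> H f -> H (T t f) ;
  sgL : forall t a f g, 0 <= t -> H f -> H g ->
    T t (a *: f + g) ~~ a *: T t f + T t g ;
  sgM : forall t, 0 <= t -> exists2 M, 0 <= M &
    forall f, H f -> nm (T t f) <= M * nm f ;
  sg0 : forall f, H f -> T 0 f ~~ f ;
  sgA : forall s t f, 0 <= s -> 0 <= t -> H f -> T (s + t) f ~~ T s (T t f) ;
  sgC : forall f s, H f -> 0 <= s -> forall e, 0 < e -> exists2 d, 0 < d &
    forall t, 0 <= t -> `|t - s| < d -> nm (T t f - T s f) < e }.

(** The pair [(f, h)] belongs to the graph of the generator: the difference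
    quotients of the orbit of [f] at time 0 tend to [h]. The quotient is cleared
    to avoid division by [x]. *)
Definition sgen (T : R -> V -> V) f h := [/\ H f, H h &
  forall e, 0 < e -> exists2 d, 0 < d & forall x, 0 < x < d ->
    nm (T x f - f - x *: h) <= e * x].

(** The constant 1, for which the estimates are wanted, lies in the closure of
    the domain but not in the domain. *)
Definition domain_closure (T : R -> V -> V) f := H f /\ forall e, 0 < e ->
  exists g, (exists h, sgen T g h) /\ nm (f - g) <= e.

Section OneSemigroup.
Variable T : R -> V -> V.
Hypothesis sT : sgroup T.
Let TH := sgH sT.

Lemma sgD t f g : 0 <= t -> H f -> H g -> T t (f + g) ~~ T t f + T t g.
Proof. by move=> t0 Hf Hg; have := sgL sT 1 t0 Hf Hg; rewrite !scale1r. Qed.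

Lemma sgB t f g : 0 <= t -> H f -> H g -> T t (f - g) ~~ T t f - T t g.
Proof.
move=> t0 Hf Hg; have := sgL sT (-1) t0 Hg Hf.
by rewrite !scaleN1r ![- _ + _]addrC.
Qed.

Lemma sgZ t a f : 0 <= t -> H f -> T t (a *: f) ~~ a *: T t f.
Proof.
move=> t0 Hf; have -> : a *: f = (a - 1) *: f + f.
  by rewrite scalerBl scale1r subrK.
apply: eqv_trans (sgL sT (a - 1) t0 Hf Hf) _.
rewrite scalerBl scale1r subrK; apply: eqv_refl.
by apply: (sipZ S); apply: TH.
Qed.

(** The generator commutes with the semigroup because T_x and T_t commute and
    T_t is bounded. *)
Lemma sgen_orbit f h t : sgen T f h -> 0 <= t -> sgen T (T t f) (T t h).
Proof.
move=> [Hf Hh g] t0; split; [exact: TH|exact: TH|] => e e0.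
have [M M0 hM] := sgM sT t0.
have M1 : 0 < M + 1 by lra.
have [d d0 hd] := g (e / (M + 1)) (divr_gt0 e0 M1); exists d => // x xd.
have x0 : 0 <= x by case/andP: xd => /ltW.
have hr := hd x xd.
have Hxh : H (x *: h) by apply: (sipZ S).
have HTf : H (T x f) by apply: TH.
have HTB := sipB HTf Hf.
have A : T x (T t f) - T t f - x *: T t h ~~ T t (T x f - f - x *: h).
  apply: eqv_sym; apply: eqv_trans (sgB t0 HTB Hxh) _.
  apply: eqvB; last exact: sgZ.
  apply: eqv_trans (sgB t0 HTf Hf) _.
  apply: eqvB; last by apply: eqv_refl; apply: TH.
  apply: eqv_trans (eqv_sym (sgA sT t0 x0 Hf)) _.
  by rewrite addrC; apply: (sgA sT).
rewrite (eqv_ipnorm A); apply: le_trans (hM _ (sipB HTB Hxh)) _.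
apply: le_trans (_ : M * (e / (M + 1) * x) <= _); first exact: ler_wpM2l.
rewrite mulrA ler_wpM2r// mulrA ler_pdivrMr//; nra.
Qed.

Lemma sg_orbit f h t : sgen T f h -> 0 <= t -> forall e, 0 < e ->
  exists2 d, 0 < d & forall x, 0 < x < d ->
    nm (T (t + x) f - T t f - x *: T t h) <= e * x.
Proof.
move=> g t0 e e0; have [_ _ /(_ e e0) [d d0 hd]] := sgen_orbit g t0.
have [Hf Hh _] := g.
exists d => // x xd; have x0 : 0 <= x by case/andP: xd => /ltW.
rewrite (le_trans _ (hd x xd))// le_eqVlt; apply/orP; left; apply/eqP.
apply: eqv_ipnorm; apply: eqvB; last first.
  by apply: eqv_refl; apply: (sipZ S); apply: TH.
apply: eqvB; last by apply: eqv_refl; apply: TH.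
by rewrite addrC; apply: (sgA sT).
Qed.

Lemma sgen_cl f h : sgen T f h -> domain_closure T f.
Proof.
move=> g; have [Hf _ _] := g; split=> // e e0; exists f; split.
  by exists h.
by have [_ _ ->] := eqv_refl Hf; apply: ltW.
Qed.

Lemma domain_closure_of_gen f : H f ->
  (forall e, 0 < e -> exists g, domain_closure T g /\ nm (f - g) <= e) -> domain_closure T f.
Proof.
move=> Hf c; split=> // e e0.
have e2 : 0 < e / 2 by lra.
have [g [[Hg cg] fg]] := c _ e2.
have [k [[h gk] gk']] := cg _ e2; exists k; split; first by exists h.
have [Hk _ _] := gk.
apply: le_trans (ipnorm_dist_tri Hf Hg Hk) _; lra.
Qed.

Lemma domain_closureD f g : domain_closure T f -> domain_closure T g -> domain_closure T (f + g).
Proof.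
move=> [Hf cf] [Hg cg]; split; first exact: (sipD S).
move=> e e0; have e2 : 0 < e / 2 by lra.
have [f' [[hf gf] fe]] := cf _ e2; have [g' [[hg gg] ge]] := cg _ e2.
have [Hf' Hhf df] := gf; have [Hg' Hhg dg] := gg.
exists (f' + g'); split; last first.
  rewrite opprD addrACA (le_trans (ipnormD (sipB Hf Hf') (sipB Hg Hg')))//; lra.
exists (hf + hg); split; [exact: (sipD S)|exact: (sipD S)|].
move=> x x0; have x2 : 0 < x / 2 by lra.
have [d1 d10 h1] := df _ x2; have [d2 d20 h2] := dg _ x2.
exists (Num.min d1 d2); first by rewrite lt_min d10.
move=> y /andP[y0]; rewrite lt_min => /andP[y1 y2].
have y0' := ltW y0.
have {}h1 := h1 y; have {}h2 := h2 y; rewrite y0 y1 in h1; rewrite y0 y2 in h2.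
have {}h1 := h1 erefl; have {}h2 := h2 erefl.
have A1 : H (T y f' - f' - y *: hf).
  by apply: sipB; [apply: sipB => //; apply: TH|apply: (sipZ S)].
have A2 : H (T y g' - g' - y *: hg).
  by apply: sipB; [apply: sipB => //; apply: TH|apply: (sipZ S)].
suff /eqv_ipnorm -> : T y (f' + g') - (f' + g') - y *: (hf + hg) ~~
    (T y f' - f' - y *: hf) + (T y g' - g' - y *: hg).
  apply: le_trans (ipnormD A1 A2) _; lra.
rewrite scalerDr.
have -> : (T y f' - f' - y *: hf) + (T y g' - g' - y *: hg) =
   (T y f' + T y g') - (f' + g') - (y *: hf + y *: hg).
  by rewrite !opprD addrACA; congr (_ + _); apply: addrACA.
apply: eqvB; last first.
  by apply: eqv_refl; apply: (sipD S); apply: (sipZ S).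
apply: eqvB; last by apply: eqv_refl; apply: (sipD S).
exact: sgD.
Qed.

Lemma domain_closureZ a f : domain_closure T f -> domain_closure T (a *: f).
Proof.
move=> [Hf cf]; split; first exact: (sipZ S).
move=> e e0.
have a1 : 0 < `|a| + 1 by have := normr_ge0 a; lra.
have [g [[h gg] ge]] := cf _ (divr_gt0 e0 a1); have [Hg Hh dg] := gg.
exists (a *: g); split; last first.
  rewrite -scalerBr ipnormZ; last exact: sipB.
  apply: le_trans (_ : `|a| * (e / (`|a| + 1)) <= _); first exact: ler_wpM2l.
  rewrite mulrA ler_pdivrMr//; have := normr_ge0 a; nra.
exists (a *: h); split; [exact: (sipZ S)|exact: (sipZ S)|].
move=> x x0; have [d d0 hd] := dg _ (divr_gt0 x0 a1).
exists d => // y yd; have y0 : 0 <= y by case/andP: yd => /ltW.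
have A : H (T y g - g - y *: h).
  by apply: sipB; [apply: sipB => //; apply: TH|apply: (sipZ S)].
suff /eqv_ipnorm -> : T y (a *: g) - a *: g - y *: (a *: h) ~~
    a *: (T y g - g - y *: h).
  rewrite ipnormZ//.
  apply: le_trans (_ : `|a| * (x / (`|a| + 1) * y) <= _).
    by apply: ler_wpM2l => //; apply: hd.
  have -> : `|a| * (x / (`|a| + 1) * y) = x * y * (`|a| / (`|a| + 1)) by ring.
  rewrite ler_piMr ?mulr_ge0 ?(ltW x0)// ler_pdivrMr//; lra.
rewrite !scalerBr !scalerA (mulrC y).
apply: eqvB; last by apply: eqv_refl; apply: (sipZ S).
apply: eqvB; last by apply: eqv_refl; apply: (sipZ S).
exact: sgZ.
Qed.

Lemma domain_closureB f g : domain_closure T f -> domain_closure T g -> domain_closure T (f - g).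
Proof.
by move=> cf cg; rewrite -(scaleN1r g); apply: domain_closureD => //; apply: domain_closureZ.
Qed.

Lemma domain_closure_orbit t f : 0 <= t -> domain_closure T f -> domain_closure T (T t f).
Proof.
move=> t0 [Hf cf]; split; first exact: TH.
move=> e e0; have [M M0 hM] := sgM sT t0.
have M1 : 0 < M + 1 by lra.
have [g [[h gg] fg]] := cf _ (divr_gt0 e0 M1); have [Hg _ _] := gg.
exists (T t g); split; first by exists (T t h); apply: sgen_orbit.
rewrite -(eqv_ipnorm (sgB t0 Hf Hg)).
apply: le_trans (hM _ (sipB Hf Hg)) _.
apply: le_trans (_ : M * (e / (M + 1)) <= _); first exact: ler_wpM2l.
rewrite mulrA ler_pdivrMr//; nra.
Qed.

(** The image of the generator is a limit of difference quotients of elements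
    of its domain. *)
Lemma sgen_cl_image f h : sgen T f h -> domain_closure T h.
Proof.
move=> g; have [Hf Hh df] := g.
apply: domain_closure_of_gen => // e e0; have [d d0 hd] := df e e0.
pose x := d / 2; have x0 : 0 < x by rewrite /x; lra.
have xd : 0 < x < d by rewrite x0 /x; lra.
have x0' := ltW x0.
exists (x^-1 *: (T x f - f)); split.
  apply: domain_closureZ; apply: domain_closureB; last exact: sgen_cl g.
  by apply: domain_closure_orbit => //; apply: sgen_cl g.
have HB : H (T x f - f) by apply: sipB => //; apply: TH.
have HZ : H (x *: h) by apply: (sipZ S).
rewrite ipnorm_distC//; last exact: (sipZ S).
have -> : x^-1 *: (T x f - f) - h = x^-1 *: (T x f - f - x *: h).
  by rewrite [RHS]scalerBr scalerA mulVf ?gt_eqF// scale1r.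
rewrite ipnormZ; last exact: sipB.
rewrite gtr0_norm ?invr_gt0// mulrC ler_pdivrMr//; exact: hd.
Qed.

Variable lam : R.
Hypothesis lam0 : 0 <= lam.
Hypothesis dissip : forall f h, sgen T f h -> ip f h <= - lam * ip f f.

(** Right differentiation of (1 + 2 lam s) |T_s f|^2 gives
    2 lam |u|^2 + 2 (1 + 2 lam s) <u, L u> with u = T_s f, which is at most
    2 lam |u|^2 (1 - (1 + 2 lam s)) <= 0. The polynomial weight is all that is
    needed below, and it avoids exponentials. *)
Lemma sgen_decay f h t : sgen T f h -> 0 <= t ->
  (1 + 2 * lam * t) * nm (T t f) ^+ 2 <= nm f ^+ 2.
Proof.
move=> g t0; have [Hf Hh _] := g.
pose k s := (1 + 2 * lam * s) * nm (T s f) ^+ 2.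
have -> : nm f ^+ 2 = k 0.
  by rewrite /k mulr0 addr0 mul1r (eqv_ipnorm (sg0 sT Hf)).
apply: (@dini_nonincreasing _ k 0 t t0).
  have hc : {within `[0, t], continuous (fun s => nm (T s f))}.
    apply/within_itv_continuousP => s /andP[s0 st] e e0.
    have [d d0 hd] := sgC sT Hf s0 e0; exists d => // x /andP[x0 xt] xs.
    by rewrite (le_lt_trans (ipnorm_dist_norm _ _)) ?hd//; apply: TH.
  move=> s; apply: cvgM; last by apply: cvgM; exact: hc.
  apply: cvgD; first exact: cvg_cst.
  apply: cvgM; first exact: cvg_cst.
  by apply: continuous_subspaceT => ?; exact: cvg_id.
move=> s /andP[s0 st] e e0.
set u := T s f; set h' := T s h.
have Hu : H u by apply: TH.
have Hh' : H h' by apply: TH.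
have dsp : ip u h' <= - lam * ip u u by apply: dissip; apply: sgen_orbit.
have N0 := ipnorm_ge0 u; have N1 := ipnorm_ge0 h'.
pose c := 1 + 2 * lam * (s + 1).
have c0 : 0 < c by rewrite /c; have := mulr_ge0 lam0 s0; have := lam0; lra.
pose q := (nm h' + 1) ^+ 2.
have q0 : 0 < q by rewrite /q; apply: exprn_gt0; lra.
have cq0 : 0 < 2 * c * q by apply: mulr_gt0 => //; lra.
(* The error of the expansion of the orbit contributes c (2 e1 |u| + x q)
   to the difference quotient; e1 and the bound on x share e between them. *)
pose e1 := Num.min 1 (e / (4 * c * (nm u + 1))).
have cu : 0 < 4 * c * (nm u + 1) by rewrite !mulr_gt0//; lra.
have e10 : 0 < e1 by rewrite /e1 lt_min ltr01 divr_gt0.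
have e11 : e1 <= 1 by rewrite /e1 ge_min lexx.
have e12 : e1 * (4 * c * (nm u + 1)) <= e.
  by rewrite -ler_pdivlMr// /e1 ge_min lexx orbT.
have [d d0 hd] := sg_orbit g s0 e10.
exists (Num.min d (Num.min 1 (e / (2 * c * q)))).
  rewrite !lt_min d0 ltr01 /=; exact: divr_gt0.
move=> x /andP[x0]; rewrite !lt_min => /and3P[xd x1].
rewrite ltr_pdivlMr// => xq.
have := hd x; rewrite x0 xd => /(_ erefl).
have Hw : H (T (s + x) f) by apply: TH => //; lra.
have Hxh : H (x *: h') by apply: (sipZ S).
set w := T (s + x) f in Hw *; rewrite -/u -/h'.
set r := w - u - x *: h' => hr.
have Hr : H r by apply: sipB => //; apply: sipB.
have wE : w = u + (x *: h' + r) by rewrite /r [x *: h' + _]addrC subrK addrC subrK.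
have Hxr : H (x *: h' + r) by apply: (sipD S).
have wn : nm w ^+ 2 <= nm u ^+ 2 + x * (- 2 * lam * nm u ^+ 2) +
    x * (2 * e1 * nm u + x * q).
  rewrite wE ipnormD2// ipDr// ipZr//.
  have n1 : nm (x *: h' + r) <= x * (nm h' + 1).
    apply: le_trans (ipnormD Hxh Hr) _; rewrite ipnormZ// gtr0_norm//.
    by rewrite mulrDr mulr1 lerD2l (le_trans hr)// ler_piMl// ltW.
  have n2 : nm (x *: h' + r) ^+ 2 <= x * (x * q).
    have -> : x * (x * q) = (x * (nm h' + 1)) ^+ 2 by rewrite /q; ring.
    rewrite ler_pXn2r ?nnegrE ?ipnorm_ge0//.
    by rewrite ?nnegrE; apply: mulr_ge0; [exact: ltW|lra].
  have n3 : ip u r <= x * (e1 * nm u).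
    apply: le_trans (ler_norm _) _; apply: le_trans (cauchy_schwarz Hu Hr) _.
    by rewrite mulrA [x * e1]mulrC [nm u * _]mulrC ler_wpM2r.
  have n4 : x * ip u h' <= x * (- lam * nm u ^+ 2).
    by rewrite ler_wpM2l ?(ltW x0)// (ipnorm2 u).
  lra.
rewrite /k -/w -/u.
pose c' := 1 + 2 * lam * (s + x).
have c'0 : 0 < c' by rewrite /c'; have := mulr_ge0 lam0 s0; have := mulr_ge0 lam0 (ltW x0); lra.
have lx : lam * x <= lam by rewrite ler_piMr// ltW.
have cc : c' <= c by rewrite /c' /c; lra.
set N := nm u ^+ 2 in wn *; have NN : 0 <= N by apply: sqr_ge0.
set y := 2 * e1 * nm u + x * q in wn.
have xq0 : 0 <= x * q by apply: mulr_ge0; exact: ltW.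
have eu0 : 0 <= e1 * nm u by apply: mulr_ge0 => //; exact: ltW.
have y0 : 0 <= y by rewrite /y; lra.
have cy : c' * y <= e.
  apply: le_trans (_ : c * y <= e); first exact: ler_wpM2r.
  have : c * e1 * nm u <= c * e1 * (nm u + 1).
    by apply: ler_wpM2l; [apply: mulr_ge0; exact: ltW|lra].
  rewrite /y; lra.
have -> : c' * nm w ^+ 2 - (1 + 2 * lam * s) * N =
  c' * (nm w ^+ 2 - N) + 2 * lam * x * N by rewrite /c'; ring.
have c1 : 1 <= c'.
  by rewrite /c'; have := mulr_ge0 lam0 s0; have := mulr_ge0 lam0 (ltW x0); lra.
have z1 : c' * (nm w ^+ 2 - N) <= c' * (x * (- 2 * lam * N) + x * y).
  by apply: ler_wpM2l; [exact: ltW|lra].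
have z2 : 0 <= (c' - 1) * (lam * x * N).
  apply: mulr_ge0; first by rewrite subr_ge0.
  by apply: mulr_ge0 => //; apply: mulr_ge0 => //; exact: ltW.
have z3 : x * (c' * y) <= x * e by rewrite ler_wpM2l// ltW.
lra.
Qed.

Lemma domain_closure_decay f t : domain_closure T f -> 0 <= t ->
  (1 + 2 * lam * t) * nm (T t f) ^+ 2 <= nm f ^+ 2.
Proof.
move=> [Hf cf] t0; have lt := mulr_ge0 lam0 t0.
set c := 1 + 2 * lam * t.
have c0 : 0 <= c by rewrite /c; lra.
pose q := Num.sqrt c; have q0 : 0 <= q by exact: sqrtr_ge0.
have qc : q ^+ 2 = c by rewrite sqr_sqrtr.
rewrite -qc -exprMn ler_pXn2r ?nnegrE ?mulr_ge0 ?ipnorm_ge0//.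
have [M M0 hM] := sgM sT t0.
apply/ler_addgt0Pr => e e0.
have k0 : 0 < 1 + q * M by have := mulr_ge0 q0 M0; lra.
have [g [[h gg] fg]] := cf _ (divr_gt0 e0 k0); have [Hg _ _] := gg.
have HTf := TH t0 Hf; have HTg := TH t0 Hg.
have l1 : nm (T t f) <= nm (T t g) + M * (e / (1 + q * M)).
  apply: le_trans (ipnorm_le_dist HTf HTg) _; rewrite lerD2l.
  rewrite -(eqv_ipnorm (sgB t0 Hf Hg)) (le_trans (hM _ (sipB Hf Hg)))//.
  exact: ler_wpM2l.
have l2 : q * nm (T t g) <= nm g.
  rewrite -(@ler_pXn2r _ 2) ?nnegrE ?mulr_ge0 ?ipnorm_ge0//.
  by rewrite exprMn qc; apply: sgen_decay gg t0.
have l3 : nm g <= nm f + e / (1 + q * M).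
  by rewrite (le_trans (ipnorm_le_dist Hg Hf))// lerD2l ipnorm_distC.
have l4 : q * nm (T t f) <= q * (nm (T t g) + M * (e / (1 + q * M))).
  exact: ler_wpM2l.
have eE : e / (1 + q * M) * (1 + q * M) = e by rewrite divfK// gt_eqF.
lra.
Qed.

Lemma domain_closure_contract f t : domain_closure T f -> 0 <= t -> nm (T t f) <= nm f.
Proof.
move=> cf t0; have h := domain_closure_decay cf t0.
rewrite -(@ler_pXn2r _ 2) ?nnegrE ?ipnorm_ge0// (le_trans _ h)//.
have := mulr_ge0 (mulr_ge0 lam0 t0) (sqr_ge0 (nm (T t f))); lra.
Qed.

End OneSemigroup.

Section TwoSemigroups.
Variables T U : R -> V -> V.
Hypotheses (sT : sgroup T) (sU : sgroup U).
Let TH := sgH sT.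
Let UH := sgH sU.
Variable lam : R.
Hypothesis lam0 : 0 <= lam.
Hypothesis dissT : forall f h, sgen T f h -> ip f h <= - lam * ip f f.
Hypothesis dissU : forall f h, sgen U f h -> ip f h <= - lam * ip f f.
Hypothesis symTU :
  forall f h g k, sgen T f h -> sgen U g k -> ip h g = ip f k.

Let contrT := domain_closure_contract sT lam0 dissT.
Let contrU := domain_closure_contract sU lam0 dissU.

(** The classical duality argument: s |-> <T_s f, U_{t-s} g> has derivative
    <L f', g'> - <f', L g'> = 0 at each s, where f' = T_s f and g' = U_{t-s} g.
    Only its right derivative is computed, hence the terms U_r with
    r = t - s - x. *)
Lemma sgen_sym f h g k t : sgen T f h -> sgen U g k -> 0 <= t ->
  ip (T t f) g = ip f (U t g).
Proof.
move=> gf gg t0; have [Hf Hh _] := gf; have [Hg Hk dg] := gg.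
pose p s := ip (T s f) (U (t - s) g).
have -> : ip (T t f) g = p t.
  rewrite /p subrr; apply: eqv_ip; first exact/eqv_refl/TH.
  exact/eqv_sym/sg0.
have -> : ip f (U t g) = p 0.
  rewrite /p subr0; apply: eqv_ip; first exact/eqv_sym/sg0.
  exact/eqv_refl/UH.
have cT s : 0 <= s -> nm (T s f) <= nm f.
  by apply: contrT; apply: sgen_cl gf.
have cU s : 0 <= s -> nm (U s g) <= nm g.
  by apply: contrU; apply: sgen_cl gg.
have n0 := ipnorm_ge0 f; have m0 := ipnorm_ge0 g.
have nm0 : 0 < nm f + nm g + 1 by lra.
apply: (@dini_constant _ p) => //.
  apply/within_itv_continuousP => s /andP[s0 st] e e0.
  have e10 := divr_gt0 e0 nm0.
  have [d1 d10 h1] := sgC sT Hf s0 e10.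
  have ts0 : 0 <= t - s by lra.
  have [d2 d20 h2] := sgC sU Hg ts0 e10.
  exists (Num.min d1 d2); first by rewrite lt_min d10.
  move=> x /andP[x0 xt]; rewrite lt_min [X in _ && (X < _)]distrC => /andP[x1 x2].
  have tx0 : 0 <= t - x by lra.
  have xs : `|t - x - (t - s)| < d2.
    by have -> : t - x - (t - s) = s - x by ring.
  have {}h1 := h1 _ x0 x1; have {}h2 := h2 _ tx0 xs.
  have := ip_close (TH x0 Hf) (UH tx0 Hg) (TH s0 Hf) (UH ts0 Hg).
  move=> /le_lt_trans; apply.
  have a1 : nm (T x f - T s f) * nm (U (t - x) g) <=
      e / (nm f + nm g + 1) * nm g.
    by apply: ler_pM; rewrite ?ipnorm_ge0 ?cU// ltW.
  have a2 : nm (T s f) * nm (U (t - x) g - U (t - s) g) <=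
      nm f * (e / (nm f + nm g + 1)).
    by apply: ler_pM; rewrite ?ipnorm_ge0 ?cT// ltW.
  have a3 : e = e / (nm f + nm g + 1) * (nm f + nm g + 1).
    by rewrite divfK// gt_eqF.
  lra.
move=> s /andP[s0 st] e e0.
have e10 := divr_gt0 e0 nm0; set e1 := e / _ in e10.
have [d1 d10 h1] := sg_orbit sT gf s0 e10.
have [d2 d20 h2] := dg _ e10.
exists (Num.min (t - s) (Num.min d1 d2)).
  by rewrite !lt_min d10 d20 subr_gt0 st.
move=> x /andP[x0]; rewrite !lt_min => /and3P[xts x1 x2].
have x0' := ltW x0.
pose r := t - s - x; have r0 : 0 <= r by rewrite /r; lra.
have sx0 : 0 <= s + x by lra.
have {}h1 := h1 x; rewrite x0 x1 in h1; have {}h1 := h1 erefl.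
have {}h2 := h2 x; rewrite x0 x2 in h2; have {}h2 := h2 erefl.
have HTs := TH s0 Hf; have HTsx := TH sx0 Hf.
have HTh := TH s0 Hh; have Hxh : H (x *: T s h) by apply: (sipZ S).
have HUx := UH x0' Hg; have Hxk : H (x *: k) by apply: (sipZ S).
set rho := T (s + x) f - T s f - x *: T s h in h1.
have Hrho : H rho by apply: sipB => //; apply: sipB.
set sig := U x g - g - x *: k in h2.
have Hsig : H sig by apply: sipB => //; apply: sipB.
have HUr := UH r0 Hg; have HUrk := UH r0 Hk; have HUrs := UH r0 Hsig.
have HxUk : H (x *: U r k) by apply: (sipZ S).
have clsig : domain_closure U sig.
  apply: domain_closureB => //; last by apply: domain_closureZ => //; apply: sgen_cl_image gg.
  apply: domain_closureB => //; last exact: sgen_cl gg.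
  by apply: domain_closure_orbit => //; apply: sgen_cl gg.
have nsig : nm (U r sig) <= e1 * x.
  by rewrite (le_trans _ h2)//; apply: contrU.
have p1 : p (s + x) = ip (T s f) (U r g) + x * ip (T s h) (U r g) + ip rho (U r g).
  rewrite /p opprD addrA -/r.
  have -> : T (s + x) f = T s f + x *: T s h + rho.
    by rewrite /rho -(addrA (T (s + x) f)) -opprD [RHS]addrC subrK.
  rewrite (ipDl S (sipD S HTs Hxh) Hrho HUr) (ipDl S HTs Hxh HUr).
  by rewrite (ipZl S).
have p2 : p s = ip (T s f) (U r g) + x * ip (T s f) (U r k) + ip (T s f) (U r sig).
  rewrite /p.
  have : U (t - s) g ~~ U r g + x *: U r k + U r sig.
    have -> : t - s = r + x by rewrite /r subrK.
    apply: eqv_trans (sgA sU r0 x0' Hg) _.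
    apply: eqv_sym; apply: eqv_trans (_ : _ ~~ U r (g + x *: k + sig)) _.
      apply: eqv_sym; apply: eqv_trans (sgD sU r0 _ Hsig) _.
        exact: (sipD S).
      apply: eqvD; last exact: eqv_refl.
      apply: eqv_trans (sgD sU r0 Hg Hxk) _.
      by apply: eqvD; [exact: eqv_refl|exact: sgZ].
    have -> : g + x *: k + sig = U x g.
      by rewrite /sig -(addrA (U x g)) -opprD [LHS]addrC subrK.
    by apply: eqv_refl; apply: UH.
  move=> /(eqv_ip (eqv_refl HTs)) ->.
  rewrite (ipDr (sipD S HUr HxUk) HUrs HTs) (ipDr HUr HxUk HTs).
  by rewrite ipZr.
have sy : ip (T s h) (U r g) = ip (T s f) (U r k).
  by apply: symTU; apply: sgen_orbit.
have -> : p (s + x) - p s = ip rho (U r g) - ip (T s f) (U r sig).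
  by rewrite p1 p2 sy; ring.
apply: le_trans (ler_normB _ _) _.
have b1 : `|ip rho (U r g)| <= e1 * x * nm g.
  apply: le_trans (cauchy_schwarz Hrho HUr) _.
  by apply: ler_pM; rewrite ?ipnorm_ge0 ?cU.
have b2 : `|ip (T s f) (U r sig)| <= nm f * (e1 * x).
  apply: le_trans (cauchy_schwarz HTs HUrs) _.
  by apply: ler_pM; rewrite ?ipnorm_ge0 ?cT.
have b3 : e * x = e1 * x * (nm f + nm g + 1).
  by rewrite mulrAC /e1 divfK// gt_eqF.
have := mulr_gt0 e10 x0; lra.
Qed.

(** Both sides are continuous in [f] and [g], because the semigroups contract on
    the closure of their domains. *)
Lemma domain_closure_sym f g t : domain_closure T f -> domain_closure U g -> 0 <= t ->
  ip (T t f) g = ip f (U t g).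
Proof.
move=> cf cg t0; have [Hf hf] := cf; have [Hg hg] := cg.
apply/eqP; rewrite -subr_eq0 -normr_le0; apply/ler_addgt0Pr => e e0.
have n0 := ipnorm_ge0 f; have m0 := ipnorm_ge0 g.
pose c := 2 * (nm f + nm g + 1); have c0 : 0 < c by rewrite /c; lra.
pose e1 := Num.min 1 (e / c).
have e10 : 0 < e1 by rewrite lt_min ltr01 divr_gt0.
have e11 : e1 <= 1 by rewrite ge_min lexx.
have e12 : e1 * c <= e by rewrite -ler_pdivlMr// ge_min lexx orbT.
have [f' [[h gf'] ff']] := hf _ e10; have [g' [[k gg'] gg'e]] := hg _ e10.
have [Hf' _ _] := gf'; have [Hg' _ _] := gg'.
have HTf := TH t0 Hf; have HTf' := TH t0 Hf'.
have HUg := UH t0 Hg; have HUg' := UH t0 Hg'.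
have l1 := ip_close HTf Hg HTf' Hg'.
have l2 := ip_close Hf HUg Hf' HUg'.
have eq := sgen_sym gf' gg' t0.
have cf' := sgen_cl gf'; have cg' := sgen_cl gg'.
have q1 : nm (T t f - T t f') <= e1.
  rewrite -(eqv_ipnorm (sgB sT t0 Hf Hf')) (le_trans _ ff')//.
  by apply: contrT => //; apply: domain_closureB.
have q2 : nm (U t g - U t g') <= e1.
  rewrite -(eqv_ipnorm (sgB sU t0 Hg Hg')) (le_trans _ gg'e)//.
  by apply: contrU => //; apply: domain_closureB.
have q3 : nm (T t f') <= nm f + 1.
  apply: le_trans (contrT cf' t0) _.
  apply: le_trans (ipnorm_le_dist Hf' Hf) _.
  by rewrite ipnorm_distC// lerD2l (le_trans ff').
have q3' : nm f' <= nm f + 1.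
  apply: le_trans (ipnorm_le_dist Hf' Hf) _.
  by rewrite ipnorm_distC// lerD2l (le_trans ff').
have q4 : nm (U t g) <= nm g by apply: contrU.
have r1 : nm (T t f - T t f') * nm g <= e1 * nm g by rewrite ler_wpM2r.
have r2 : nm (T t f') * nm (g - g') <= (nm f + 1) * e1.
  by apply: ler_pM; rewrite ?ipnorm_ge0.
have r3 : nm (f - f') * nm (U t g) <= e1 * nm g.
  by apply: ler_pM; rewrite ?ipnorm_ge0.
have r4 : nm f' * nm (U t g - U t g') <= (nm f + 1) * e1.
  by apply: ler_pM; rewrite ?ipnorm_ge0.
rewrite add0r.
have -> : ip (T t f) g - ip f (U t g) =
  (ip (T t f) g - ip (T t f') g') - (ip f (U t g) - ip f' (U t g')).
  by rewrite eq; ring.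
apply: le_trans (ler_normB _ _) _; rewrite /c in e12.
nra.
Qed.

End TwoSemigroups.
End SemiInner.

(** * Heat content and the gap between two fluxes *)

Section HeatContent.
Variables (R : realType) (V : lmodType R) (H : V -> Prop) (ip : V -> V -> R).
Hypothesis S : semi_inner H ip.
Local Notation nm := (ipnorm ip).
Variables (T : R -> V -> V) (one g1 : V).
Hypothesis sT : sgroup H ip T.
Hypothesis dissT : forall f h, sgen H ip T f h -> ip f h <= - (4 / 3) * ip f f.
Hypothesis symT : forall f h g k,
  sgen H ip T f h -> sgen H ip T g k -> ip h g = ip f k.
Hypothesis gen1 : sgen H ip T g1 (- one).
Hypothesis one1 : ip one one = 1.
Hypothesis g11 : ip g1 g1 <= 1.
Hypothesis g1one : ip g1 one = 1 / 2.
Implicit Types s t r x e b : R.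

(** The amount of heat left at time [t] when the initial temperature is 1. *)
Definition content t := ip (T t one) one.
Definition content1 t := ip (T t g1) one.

Let lam0 : 0 <= 4 / 3 :> R. Proof. lra. Qed.
Let TH := sgH sT.
Let Hg1 : H g1. Proof. by case: gen1. Qed.
Let Hone : H one.
Proof. by case: gen1 => _ h _; rewrite -(opprK one); apply: (sipN S). Qed.
Let cl1 : domain_closure H ip T g1. Proof. exact: (sgen_cl S gen1). Qed.
Let clone : domain_closure H ip T one.
Proof.
rewrite -(opprK one) -scaleN1r; apply: (domain_closureZ S sT).
exact: (sgen_cl_image S sT gen1).
Qed.
Let nmone : nm one = 1. Proof. by rewrite /ipnorm one1 sqrtr1. Qed.

(** Half of the time is moved to the other side of the inner product. *)
Lemma content_normE t : 0 <= t -> content t = nm (T (t / 2) one) ^+ 2.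
Proof.
move=> t0; have t2 : 0 <= t / 2 by lra.
have -> : content t = ip (T (t / 2) (T (t / 2) one)) one.
  apply: (eqv_ip S); last exact: (eqv_refl S).
  by rewrite {1}(splitr t); apply: (sgA sT).
rewrite (domain_closure_sym S sT sT lam0 dissT dissT symT _ clone t2) ?(ipnorm2 S)//.
exact: (domain_closure_orbit S sT).
Qed.

Lemma content_ge0 t : 0 <= t -> 0 <= content t.
Proof. by move=> t0; rewrite content_normE// sqr_ge0. Qed.

Lemma content_double t : 0 <= t -> content t ^+ 2 <= content (2 * t).
Proof.
move=> t0; rewrite [leRHS]content_normE; last by lra.
rewrite mulrAC divff// mul1r.
rewrite ler_pXn2r ?nnegrE ?ipnorm_ge0 ?content_ge0//.
apply: le_trans (ler_norm _) _.
apply: le_trans (cauchy_schwarz S (TH t0 Hone) Hone) _.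
by rewrite nmone mulr1.
Qed.

(** The decay of T_{s/2} 1 over the time (r - s) / 2. *)
Lemma content_drop s r : 0 <= s <= r ->
  (1 + 4 / 3 * (r - s)) * content r <= content s.
Proof.
move=> /andP[s0 sr]; have r0 : 0 <= r by lra.
rewrite !content_normE//.
have s2 : 0 <= s / 2 by lra.
have d0 : 0 <= (r - s) / 2 by lra.
have -> : nm (T (r / 2) one) = nm (T ((r - s) / 2) (T (s / 2) one)).
  apply: (eqv_ipnorm S); have -> : r / 2 = (r - s) / 2 + s / 2 by lra.
  exact: (sgA sT).
have := domain_closure_decay S sT lam0 dissT (domain_closure_orbit S sT s2 clone) d0.
have -> // : 1 + 2 * (4 / 3) * ((r - s) / 2) = 1 + 4 / 3 * (r - s) by lra.
Qed.

Lemma content_noninc s r : 0 <= s <= r -> content r <= content s.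
Proof.
move=> /[dup] /andP[s0 sr] /content_drop h; apply: le_trans _ h.
have r0 : 0 <= r by lra.
have rs : 0 <= r - s by lra.
have := mulr_ge0 rs (content_ge0 r0); lra.
Qed.

Lemma orbit_ip_continuous f k r : H f -> H k ->
  {within `[0, r], continuous (fun t => ip (T t f) k)}.
Proof.
move=> Hf Hk; apply/within_itv_continuousP => s /andP[s0 st] e e0.
have k0 : 0 < nm k + 1 by have := ipnorm_ge0 ip k; lra.
have [d d0 hd] := sgC sT Hf s0 (divr_gt0 e0 k0).
exists d => // x /andP[x0 xr] xs.
rewrite -(ipBl S (TH x0 Hf) (TH s0 Hf) Hk).
apply: le_lt_trans (cauchy_schwarz S _ Hk) _; first by apply: (sipB S); apply: TH.
have := hd x x0 xs; rewrite ltr_pdivlMr//; apply: le_lt_trans.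
by apply: ler_wpM2l; [exact: ipnorm_ge0|lra].
Qed.

(** The image of [g1] under the generator is [- one]. *)
Lemma content1_deriv t e : 0 <= t -> 0 < e -> exists2 d, 0 < d &
  forall x, 0 < x < d -> `|content1 (t + x) - content1 t + x * content t| <= e * x.
Proof.
move=> t0 e0; have [d d0 hd] := sg_orbit S sT gen1 t0 e0.
exists d => // x /[dup] xd /andP[x0 _]; apply: le_trans _ (hd x xd).
have tx0 : 0 <= t + x by lra.
have H1 := TH tx0 Hg1; have H2 := TH t0 Hg1; have H3 := TH t0 Hone.
have H4 : H (T t (- one)) by apply: TH => //; apply: (sipN S).
have H5 : H (x *: T t (- one)) by apply: (sipZ S).
rewrite -[leRHS]mulr1 -nmone.
apply: le_trans _ (cauchy_schwarz S _ Hone); last by do 2 apply: (sipB S) => //.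
rewrite le_eqVlt; apply/orP; left; apply/eqP; congr (`| _ |).
rewrite (ipBl S)//; last exact: (sipB S).
rewrite (ipBl S)// (ipZl S)// /content1 /content.
have -> : ip (T t (- one)) one = - ip (T t one) one.
  rewrite -mulN1r -(ipZl S)//; apply: (eqv_ip S); last exact: (eqv_refl S).
  by rewrite -scaleN1r; apply: (sgZ S sT).
by ring.
Qed.

Let within_sub (p : R -> R) s r : 0 <= s -> {within `[0, r], continuous p} ->
  {within `[s, r], continuous p}.
Proof.
move=> s0; apply: continuous_subspaceW => x /=.
by rewrite !in_itv/= => /andP[sx ->]; rewrite (le_trans s0 sx).
Qed.

(** [content1] decreases at the rate [content t], which is at least
    [content r] up to time [r]. *)
Lemma content1_drop s r : 0 <= s <= r ->
  (r - s) * content r <= content1 s - content1 r.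
Proof.
move=> /andP[s0 sr].
suff : content1 r + r * content r <= content1 s + s * content r by lra.
apply: (@dini_nonincreasing _ (fun t => content1 t + t * content r)) => //.
  move=> t; apply: cvgD.
    by apply: (within_sub s0); apply: orbit_ip_continuous.
  apply: cvgM; last exact: cvg_cst.
  by apply: continuous_subspaceT => ?; exact: cvg_id.
move=> t /andP[st tr] e e0; have t0 : 0 <= t by lra.
have [d d0 hd] := content1_deriv t0 e0.
exists (d) => // x /[dup] xd /andP[x0 _].
have := hd x xd; rewrite ler_norml => /andP[_ h1].
have h2 : x * content r <= x * content t.
  apply: ler_wpM2l; first exact: ltW.
  by apply: content_noninc; rewrite t0 ltW.
lra.
Qed.

(** [content1] starts at 1/2 and decreases at a rate of at most
    [content 0 = 1]. *)
Lemma content1_lower t : 0 <= t -> 1 / 2 - t <= content1 t.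
Proof.
move=> t0.
have c10 : content1 0 = 1 / 2.
  rewrite -g1one; apply: (eqv_ip S); last exact: (eqv_refl S).
  exact: (sg0 sT).
have c0 : content 0 = 1.
  rewrite -one1; apply: (eqv_ip S); last exact: (eqv_refl S).
  exact: (sg0 sT).
suff : - content1 t - t <= - content1 0 - 0 by lra.
apply: (@dini_nonincreasing _ (fun s => - content1 s - s)) => //.
  move=> s; apply: cvgB.
    by apply: cvgN; apply: orbit_ip_continuous.
  by apply: continuous_subspaceT => ?; exact: cvg_id.
move=> s /andP[s0 st] e e0.
have [d d0 hd] := content1_deriv s0 e0.
exists (d) => // x /[dup] xd /andP[x0 _].
have := hd x xd; rewrite ler_norml => /andP[h1 _].
have h2 : x * content s <= x * 1.
  apply: ler_wpM2l; first exact: ltW.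
  by rewrite -c0; apply: content_noninc; rewrite lexx s0.
lra.
Qed.

(** The derivative of [content] is at most - 4/3 [content], which is 4/3 of the
    derivative of [content1]. *)
Lemma content_drop1 s r : 0 <= s <= r ->
  4 / 3 * (content1 s - content1 r) <= content s - content r.
Proof.
move=> /andP[s0 sr].
suff : content r - 4 / 3 * content1 r <= content s - 4 / 3 * content1 s by lra.
apply: (@dini_nonincreasing _ (fun t => content t - 4 / 3 * content1 t)) => //.
  move=> t; apply: cvgB.
    by apply: (within_sub s0); apply: orbit_ip_continuous.
  apply: cvgM; first exact: cvg_cst.
  by apply: (within_sub s0); apply: orbit_ip_continuous.
move=> t /andP[st tr] e e0; have t0 : 0 <= t by lra.
have e20 : 0 < e / 4 by lra.
have [d d0 hd] := content1_deriv t0 e20.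
have := @orbit_ip_continuous one one r Hone Hone.
move=> /within_itv_continuousP /(_ t); rewrite t0 (ltW tr).
move=> /(_ erefl _ e20) [d' d'0 hd'].
exists (Num.min (r - t) (Num.min d d')); first by rewrite !lt_min subr_gt0 tr d0.
move=> x /andP[x0]; rewrite !lt_min => /and3P[xrt xd xd'].
have tx : 0 <= t <= t + x by apply/andP; split; lra.
have := content_drop tx; have -> : t + x - t = x by ring.
have {}hd := hd x; rewrite x0 xd in hd; have := hd erefl.
rewrite ler_norml => /andP[h1 h2].
have := hd' (t + x); have -> : t + x - t = x by ring.
have -> : 0 <= t + x <= r by apply/andP; split; lra.
rewrite gtr0_norm// xd' => /(_ erefl erefl); rewrite ltr_norml => /andP[h3 h4].
rewrite -/(content (t + x)) -/(content t) in h3 h4 *.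
have h5 : x * (content t - content (t + x)) <= x * (e / 4).
  by apply: ler_wpM2l; [exact: ltW|lra].
lra.
Qed.

(** [content - 4/3 content1] is nonincreasing, and it tends to 0 by the decay of
    the orbit of [g1]. *)
Lemma content1_le t : 0 <= t -> 4 / 3 * content1 t <= content t.
Proof.
move=> t0; rewrite -subr_ge0; apply/ler_addgt0Pr => e e0.
(* By decay |T_r g1|^2 <= 1 / (1 + 8 r / 3), so this r makes it at most
   e^2 / 9. *)
pose r := t + 9 / e ^+ 2.
have ee : 0 < e ^+ 2 by rewrite exprn_gt0.
have re : 9 / e ^+ 2 * e ^+ 2 = 9 by rewrite divfK// gt_eqF.
have q0 : 0 <= 9 / e ^+ 2 by rewrite divr_ge0// ltW.
have r0 : 0 <= r by rewrite /r; lra.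
have tr : 0 <= t <= r by rewrite t0 /r; lra.
have h := content_drop1 tr.
have H1 := TH r0 Hone; have H2 := TH r0 Hg1.
have := content_ge0 r0.
have : `|content1 r| <= e / 2.
  apply: le_trans (cauchy_schwarz S H2 Hone) _; rewrite nmone mulr1.
  rewrite -(@ler_pXn2r _ 2) ?nnegrE ?ipnorm_ge0//; last by lra.
  have := domain_closure_decay S sT lam0 dissT cl1 r0; rewrite (ipnorm2 S g1).
  set z := nm (T r g1) ^+ 2 => hz.
  have z0 : 0 <= z by apply: sqr_ge0.
  have rz : 9 / e ^+ 2 * z <= 1.
    have a1 : 0 <= t * z by apply: mulr_ge0.
    have a2 : 0 <= 9 / e ^+ 2 * z by apply: mulr_ge0.
    have := g11; rewrite /r in hz; lra.
  have : 9 * z <= e ^+ 2.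
    have -> : 9 * z = 9 / e ^+ 2 * z * e ^+ 2 by rewrite -{1}re; ring.
    by rewrite ler_piMl// ltW.
  have -> : (e / 2) ^+ 2 = e ^+ 2 / 4 by field.
  lra.
rewrite ler_norml; lra.
Qed.

Lemma content_quarter : 1 / 3 <= content (1 / 4).
Proof.
have h : 0 <= 1 / 4 :> R by lra.
have := content1_le h; have := content1_lower h; lra.
Qed.

(** Iteration of [content_double] from the time 1/4; explicit, because the
    separation constant has to be uniform over all solution families. *)
Lemma content_dyadic n : (1 / 3) ^+ (2 ^ n) <= content (1 / 4 * 2 ^+ n).
Proof.
elim: n => [|n IH]; first by rewrite !expr0 mulr1 expr1 content_quarter.
have h : 0 <= 1 / 4 * 2 ^+ n :> R by rewrite mulr_ge0 ?exprn_ge0//; lra.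
rewrite exprS mulrCA (le_trans _ (content_double h))// expnSr exprM.
have p3 : 0 <= 1 / 3 :> R by lra.
have h3 : 0 <= (1 / 3) ^+ (2 ^ n) :> R by exact: exprn_ge0.
by rewrite ler_pXn2r// ?nnegrE//; exact: content_ge0.
Qed.

Lemma content_gt0_bound t n : 0 <= t <= 1 / 4 * 2 ^+ n ->
  (1 / 3) ^+ (2 ^ n) <= content t.
Proof. by move=> h; rewrite (le_trans (content_dyadic n))// content_noninc. Qed.

(** With P and R for the two contents, s = t / b2 and r = t / b1, the right-hand
    side is (1 + 2 b2) (P(s) - P(r)) - 4 b2 (R(s) - R(r)) +
    (b2 - b1) (2 P(r) - 4 R(r)). By [content_drop1] the first two terms are at
    least 4/3 (1 - b2) (R(s) - R(r)), where 1 - b2 >= a and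
    R(s) - R(r) >= t (b2 - b1) P(r). The last term is at least
    - (b2 - b1) P(r) by [content1_le]. *)
Lemma flux_gap a b1 b2 t : 0 < b1 <= b2 -> b2 <= 1 - a -> 0 <= a -> 0 <= t ->
  (b2 - b1) * content (t / b1) * (4 / 3 * a * t - 1) <=
  ((1 + 2 * b2) * content (t / b2) - 4 * b2 * content1 (t / b2)) -
  ((1 + 2 * b1) * content (t / b1) - 4 * b1 * content1 (t / b1)).
Proof.
move=> /andP[b10 b12] b2a a0 t0.
have b20 : 0 < b2 by lra.
set s := t / b2; set r := t / b1.
have s0 : 0 <= s by apply: divr_ge0 => //; exact: ltW.
have sr : s <= r by rewrite ler_wpM2l// lef_pV2 ?posrE.
have r0 : 0 <= r by lra.
have srb : 0 <= s <= r by rewrite s0 sr.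
have h1 := content_drop1 srb; have h2 := content1_drop srb.
have h3 := content1_le r0; have h4 := content_ge0 r0.
have rs : t * (b2 - b1) <= r - s.
  have -> : r - s = t * (b2 - b1) / (b1 * b2).
    by rewrite /r /s; field; rewrite !gt_eqF.
  have bb : b1 * b2 <= 1 * 1 by apply: ler_pM; lra.
  rewrite mulr1 in bb.
  rewrite ler_pdivlMr ?mulr_gt0// ler_piMr//.
  by apply: mulr_ge0 => //; lra.
have h5 : (1 + 2 * b2) * (4 / 3 * (content1 s - content1 r)) <=
          (1 + 2 * b2) * (content s - content r).
  by apply: ler_wpM2l => //; lra.
have b0 : 0 <= b2 - b1 by lra.
have h6 : (b2 - b1) * (4 / 3 * content1 r) <= (b2 - b1) * content r.
  exact: ler_wpM2l.
have h7 : t * (b2 - b1) * content r <= (r - s) * content r.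
  exact: ler_wpM2r.
have h8 : 0 <= content1 s - content1 r.
  by apply: le_trans h2; apply: mulr_ge0 => //; lra.
have h9 : 4 / 3 * a * (content1 s - content1 r) <=
   4 / 3 * (1 - b2) * (content1 s - content1 r).
  by apply: ler_wpM2r => //; lra.
have h10 : a * (t * (b2 - b1) * content r) <= a * (content1 s - content1 r).
  by apply: ler_wpM2l => //; exact: le_trans h7 h2.
lra.
Qed.

End HeatContent.

(** * L^2 as a semi-inner product space *)

Section L2Inner.
Context d (T : measurableType d) (R : realType).
Variable mu : {measure set T -> \bar R}.
Local Notation Lf := (Lfun mu 2%:E).
Implicit Types f g k : T -> R^o.

Definition inner f g : R := \int[mu]_x (f x * g x).

Lemma Lfun2_measurable f : f \in Lf -> measurable_fun setT f.
Proof. by rewrite inE => /andP[/[!inE]/=]. Qed.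

Lemma inner_integrable f g : f \in Lf -> g \in Lf ->
  mu.-integrable setT (fun x => (f x * g x)%:E).
Proof.
by move=> ff fg; apply/(Lfun1_integrable _ (f \* g)); apply: Lfun2_mul_Lfun1.
Qed.

Lemma semi_inner_L2 : semi_inner (fun f => f \in Lf) inner.
Proof.
split.
- by move=> f g ff fg; apply: (@Lfun_addr_closed _ _ _ mu 2%:E (lee1n 2)).2.
- move=> a f ff.
  have := @Lfun_scale _ _ _ mu f a 2 (ler1n _ 2) ff.
  suff -> : a \o* f = a *: f by [].
  by apply/funext => x /=; rewrite /GRing.scale/= mulrC.
- by move=> f g; apply: eq_Rintegral => x _; rewrite mulrC.
- move=> f g k Hf Hg Hk; rewrite -RintegralD//; try exact: inner_integrable.
  by apply: eq_Rintegral => x _; rewrite -mulrDl.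
- move=> a f k Hf Hk; rewrite -RintegralZl//; try exact: inner_integrable.
  by apply: eq_Rintegral => x _; rewrite mulrA.
- by move=> f; apply: Rintegral_ge0 => x _; rewrite -expr2 sqr_ge0.
Qed.

Lemma Lfun2P f : f \in Lf <->
  measurable_fun setT f /\ mu.-integrable setT (fun x => (f x ^+ 2)%:E).
Proof.
split=> [ff|[mf intf]].
  by split; [exact: Lfun2_measurable|exact: Lfun2_integrable_sqr].
rewrite inE; apply/andP; split; rewrite inE//= /finite_norm unlock /Lnorm.
apply: poweR_lty; move/integrableP : intf => [_]; apply: le_lt_trans.
rewrite le_eqVlt; apply/orP; left; apply/eqP; apply: eq_integral => x _ /=.
by rewrite powR_mulrn// normrX.
Qed.

Lemma Lnorm2_inner f : f \in Lf ->
  Lnorm mu 2%:E (EFin \o f) = (ipnorm inner f)%:E.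
Proof.
move=> ff; rewrite unlock /Lnorm /ipnorm.
have -> : (\int[mu]_x (`|(EFin \o f) x| `^ 2) = (inner f f)%:E)%E.
  rewrite /inner /Rintegral fineK; last first.
    by apply: integrable_fin_num => //; apply: inner_integrable.
  apply: eq_integral => x _ /=.
  by rewrite powR_mulrn// real_normK ?num_real// expr2.
rewrite poweR_EFin; congr (_%:E).
by rewrite -powR12_sqrt//; apply: (ip_ge0 semi_inner_L2).
Qed.

Lemma inner_ae f f' g : f \in Lf -> f' \in Lf -> g \in Lf ->
  f = f' %[ae mu] -> inner f g = inner f' g.
Proof.
move=> Hf Hf' Hg ff; rewrite /inner /Rintegral; congr fine.
apply: ae_eq_integral => //; try exact: measurable_int (inner_integrable _ _).
by apply: filterS ff => x /= + _ => /(_ I) ->.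
Qed.

Lemma ae_eqv f g : f \in Lf -> g \in Lf -> f = g %[ae mu] ->
  eqv (fun f => f \in Lf) inner f g.
Proof.
move=> Hf Hg fg; split=> //; rewrite /ipnorm.
have HB : f - g \in Lf by apply: (sipB semi_inner_L2).
have H0 : 0 \in Lf by rewrite -(subrr f); apply: (sipB semi_inner_L2).
have -> : inner (f - g) (f - g) = inner 0 (f - g).
  apply: inner_ae => //; apply: filterS fg => x /= h _.
  have -> : (f - g) x = f x - g x by [].
  by rewrite h// subrr.
rewrite -(scale0r 0) (ipZl semi_inner_L2)//.
by rewrite mul0r sqrtr0.
Qed.

End L2Inner.

(** * The substitution x = a + (1 - a) y *)

Section Affine.
Context {R : realType}.
Local Notation mu := (@lebesgue_measure R).
Implicit Types (a x y : R).

Lemma leb1_integral a (f : measurableTypeR R -> \bar R) : measurable_fun setT f ->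
  (\int[leb1 a]_x f x = \int[mu]_(x in `]a, 1%R[) f x)%E.
Proof.
move=> mf; have mD : measurable (`]a, 1%R[%classic : set (measurableTypeR R)) by [].
transitivity (\int[leb1 a]_(x in `]a, 1%R[) f x)%E; last first.
  apply: eq_measure_integral => A mA AD /=.
  by rewrite /leb1 /mrestr/= setIidl.
rewrite [RHS]integral_mkcond; apply: ae_eq_integral => //.
  by apply/(measurable_restrictT _ mD); exact: measurable_funTS.
exists (~` `]a, 1%R[%classic); split; first exact: measurableC.
  transitivity (mu (~` `]a, 1%R[%classic `&` `]a, 1%R[%classic)); first by [].
  by rewrite setICl measure0.
by move=> x /= h; apply: contra_not h => xa _; rewrite patchE mem_set.
Qed.

(** The measure [leb1 a] gives no mass to the complement of (a, 1). *)
Lemma leb1_ae a (P : set R) : {ae leb1 a, forall x, P x} <->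
  {ae mu, forall x, x \in `]a, 1%R[ -> P x}.
Proof.
split=> -[N [mN N0 hN]].
  exists (N `&` `]a, 1%R[%classic); split; [exact: measurableI|exact: N0|].
  move=> x /= /not_implyP [xa Px]; split; last exact: xa.
  exact: hN.
exists (N `|` ~` `]a, 1%R[%classic); split.
- by apply: measurableU => //; apply: measurableC.
- transitivity (mu ((N `|` ~` `]a, 1%R[%classic) `&` `]a, 1%R[%classic)); first by [].
  rewrite setIUl setICl setU0.
  apply: subset_measure0 N0 => //; exact: measurableI.
move=> x /= Px; case: (boolP (x \in `]a, 1%R[)) => xa; last by right => /= xa'; rewrite xa' in xa.
by left; apply: hN => /= /(_ xa).
Qed.

Definition affine a y : R := a + (1 - a) * y.
Definition affine_inv a x : R := (x - a) / (1 - a).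

Lemma affineK a : a < 1 -> cancel (affine a) (affine_inv a).
Proof. by move=> a1 y; rewrite /affine /affine_inv; field; lra. Qed.

Lemma affine_invK a : a < 1 -> cancel (affine_inv a) (affine a).
Proof. by move=> a1 y; rewrite /affine /affine_inv; field; lra. Qed.

Lemma affine_itv a y : a < 1 -> (affine a y \in `]a, 1[) = (y \in `]0, 1[).
Proof.
move=> a1; rewrite !in_itv/= /affine; have b0 : 0 < 1 - a by lra.
apply/idP/idP => /andP[h1 h2]; apply/andP; split; nra.
Qed.

Lemma measurable_affine a : measurable_fun setT (affine a : measurableTypeR R -> measurableTypeR R).
Proof. by apply: measurable_funD => //; apply: measurable_funM. Qed.

Lemma measurable_affine_inv a :
  measurable_fun setT (affine_inv a : measurableTypeR R -> measurableTypeR R).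
Proof. by apply: measurable_funM => //; apply: measurable_funB. Qed.

Definition push_affine a (m : {measure set (measurableTypeR R) -> \bar R}) :
    {measure set (measurableTypeR R) -> \bar R} :=
  measure_function_pushforward__canonical__measure_function_Measure m
    (measurable_affine a).

Lemma lebesgue_affine a (a1 : a < 1) (A : set (measurableTypeR R)) :
  measurable A -> (mu A = (1 - a)%:E * mu (affine a @^-1` A))%E.
Proof.
have b0 : 0 < 1 - a by lra.
pose k : {nonneg R} := NngNum (ltW b0).
have := @lebesgue_measure_unique R (mscale k (push_affine a mu)).
move=> h mA; rewrite h//; move=> _ [[p q] _ <-] /=.
rewrite /mscale /= /pushforward.
have -> : affine a @^-1` `]p, q] = `](p - a) / (1 - a), (q - a) / (1 - a)]%classic.
  apply/seteqP; split => y /=; rewrite !in_itv/= ltr_pdivrMr// ler_pdivlMr// /affine.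
    move=> /andP[h1 h2]; apply/andP; split; lra.
  move=> /andP[h1 h2]; apply/andP; split; lra.
rewrite !lebesgue_measure_itv/= !lte_fin ltr_pM2r ?invr_gt0// ltrD2r.
case: ifPn => _; last by rewrite mule0.
by rewrite -!EFinB -EFinM; congr (_%:E); field; lra.
Qed.

Lemma affine_preimage a : a < 1 ->
  affine a @^-1` `]a, 1%R[%classic = `]0, 1%R[%classic.
Proof. by move=> a1; apply/seteqP; split => y /=; rewrite affine_itv. Qed.

Lemma leb1_affine a (a1 : a < 1) (A : set (measurableTypeR R)) :
  measurable A -> (leb1 a A = (1 - a)%:E * leb1 0 (affine a @^-1` A))%E.
Proof.
move=> mA; have mI : measurable (A `&` `]a, 1%R[%classic) by exact: measurableI.
have := lebesgue_affine a1 mI.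
by rewrite preimage_setI affine_preimage.
Qed.

(** Both the Lebesgue measure and its restrictions to (a, 1) and (0, 1) scale
    in this way, hence the two abstract measures. *)
Section Dilate.
Variables (a : R) (m m' : {measure set (measurableTypeR R) -> \bar R}).
Local Notation b := (1 - a).
Hypothesis a1 : a < 1.
Hypothesis mE : forall A : set (measurableTypeR R), measurable A ->
  (m A = b%:E * m' (affine a @^-1` A))%E.
Let b0 : 0 < b. Proof. by rewrite subr_gt0. Qed.

Lemma ge0_integral_dilate (f : measurableTypeR R -> \bar R) :
  measurable_fun setT f -> (forall x, 0 <= f x)%E ->
  (\int[m]_x f x = b%:E * \int[m']_y f (affine a y))%E.
Proof.
move=> mf f0.
pose k : {nonneg R} := NngNum (ltW b0).
have -> : (\int[m]_x f x =
    \int[mscale k (push_affine a (m'))]_x f x)%E.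
  apply: eq_measure_integral => A mA _.
  by rewrite /= mE.
rewrite ge0_integral_mscale//; congr (_ * _)%E.
by rewrite (ge0_integral_pushforward (measurable_affine a)).
Qed.

Lemma integrable_dilate (f : measurableTypeR R -> R) :
  measurable_fun setT f ->
  (m).-integrable setT (EFin \o f) <->
  (m').-integrable setT (EFin \o (f \o affine a)).
Proof.
move=> mf.
have ma : measurable_fun setT (f \o affine a).
  by apply: measurableT_comp => //; exact: measurable_affine.
have mabs : measurable_fun setT (fun x => `|(f x)%:E|%E).
  by apply: measurableT_comp => //; exact/measurable_EFinP.
split=> /integrableP[_ h]; apply/integrableP; split; try exact/measurable_EFinP.
  move: h; rewrite (ge0_integral_dilate mabs)// => h.
  by rewrite -(@lte_pmul2l _ b%:E)// ?lte_fin// (lt_le_trans h)// gt0_muley ?leey.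
rewrite (ge0_integral_dilate mabs)//.
by rewrite lte_mul_pinfty// ?lee_fin ?ltW.
Qed.

Lemma Rintegral_dilate (f : measurableTypeR R -> R) :
  (m).-integrable setT (EFin \o f) ->
  \int[m]_x f x = b * \int[m']_y f (affine a y).
Proof.
move=> intf; have mf : measurable_fun setT f.
  by apply/measurable_EFinP; exact: measurable_int intf.
have intg := (integrable_dilate mf).1 intf.
rewrite /Rintegral.
have -> : (\int[m]_x (f x)%:E = b%:E * \int[m']_y (f (affine a y))%:E)%E.
  have mEf : measurable_fun setT (EFin \o f) by exact/measurable_EFinP.
  rewrite integralE ge0_integral_dilate//; last exact: measurable_funepos.
  rewrite ge0_integral_dilate//; last exact: measurable_funeneg.
  rewrite [X in _ = (_ * X)%E]integralE [RHS]muleBr//.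
    by congr (_ * _ - _ * _)%E; apply: eq_integral => x _; rewrite ?funeposE ?funenegE.
  exact: integrable_add_def.
by rewrite fineM//; apply: integrable_fin_num.
Qed.

End Dilate.

Lemma Rintegral_affine a (a1 : a < 1) (f : measurableTypeR R -> R) :
  (leb1 a).-integrable setT (EFin \o f) ->
  \int[leb1 a]_x f x = (1 - a) * \int[leb1 0]_y f (affine a y).
Proof. exact: (Rintegral_dilate a1 (fun A => @leb1_affine a a1 A)). Qed.

Lemma Rintegral_affine_itv a (a1 : a < 1) p q (f : measurableTypeR R -> R) :
  mu.-integrable `[affine a p, affine a q] (EFin \o f) ->
  \int[mu]_(x in `[affine a p, affine a q]) f x =
  (1 - a) * \int[mu]_(y in `[p, q]) f (affine a y).
Proof.
move=> intf; rewrite Rintegral_mkcond [in RHS]Rintegral_mkcond.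
rewrite (Rintegral_dilate a1 (fun A => @lebesgue_affine a a1 A)).
  congr (_ * _); apply: eq_Rintegral => y _; rewrite !patchE !mem_setE !in_itv/=.
  by rewrite /affine !lerD2l !ler_pM2l ?subr_gt0.
have mI : measurable (`[affine a p, affine a q]%classic : set (measurableTypeR R)).
  exact: measurable_itv.
have := (integrable_mkcond (EFin \o f) mI).1 intf.
by apply: eq_integrable => // x _; rewrite /= !patchE; case: ifP.
Qed.

Lemma L2_affine a (a1 : a < 1) (f : R -> R) :
  L2 a f <-> L2 0 (f \o affine a).
Proof.
split=> /Lfun2P[mf intf]; apply/Lfun2P.
  split; first by apply: measurableT_comp => //; exact: measurable_affine.
  by apply/(@integrable_dilate a (leb1 a) (leb1 0) a1 (fun A => @leb1_affine a a1 A) (fun x => f x ^+ 2)) => //; exact: measurable_funX.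
have mf' : measurable_fun setT (f : measurableTypeR R -> R).
  have -> : f = (f \o affine a) \o affine_inv a.
    by apply/funext => x /=; rewrite affine_invK.
  by apply: measurableT_comp => //; exact: measurable_affine_inv.
split => //.
by apply/(@integrable_dilate a (leb1 a) (leb1 0) a1 (fun A => @leb1_affine a a1 A) (fun x => f x ^+ 2)) => //; exact: measurable_funX.
Qed.

Lemma ipnorm_affine a (a1 : a < 1) (f : R -> R) : L2 a f ->
  ipnorm (inner (leb1 a)) f =
  Num.sqrt (1 - a) * ipnorm (inner (leb1 0)) (f \o affine a).
Proof.
move=> ff; rewrite /ipnorm /inner -sqrtrM; last by lra.
by rewrite Rintegral_affine//; exact: inner_integrable.
Qed.

Lemma ae_affine a (a1 : a < 1) (P : R -> Prop) :
  {ae leb1 a, forall x, P x} <-> {ae leb1 0, forall y, P (affine a y)}.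
Proof.
split=> -[N [mN N0 hN]].
  have mpN : measurable (affine a @^-1` N).
    by rewrite -[X in measurable X]setTI; apply: measurable_affine.
  exists (affine a @^-1` N); split => //; last by move=> y /= Py; apply: hN.
  move: N0; rewrite leb1_affine// => /eqP; rewrite mule_eq0 eqe => /orP[|/eqP//].
  by rewrite subr_eq0 => /eqP e; rewrite -e ltxx in a1.
have mpN : measurable (affine_inv a @^-1` N).
  by rewrite -[X in measurable X]setTI; apply: measurable_affine_inv.
exists (affine_inv a @^-1` N); split => //.
  rewrite leb1_affine//.
  have -> : affine a @^-1` (affine_inv a @^-1` N) = N.
    by apply/seteqP; split => y /=; rewrite affineK.
  by rewrite N0 mule0.
by move=> x /= Px; apply: hN => /=; rewrite affine_invK.
Qed.

End Affine.

(** * Rescaled semigroups *)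

Section Cvg.
Context {R : realType}.

(** Norms in L^2 are extended real numbers; near a limit point where they are
    finite, convergence to 0 can be read on their real values. *)
Lemma cvge0_nearP (F : set_system R) (FF : Filter F) (f : R -> \bar R)
    (g : R -> R) :
  (\forall t \near F, f t = (g t)%:E) ->
  (f t @[t --> F] --> 0%E) <->
  forall e, 0 < e -> \forall t \near F, `|g t| < e.
Proof.
move=> fg; split=> [h|h].
  apply/cvgr0Pnorm_lt; apply: cvg_trans (fine_cvg h).
  apply: near_eq_cvg; apply: (@filterS _ F FF _ _ _ fg) => t /= ->//.
have {}h : g @ F --> (0 : R) by apply/cvgr0Pnorm_lt.
apply: cvg_EFin; first by apply: (@filterS _ F FF _ _ _ fg) => t ->.
apply: cvg_trans h; apply: near_eq_cvg.
by apply: (@filterS _ F FF _ _ _ fg) => t /= ->.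
Qed.

Lemma near_rightP (P : R -> Prop) :
  (\forall t \near 0^'+, P t) <-> exists2 d, 0 < d & forall t, 0 < t < d -> P t.
Proof.
split=> [|[d d0 h]].
  rewrite near_withinE => /nbhs_ballP[d /= d0 h]; exists d => // t /andP[t0 td].
  by apply: h => //; rewrite /ball/= sub0r normrN gtr0_norm.
rewrite near_withinE; apply/nbhs_ballP; exists d => //= t.
rewrite /ball/= sub0r normrN => td t0; apply: h; rewrite t0.
by move: td; rewrite gtr0_norm.
Qed.

Lemma near_within0P (s : R) (P : R -> Prop) : 0 <= s ->
  (\forall t \near within `[0, +oo[ (nbhs s), P t) <->
  exists2 d, 0 < d & forall t, 0 <= t -> `|t - s| < d -> P t.
Proof.
move=> s0; rewrite near_withinE; split=> [/nbhs_ballP[d /= d0 h]|[d d0 h]].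
  exists d => // t t0 ts; apply: h; first by rewrite /ball/= distrC.
  by rewrite in_itv/= t0.
apply/nbhs_ballP; exists d => //= t; rewrite /ball/= distrC in_itv/= andbT.
by move=> ts t0; apply: h.
Qed.

End Cvg.

Section ScaledSemigroup.
Context {R : realType}.
Variables (a : R) (S : R -> (R -> R) -> R -> R).
Hypothesis a1 : a < 1.
Hypothesis SC : C0_semigroup a S.
Local Notation b := (1 - a).
Local Notation V := (measurableTypeR R -> R^o).
Local Notation nm0 := (ipnorm (inner (@leb1 R 0))).
Local Notation nma := (ipnorm (inner (leb1 a))).
Let semi0 := semi_inner_L2 (@leb1 R 0).
Let semia := semi_inner_L2 (leb1 a).

(** The factor [1 - a] in time makes the generator of the rescaled semigroup
    independent of [a]. *)
Definition rescale (t : R) (f : V) : V :=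
  S ((1 - a) * t) (f \o affine_inv a) \o affine a.

Let b0 : 0 < b. Proof. by rewrite subr_gt0. Qed.
Let sb0 : 0 < Num.sqrt b. Proof. by rewrite sqrtr_gt0. Qed.

Lemma L2norm_nm (f : R -> R) : L2 a f -> L2norm a f = (nma f)%:E.
Proof. exact: Lnorm2_inner. Qed.

Lemma L2_affine_inv (f : V) : L2 0 f <-> L2 a (f \o affine_inv a).
Proof.
have fE : f = (f \o affine_inv a) \o affine a.
  by apply/funext => x /=; rewrite affineK.
by rewrite {1}fE; split=> h; apply/(L2_affine a1).
Qed.

Lemma nm0_affine_inv (f : V) : L2 0 f ->
  nma (f \o affine_inv a) = Num.sqrt b * nm0 f.
Proof.
move=> /L2_affine_inv ff; rewrite ipnorm_affine//; congr (_ * ipnorm _ _).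
by apply/funext => x /=; rewrite affineK.
Qed.

Lemma rescale_L2 t f : 0 <= t -> L2 0 f -> L2 0 (rescale t f).
Proof.
move=> t0 /L2_affine_inv ff; apply/(L2_affine a1).
by apply: (C0_L2 SC) => //; rewrite mulr_ge0// ltW.
Qed.

Lemma ae_rescale (f g : R -> R) : f = g %[ae leb1 a] ->
  (f \o affine a : V) = g \o affine a %[ae leb1 0].
Proof.
move=> fg; have {}fg : {ae leb1 a, forall x, f x = g x}.
  case: fg => N [mN N0 hN]; exists N; split => // x /= nx.
  by apply: hN => /= h; apply: nx; exact: h.
have [N [mN N0 hN]] := (ae_affine a1 _).1 fg; exists N; split => // x /= nx.
by apply: hN => /= h; apply: nx.
Qed.

Lemma sgroup_rescale : sgroup (L2 0) (inner (leb1 0)) rescale.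
Proof.
have bt t : 0 <= t -> 0 <= b * t by move=> t0; rewrite mulr_ge0// ltW.
split.
- exact: rescale_L2.
- move=> t k f g t0 Hf Hg.
  have Hf' := (L2_affine_inv f).1 Hf; have Hg' := (L2_affine_inv g).1 Hg.
  apply: ae_eqv.
  + by apply: rescale_L2 => //; apply: (sipD semi0) => //; apply: (sipZ semi0).
  + by apply: (sipD semi0); [apply: (sipZ semi0)|]; apply: rescale_L2.
  + exact: ae_rescale (C0_linear SC k (bt _ t0) Hf' Hg').
- move=> t t0; have [M M0 hM] := C0_bounded SC (bt _ t0).
  exists M => // f Hf; have Hf' := (L2_affine_inv f).1 Hf.
  have HS := C0_L2 SC (bt _ t0) Hf'.
  have := hM _ Hf'; rewrite !L2norm_nm// -EFinM lee_fin.
  rewrite nm0_affine_inv// (ipnorm_affine a1)// mulrCA ler_pM2l//.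
- move=> f Hf; have Hf' := (L2_affine_inv f).1 Hf.
  apply: ae_eqv => //; first exact: rescale_L2.
  have := ae_rescale (C0_id SC Hf'); rewrite /rescale mulr0.
  have -> // : (f \o affine_inv a) \o affine a = f.
  by apply/funext => x /=; rewrite affineK.
- move=> s t f s0 t0 Hf; have Hf' := (L2_affine_inv f).1 Hf.
  apply: ae_eqv; try (do ?apply: rescale_L2 => //; exact: addr_ge0).
  have := ae_rescale (C0_add SC (bt _ s0) (bt _ t0) Hf').
  rewrite /rescale mulrDr.
  have -> // : ((S (b * t) (f \o affine_inv a) \o affine a) \o affine_inv a) =
    S (b * t) (f \o affine_inv a).
  by apply/funext => x /=; rewrite affine_invK.
- move=> f s Hf s0 e e0; have Hf' := (L2_affine_inv f).1 Hf.
  have := C0_continuous SC Hf' (bt _ s0).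
  have nE : \forall t \near within `[0, +oo[ (nbhs (b * s)),
      L2norm a (S t (f \o affine_inv a) \- S (b * s) (f \o affine_inv a)) =
      (nma (S t (f \o affine_inv a) \- S (b * s) (f \o affine_inv a)))%:E.
    apply/(near_within0P _ (bt _ s0)); exists 1 => // t t0 _.
    by rewrite L2norm_nm//; apply: (sipB semia); apply: (C0_L2 SC) => //; exact: bt.
  move=> /(cvge0_nearP _ nE) /(_ (Num.sqrt b * e)).
  rewrite mulr_gt0// => /(_ erefl) /(near_within0P _ (bt _ s0)) [d d0 hd].
  exists (d / b); first by rewrite divr_gt0.
  move=> t t0; rewrite ltr_pdivlMr// => ts.
  have := hd (b * t) (bt _ t0).
  rewrite -mulrBr normrM gtr0_norm// mulrC => /(_ ts).
  rewrite ger0_norm ?ipnorm_ge0// ipnorm_affine//; last first.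
    by apply: (sipB semia); apply: (C0_L2 SC) => //; exact: bt.
  by rewrite ltr_pM2l.
Qed.

(** Time is multiplied by b = 1 - a, so the image is as well; norms on both
    sides differ by the factor sqrt b. *)
Lemma sgen_rescaleP (F h : R -> R) : L2 a F -> L2 a h ->
  infinitesimal_generator a S F h <->
  sgen (L2 0) (inner (leb1 0)) rescale (F \o affine a)
    (b *: (h \o affine a : V)).
Proof.
move=> HF Hh.
have HF0 := (L2_affine a1 F).1 HF; have Hh0 := (L2_affine a1 h).1 Hh.
have FE : (F \o affine a) \o affine_inv a = F.
  by apply/funext => x /=; rewrite affine_invK.
have nE : \forall t \near 0^'+,
    L2norm a (fun x => t^-1 * (S t F x - F x) - h x) =
    (nma (fun x => t^-1 * (S t F x - F x) - h x))%:E.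
  apply/near_rightP; exists 1 => // t /andP[t0 _]; apply: L2norm_nm.
  apply: (sipB semia) => //; apply: (sipZ semia); apply: (sipB semia) => //.
  by apply: (C0_L2 SC) => //; exact: ltW.
have key t : 0 < t ->
    nm0 (rescale t (F \o affine a) - (F \o affine a : V) -
         t *: (b *: (h \o affine a : V))) * Num.sqrt b =
    b * t * nma (fun x => (b * t)^-1 * (S (b * t) F x - F x) - h x).
  move=> t0; have bt0 : 0 < b * t by rewrite mulr_gt0.
  have HS : L2 a (S (b * t) F) by apply: (C0_L2 SC) => //; exact: ltW.
  have HG : L2 a (fun x => (b * t)^-1 * (S (b * t) F x - F x) - h x).
    by apply: (sipB semia) => //; apply: (sipZ semia); apply: (sipB semia).
  rewrite [in RHS](ipnorm_affine a1)// mulrCA mulrC; congr (_ * _).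
  have HG0 := (L2_affine a1 _).1 HG.
  rewrite -[X in _ = X * _]gtr0_norm// -(ipnormZ semi0)//; congr (ipnorm _ _).
  apply/funext => y; rewrite /rescale FE.
  transitivity (S (b * t) F (affine a y) - F (affine a y) - t * (b * h (affine a y))) => //.
  transitivity (b * t * ((b * t)^-1 * (S (b * t) F (affine a y) - F (affine a y)) - h (affine a y))) => //.
  by rewrite mulrBr mulVKf ?gt_eqF// mulrA (mulrC t).
split=> [[_ _ /(cvge0_nearP _ nE) hc]|[_ _ hg]]; split => //.
- exact: (sipZ semi0).
- move=> e e0.
  have /near_rightP[d d0 hd] := hc (e / Num.sqrt b) (divr_gt0 e0 sb0).
  exists (d / b); first by rewrite divr_gt0.
  move=> x /andP[x0]; rewrite ltr_pdivlMr// mulrC => xd.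
  rewrite -(ler_pM2r sb0) key//.
  have := hd (b * x); rewrite mulr_gt0// xd => /(_ erefl).
  rewrite ger0_norm ?ipnorm_ge0// => /ltW h1.
  have -> : e * x * Num.sqrt b = b * x * (e / Num.sqrt b).
    rewrite -{2}(sqr_sqrtr (ltW b0)); field; exact: lt0r_neq0.
  by rewrite ler_pM2l// mulr_gt0.
apply/(cvge0_nearP _ nE) => e e0.
have e2 : 0 < e * Num.sqrt b / 2 by rewrite divr_gt0// mulr_gt0.
have [d d0 hd] := hg _ e2.
apply/near_rightP; exists (b * d); first by rewrite mulr_gt0.
move=> t /andP[t0 td]; pose x := t / b.
have x0 : 0 < x by rewrite divr_gt0.
have tE : t = b * x by rewrite /x mulrC divfK// gt_eqF.
have := hd x; rewrite x0 /x ltr_pdivrMr// mulrC td => /(_ erefl).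
rewrite -/x -(ler_pM2r sb0) key// -tE ger0_norm ?ipnorm_ge0//.
have -> : e * Num.sqrt b / 2 * x * Num.sqrt b = t * (e / 2).
    by rewrite tE -[X in _ = X * x * _](sqr_sqrtr (ltW b0)); field.
rewrite ler_pM2l//; lra.
Qed.

End ScaledSemigroup.

(** * Piecewise quadratic test functions *)

Section TestFunctions.
Context {R : realType}.
Implicit Types (x y z r u : R).

(** A first-order Taylor estimate with quadratic remainder. It replaces the
    calculus of derivatives for the piecewise quadratic functions below. *)
Lemma is_derive_quad (f : R -> R) x d C :
  (forall h, `|f (x + h) - f x - d * h| <= C * h ^+ 2) -> is_derive x 1 f d.
Proof.
move=> H.
have C0 : 0 <= C by have := H 1; have := normr_ge0 (f (x + 1) - f x - d * 1); lra.
suff cf : h^-1 *: (f (h *: 1 + x) - f x) @[h --> 0^'] --> d.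
  apply: DeriveDef; first by apply/cvg_ex; exists d.
  exact: cvg_lim cf.
apply/cvgrPdist_le => e e0; rewrite near_withinE; apply/nbhs_ballP.
exists (e / (C + 1)); first by rewrite /= divr_gt0//; lra.
move=> h; rewrite /ball/= sub0r normrN => he h0.
have -> : d - h^-1 *: (f (h *: 1 + x) - f x) = - (h^-1 * (f (x + h) - f x - d * h)).
  by rewrite /GRing.scale/= mulr1 [h + x]addrC; field.
rewrite normrN normrM normfV ler_pdivrMl ?normr_gt0//.
apply: le_trans (H h) _; rewrite -real_normK ?num_real//.
move: he; rewrite ltr_pdivlMr; last by lra.
have := normr_ge0 h; nra.
Qed.

Lemma is_derive_continuous (f : R -> R) x d :
  is_derive x 1 f d -> {for x, continuous f}.
Proof.
move=> h; apply: differentiable_continuous; apply/derivable1_diffP.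
exact: ex_derive.
Qed.

Definition posp u : R := Num.max 0 u.

Lemma pospE u : posp u = (u + `|u|) / 2.
Proof.
rewrite /posp; case: (leP 0 u) => u0.
  by rewrite ger0_norm//; field.
by rewrite ltr0_norm//; field.
Qed.

Lemma continuous_posp : continuous posp.
Proof.
move=> u; rewrite (_ : posp = fun u => (u + `|u|) / 2); last first.
  by apply/funext => v; exact: pospE.
apply: cvgM; last exact: cvg_cst.
by apply: cvgD; [exact: cvg_id|exact: (@norm_continuous _ R)].
Qed.

Lemma posp2_quad u h :
  `|posp (u + h) ^+ 2 - posp u ^+ 2 - 2 * posp u * h| <= h ^+ 2.
Proof.
rewrite /posp ler_norml.
by case: (leP 0 (u + h)) => h1; case: (leP 0 u) => h2; apply/andP; split; nra.
Qed.

(** A C^1 function that rises from 0 at -1 to 1 at 1; its derivative is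
    [tent]. *)
Definition step u : R :=
  (posp (u + 1) ^+ 2 - 2 * posp u ^+ 2 + posp (u - 1) ^+ 2) / 2.
Definition tent u : R := posp (u + 1) - 2 * posp u + posp (u - 1).

Lemma is_derive_step x r z : 0 < r ->
  is_derive z 1 (fun v => step ((v - x) / r)) (tent ((z - x) / r) / r).
Proof.
move=> r0; apply: (@is_derive_quad _ _ _ (2 / r ^+ 2)) => h.
have -> : (z + h - x) / r = (z - x) / r + h / r by rewrite -mulrDl; congr (_ / _); ring.
set u := (z - x) / r; set k := h / r.
have -> : tent u / r * h = tent u * k by rewrite /k; ring.
have -> : 2 / r ^+ 2 * h ^+ 2 = 2 * k ^+ 2 by rewrite /k; field; rewrite gt_eqF.
have h1 := posp2_quad (u + 1) k; have h2 := posp2_quad u k.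
have h3 := posp2_quad (u - 1) k.
move: h1 h2 h3; rewrite !ler_norml => /andP[? ?] /andP[? ?] /andP[? ?].
rewrite /step /tent (addrAC u k 1) (addrAC u k (-1)).
by apply/andP; split; lra.
Qed.

Lemma continuous_tent : continuous tent.
Proof.
have H k u : posp (v + k) @[v --> u] --> posp (u + k).
  apply: (@continuous_comp _ _ _ (fun v => v + k) posp); last exact: continuous_posp.
  by apply: cvgD; [exact: cvg_id|exact: cvg_cst].
move=> u; apply: cvgD; last exact: H.
apply: cvgB; first exact: H.
by apply: cvgM; [exact: cvg_cst|exact: continuous_posp].
Qed.

Lemma posp_le0 u : u <= 0 -> posp u = 0.
Proof. by move=> u0; apply/max_idPl. Qed.

Lemma posp_ge0 u : 0 <= u -> posp u = u.
Proof. by move=> u0; apply/max_idPr. Qed.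

Lemma step_le0 u : u <= -1 -> step u = 0.
Proof. by move=> h; rewrite /step !posp_le0; [ring|lra|lra|lra]. Qed.

Lemma step_ge1 u : 1 <= u -> step u = 1.
Proof. by move=> h; rewrite /step !posp_ge0; [field|lra|lra|lra]. Qed.

Lemma step_01 u : 0 <= step u <= 1.
Proof.
rewrite /step /posp.
by case: (leP 0 (u + 1)) => ?; case: (leP 0 u) => ?; case: (leP 0 (u - 1)) => ?;
  apply/andP; split; nra.
Qed.

Lemma tent_out u : 1 <= `|u| -> tent u = 0.
Proof.
rewrite ler_normr => /orP h; rewrite /tent /posp.
by case: h => h; case: (leP 0 (u + 1)) => ?; case: (leP 0 u) => ?;
  case: (leP 0 (u - 1)) => ?; lra.
Qed.

Lemma tent_01 u : 0 <= tent u <= 1.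
Proof.
rewrite /tent /posp.
by case: (leP 0 (u + 1)) => ?; case: (leP 0 u) => ?; case: (leP 0 (u - 1)) => ?;
  apply/andP; split; lra.
Qed.

End TestFunctions.

Section Mollify.
Context {R : realType}.
Local Notation mu := (@lebesgue_measure R).
Implicit Types (x y z r u c d : R) (f g : R -> R).

(** A continuous approximate identity at [x]. Continuity, rather than an
    indicator function, is needed because test functions have to be C^1. *)
Definition mollifier x r z : R := tent ((z - x) / r) / r.

Lemma continuous_mollifier x r : 0 < r -> continuous (mollifier x r).
Proof.
move=> r0 z; apply: cvgM; last exact: cvg_cst.
apply: (@continuous_comp _ _ _ (fun v => (v - x) / r) tent); last exact: continuous_tent.
by apply: cvgM; [apply: cvgB; [exact: cvg_id|exact: cvg_cst]|exact: cvg_cst].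
Qed.

Lemma mollifier_out x r z : 0 < r -> r <= `|z - x| -> mollifier x r z = 0.
Proof.
move=> r0 h; rewrite /mollifier tent_out ?mul0r// normrM normfV (gtr0_norm r0).
by rewrite ler_pdivlMr// mul1r.
Qed.

Lemma mollifier_bound x r z : 0 < r -> 0 <= mollifier x r z <= r^-1.
Proof.
move=> r0; rewrite /mollifier; have /andP[h1 h2] := tent_01 ((z - x) / r).
rewrite divr_ge0 ?(ltW r0)//=.
by rewrite ler_pdivrMr// mulVf ?gt_eqF.
Qed.

Lemma integral_mollifier x r : 0 < r ->
  \int[mu]_(z in `[x - r, x + r]) mollifier x r z = 1.
Proof.
move=> r0; rewrite /Rintegral.
rewrite (@continuous_FTC2 _ _ (fun v => step ((v - x) / r))).
- have e1 : (x + r - x) / r = 1 by field; rewrite gt_eqF.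
  have e2 : (x - r - x) / r = - 1 by field; rewrite gt_eqF.
  by rewrite e1 e2 step_ge1// step_le0// sube0.
- lra.
- by apply: continuous_subspaceT; apply: continuous_mollifier.
- split.
  + by move=> z _; have h := is_derive_step x z r0; exact: ex_derive.
  + apply: cvg_at_right_filter; apply: (@is_derive_continuous _ (fun v => step ((v - x) / r)) (x - r)).
    exact: (is_derive_step x (x - r) r0).
  + apply: cvg_at_left_filter; apply: (@is_derive_continuous _ (fun v => step ((v - x) / r)) (x + r)).
    exact: (is_derive_step x (x + r) r0).
- move=> z _; rewrite derive1E.
  by have h := is_derive_step x z r0; exact: derive_val.
Qed.

Lemma measurable_continuous f (D : set R) : measurable D -> continuous f ->
  measurable_fun D f.
Proof. by move=> mD cf; apply: measurable_funTS; apply: continuous_measurable_fun. Qed.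

Lemma integrable_cst_itv c d (k : R) : mu.-integrable `[c, d] (fun=> k%:E).
Proof.
apply: (@continuous_compact_integrable _ (fun=> k)); first exact: segment_compact.
by apply: continuous_subspaceT => ?; exact: cvg_cst.
Qed.

Lemma integrable_mollified f c d x r : 0 < r ->
  mu.-integrable `[c, d] (EFin \o f) ->
  mu.-integrable `[c, d] (fun z => (f z * mollifier x r z)%:E).
Proof.
move=> r0 intf.
apply: (@le_integrable _ _ _ mu `[c, d] _ _ (fun z => (r^-1)%:E * (f z)%:E)%E) => //.
- apply/measurable_EFinP; apply: measurable_funM.
    by apply/measurable_EFinP; exact: measurable_int intf.
  by apply: measurable_continuous => //; exact: continuous_mollifier.
- move=> z _; rewrite -EFinM/= lee_fin (normrM (f z)) (normrM r^-1) mulrC ler_wpM2r//.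
  have /andP[h1 h2] := mollifier_bound x z r0.
  by rewrite ger0_norm// ger0_norm// invr_ge0 ltW.
- exact: integrableZl.
Qed.

(** The mollifier has integral 1 and is at most 1 / r, while the ball has measure
    2 r, hence the factor 2 in front of the mean deviation. *)
Lemma mollify_close f c d x r : 0 < r -> c <= x - r -> x + r <= d ->
  mu.-integrable `[c, d] (EFin \o f) ->
  (`| \int[mu]_(z in `[c, d]) (f z * mollifier x r z) - f x |%:E <=
   2%:E * davg f x r)%E.
Proof.
move=> r0 cx xd intf.
set B := `]x - r, x + r[%classic.
have mB : measurable (B : set (measurableTypeR R)) by exact: measurable_itv.
have BK : B `<=` `[c, d].
  move=> z /=; rewrite !in_itv/= => /andP[h1 h2].
  by rewrite (le_trans cx (ltW h1)) (le_trans (ltW h2) xd).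
have intm : mu.-integrable `[c, d] (fun z => (f z * mollifier x r z)%:E).
  exact: integrable_mollified.
have intfB : mu.-integrable B (EFin \o f) by apply: integrableS intf.
have intcB k : mu.-integrable B (fun=> k%:E).
  by apply: integrableS (integrable_cst_itv c d k).
have -> : \int[mu]_(z in `[c, d]) (f z * mollifier x r z) =
    \int[mu]_(z in B) (f z * mollifier x r z).
  rewrite -[B](setIidr BK) Rintegral_mkcondr; apply: eq_Rintegral => z _.
  rewrite patchE; case: ifPn => // zB.
  rewrite mollifier_out ?mulr0// leNgt; apply/negP => h; case/negP: zB.
  by rewrite inE /B /= in_itv/=; move: h; rewrite ltr_norml; lra.
have intmB : mu.-integrable B (fun z => (f z * mollifier x r z)%:E).
  exact: integrableS intm.
have intfm : mu.-integrable B (fun z => (f x * mollifier x r z)%:E).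
  apply: (@integrableS _ _ _ mu `[c, d] B) => //.
  by apply: (@integrable_mollified (fun=> f x)) => //; exact: integrable_cst_itv.
have intm0 : mu.-integrable `[x - r, x + r] (EFin \o mollifier x r).
  have := @integrable_mollified (fun=> 1) (x - r) (x + r) x r r0 (integrable_cst_itv _ _ _).
  by apply: eq_integrable => // z _; rewrite /= mul1r.
have intm1 : mu.-integrable B (EFin \o mollifier x r).
  apply: integrableS intm0 => //.
  by move=> z; rewrite /B /= !in_itv/= => /andP[/ltW -> /ltW ->].
have fE : f x = \int[mu]_(z in B) (f x * mollifier x r z).
  rewrite RintegralZl//.
  rewrite -[X in _ * X](_ : \int[mu]_(z in `[x - r, x + r]) mollifier x r z = _).
    by rewrite integral_mollifier// mulr1.
  rewrite /B Rintegral_itv_bndo_bndc; last first.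
    by apply: integrableS intm1.
  rewrite Rintegral_itv_obnd_cbnd//.
  apply: integrableS intm0 => //.
  by move=> z /=; rewrite !in_itv/= => /andP[/ltW -> ->].
have intd : mu.-integrable B
    (fun z => (f z * mollifier x r z - f x * mollifier x r z)%:E).
  have := integrableB mB intmB intfm.
  by apply: eq_integrable => // z _; rewrite /= EFinB.
rewrite {1}fE -RintegralB// EFin_normr_Rintegral//.
rewrite /davg /iavg ball_itv -/B.
have -> : mu B = (2 * r)%:E.
  rewrite lebesgue_measure_itv/= lte_fin; case: ifPn => h; last by exfalso; lra.
  by rewrite -EFinB; congr (_%:E); ring.
apply: le_trans (le_abse_integral _ _ _) _ => //.
  exact: measurable_int intd.
have r2 : 0 < 2 * r by lra.
rewrite inver (gt_eqF r2) muleA -EFinM.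
have -> : 2 * (2 * r)^-1 = r^-1 by field; rewrite gt_eqF.
have intc : mu.-integrable B (fun z => (f z - f x)%:E).
  have := integrableB mB intfB (intcB (f x)).
  by apply: eq_integrable => // z _; rewrite /= EFinB.
have mc : measurable_fun B (fun z => (f z - f x)%:E) by exact: measurable_int intc.
rewrite -ge0_integralZl//; last 2 first.
  exact: measurableT_comp.
  by rewrite lee_fin invr_ge0 ltW.
apply: ge0_le_integral => //.
- by apply: measurableT_comp => //; exact: measurable_int intd.
- by apply: measurable_funeM; exact: measurableT_comp.
move=> z _; rewrite -mulrBl /= -EFinM lee_fin normrM mulrC.
have /andP[h1 h2] := mollifier_bound x z r0.
by apply: ler_pM => //; rewrite ger0_norm.
Qed.

Lemma mollify_cvg f c d x (e : R) : c < x < d -> 0 < e ->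
  mu.-integrable `[c, d] (EFin \o f) -> lebesgue_pt f x ->
  \forall r \near 0^'+,
    `| \int[mu]_(z in `[c, d]) (f z * mollifier x r z) - f x | < e.
Proof.
move=> /andP[cx xd] e0 intf fx.
have : (\forall r \near 0^'+, davg f x r < (e / 2)%:E)%E.
  move: fx => /fine_cvgP[h1 /cvgr0Pnorm_lt h2].
  have e2 : 0 < e / 2 by lra.
  have {}h2 := h2 _ e2; near=> r.
  have h3 : davg f x r \is a fin_num by near: r; exact: h1.
  rewrite -(fineK h3) lte_fin; apply: le_lt_trans (ler_norm _) _.
  by near: r; exact: h2.
move=> h; near=> r.
have r0 : 0 < r by near: r; exact: nbhs_right_gt.
have rx : r < x - c by near: r; apply: nbhs_right_lt; lra.
have rd : r < d - x by near: r; apply: nbhs_right_lt; lra.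
have hc : c <= x - r by lra.
have hd : x + r <= d by lra.
rewrite -lte_fin; apply: le_lt_trans (mollify_close r0 hc hd intf) _.
have : (davg f x r < (e / 2)%:E)%E by near: r.
rewrite -(@lte_pmul2l _ 2%:E)// => h2; apply: lt_le_trans h2 _.
by rewrite -EFinM lee_fin; lra.
Unshelve. all: by end_near.
Qed.

End Mollify.

(** * The du Bois-Reymond lemma *)

Section DuBoisReymond.
Context {R : realType}.
Local Notation mu := (@lebesgue_measure R).
Implicit Types (a b x y z r u c d : R) (f g : R -> R).

Lemma locally_integrable_itv a b c d f : a < c -> d < b ->
  locally_integrable `]a, b[ f -> mu.-integrable `[c, d] (EFin \o f).
Proof.
move=> ac db [mf oD lf].
have sub : `[c, d] `<=` `]a, b[.
  by move=> z /=; rewrite !in_itv/= => /andP[h1 h2]; rewrite (lt_le_trans ac h1) (le_lt_trans h2 db).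
apply/integrableP; split.
  by apply/measurable_EFinP; apply: measurable_funS mf.
by apply: lf => //; exact: segment_compact.
Qed.

(** Lebesgue's differentiation theorem is applied to the restrictions of [f] to
    an exhausting sequence of segments. *)
Lemma ae_lebesgue_pt a b f : locally_integrable `]a, b[ f ->
  {ae mu, forall x, x \in `]a, b[ -> lebesgue_pt f x}.
Proof.
move=> lf.
pose e n : R := n.+1%:R^-1.
have e0 n : 0 < e n by rewrite invr_gt0.
pose A n := `[a + e n, b - e n].
have inte n : mu.-integrable [set` A n] (EFin \o f).
  by apply: (@locally_integrable_itv a b) => //; have := e0 n; lra.
have H n : {ae mu, forall x, lebesgue_pt (f \_ [set` A n]) x}.
  apply: lebesgue_differentiation.
  by apply: integrable_locally_restrict => //; exact: measurable_itv.
have := ae_foralln H => -[N [mN N0 hN]]; exists N; split => // x /=.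
move=> /not_implyP[xab nx]; apply: hN => /= h; apply: nx.
move: xab; rewrite in_itv/= => /andP[ax xb].
have [n [h1 h2]] : exists n, e n < x - a /\ e n < b - x.
  have m0 : 0 < Num.min (x - a) (b - x) by rewrite lt_min !subr_gt0 ax xb.
  have [n _ hn] := near_infty_natSinv_lt (PosNum m0).
  exists n; have := hn n (leqnn n) => /=.
  by rewrite lt_min => /andP[].
have := h n; rewrite /lebesgue_pt; apply: cvg_trans.
have xd : x < b - e n by lra.
have cx : a + e n < x by lra.
apply: near_eq_cvg.
have := @near_davg _ f (BLeft (a + e n)) x (b - e n) xd.
rewrite /= lte_fin => /(_ cx).
by apply: filterS => r /= ->.
Qed.

(** A test function that is close to the indicator function of [x, y]; its
    derivative is a difference of two mollifiers. *)
Definition plateau x y r z : R := step ((z - x) / r) - step ((z - y) / r).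

Lemma plateau_test a x y r : 0 < r -> a < x - r -> x < y -> y + r < 1 ->
  C1_test a (plateau x y r) /\
  derive1 (plateau x y r) = (fun z => mollifier x r z - mollifier y r z).
Proof.
move=> r0 ax xy yr.
have D z : is_derive z 1 (plateau x y r) (mollifier x r z - mollifier y r z).
  have h1 := is_derive_step x z r0; have h2 := is_derive_step y z r0.
  exact: is_deriveB.
have dE : derive1 (plateau x y r) = (fun z => mollifier x r z - mollifier y r z).
  by apply/funext => z; rewrite derive1E; have h := D z; exact: derive_val.
split => //; split.
- by move=> z; have h := D z; exact: ex_derive.
- rewrite dE => z; apply: cvgB; exact: continuous_mollifier.
exists (x - r), (y + r); split => // z; rewrite in_itv/= negb_and -!ltNge /plateau.
move=> /orP[h|h].
  by rewrite !step_le0 ?subrr// ler_pdivrMr//; lra.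
by rewrite !step_ge1 ?subrr// ler_pdivlMr//; lra.
Qed.

Lemma plateau_out x y r z : 0 < r -> x < y -> z \notin `[x - r, y + r] ->
  plateau x y r z = 0.
Proof.
move=> r0 xy; rewrite in_itv/= negb_and -!ltNge /plateau.
move=> /orP[h|h].
  by rewrite !step_le0 ?subrr// ler_pdivrMr//; lra.
by rewrite !step_ge1 ?subrr// ler_pdivlMr//; lra.
Qed.

Lemma plateau_close x y r z : 0 < r -> x < y ->
  `|plateau x y r z - \1_(`[x, y]) z| <=
  2 * (\1_(`]x - r, x + r]) z + \1_(`]y - r, y + r]) z).
Proof.
move=> r0 xy; rewrite !indicE !mem_setE !in_itv/= /plateau.
have [/andP[a1 a2] [b1 b2]] := (step_01 ((z - x) / r), andP (step_01 ((z - y) / r))).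
have s1 : z <= x - r -> step ((z - x) / r) = 0.
  by move=> h; rewrite step_le0// ler_pdivrMr//; lra.
have s2 : x + r <= z -> step ((z - x) / r) = 1.
  by move=> h; rewrite step_ge1// ler_pdivlMr//; lra.
have s3 : z <= y - r -> step ((z - y) / r) = 0.
  by move=> h; rewrite step_le0// ler_pdivrMr//; lra.
have s4 : y + r <= z -> step ((z - y) / r) = 1.
  by move=> h; rewrite step_ge1// ler_pdivlMr//; lra.
set i : R := ((x <= z <= y)%R)%:R.
set p := step ((z - x) / r) - step ((z - y) / r).
have i01 : 0 <= i <= 1 by rewrite /i; case: (x <= z <= y)%R; rewrite /= ?lexx ?ler01.
have p2 : `|p - i| <= 2 by case/andP: i01 => ? ?; rewrite ler_norml /p; apply/andP; split; lra.
case: (boolP (x - r < z <= x + r)) => /= [_|].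
  by apply: le_trans p2 _; rewrite mulrDr mulr1 lerDl mulr_ge0.
rewrite negb_and -leNgt -ltNge add0r => hx.
case: (boolP (y - r < z <= y + r)) => /= [_|]; first by rewrite mulr1.
rewrite negb_and -leNgt -ltNge mulr0 normr_le0 subr_eq0 => hy.
apply/eqP; rewrite /p /i.
case/orP: hx => hx.
  rewrite s1// s3; last by lra.
  have -> : (x <= z) = false by apply/negbTE; rewrite -ltNge; lra.
  by rewrite subrr.
rewrite s2; last exact: ltW.
have -> : (x <= z) = true by apply/idP; lra.
case/orP: hy => hy.
  have -> : (z <= y) = true by apply/idP; lra.
  by rewrite s3// subr0.
rewrite s4; last exact: ltW.
have -> : (z <= y) = false by apply/negbTE; rewrite -ltNge; lra.
by rewrite subrr.
Qed.

Lemma integrable_indic g c d (A : set R) : measurable A ->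
  mu.-integrable `[c, d] (EFin \o g) ->
  mu.-integrable `[c, d] (fun z => (g z * \1_A z)%:E).
Proof.
move=> mA intg.
apply: (@le_integrable _ _ _ mu `[c, d] _ _ (EFin \o g)) => //.
  apply/measurable_EFinP; apply: measurable_funM.
    by apply/measurable_EFinP; exact: measurable_int intg.
  exact: measurable_indic.
move=> z _; rewrite /= lee_fin normrM ler_piMr// indicE.
by case: (_ \in _); rewrite /= ?normr1 ?normr0.
Qed.

Lemma Rintegral_indic_small g c d x (e : R) : c < x < d -> 0 < e ->
  mu.-integrable `[c, d] (EFin \o g) ->
  \forall r \near 0^'+,
    `| \int[mu]_(z in `[c, d]) (g z * \1_(`]x - r, x + r]) z) | < e.
Proof.
move=> /andP[cx xd] e0 intg.
pose G z := \int[mu]_(t in `[c, z]) g t.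
have cG : {for x, continuous G}.
  have := parameterized_integral_continuous (ltW (lt_trans cx xd)) intg.
  move=> /continuous_within_itvP -/(_ (lt_trans cx xd)) [h _ _].
  by apply: h; rewrite in_itv/= cx.
have e2 : 0 < e / 2 by lra.
move: cG => /cvgrPdist_lt /(_ _ e2) /nbhs_ballP[k /= k0 hk].
near=> r.
have r0 : 0 < r by near: r; exact: nbhs_right_gt.
have rk : r < k by near: r; exact: nbhs_right_lt.
have rc : r < x - c by near: r; apply: nbhs_right_lt; lra.
have rd : r < d - x by near: r; apply: nbhs_right_lt; lra.
have -> : \int[mu]_(z in `[c, d]) (g z * \1_(`]x - r, x + r]) z) =
    \int[mu]_(z in `]x - r, x + r]) g z.
  have sub : `]x - r, x + r] `<=` `[c, d].
    move=> z /=; rewrite !in_itv/= => /andP[z1 z2].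
    have cr : c <= x - r by lra.
    have dr : x + r <= d by lra.
    by rewrite (le_trans cr (ltW z1)) (le_trans z2 dr).
  rewrite -[X in _ = \int[mu]_(z in X) _](setIidr sub) Rintegral_mkcondr.
  apply: eq_Rintegral => z _; rewrite patchE indicE.
  by case: (_ \in _); rewrite ?mulr1 ?mulr0.
have cr : c <= x + r by lra.
have ig : mu.-integrable `[c, x + r] (EFin \o g).
  apply: (@integrableS _ _ _ mu `[c, d]) => //.
  move=> z /=; rewrite !in_itv/= => /andP[-> z2] /=.
  by apply: le_trans z2 _; lra.
have := @Rintegral_itvB _ g (BLeft c) (BRight (x + r)) (x - r) ig.
rewrite !bnd_simp => <-; [|lra|lra].
rewrite -/(G (x + r)) -/(G (x - r)).
have h1 : ball x k (x + r) by rewrite /ball/= opprD addrA subrr sub0r normrN gtr0_norm.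
have h2 : ball x k (x - r) by rewrite /ball/= opprB addrCA subrr addr0 gtr0_norm.
have := hk _ h1; have := hk _ h2; rewrite /= !ltr_norml => /andP[? ?] /andP[? ?].
by apply/andP; split; lra.
Unshelve. all: by end_near.
Qed.

Lemma Rintegral_itv_support a b c d (k : R -> R) :
  `[c, d] `<=` `]a, b[ -> (forall z, z \notin `[c, d] -> k z = 0) ->
  \int[mu]_(z in `]a, b[) k z = \int[mu]_(z in `[c, d]) k z.
Proof.
move=> sub k0; rewrite -[X in _ = \int[mu]_(z in X) _](setIidr sub).
rewrite Rintegral_mkcondr; apply: eq_Rintegral => z _.
rewrite patchE; case: ifPn => // zcd; apply: k0.
by apply: contra zcd => zcd; rewrite inE.
Qed.

Lemma continuous_plateau x y r : 0 < r -> continuous (plateau x y r).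
Proof.
move=> r0 z; apply: cvgB.
  exact: (@is_derive_continuous _ (fun v => step ((v - x) / r)) z _ (is_derive_step x z r0)).
exact: (@is_derive_continuous _ (fun v => step ((v - y) / r)) z _ (is_derive_step y z r0)).
Qed.

(** The weak derivative tested on a plateau. The right-hand side accounts for
    the difference between the plateau and the indicator function, which lives
    within [r] of the end points. *)
Lemma weak_derivative_plateau a f g c d x y r : weak_derivative a f g ->
  a < c -> d < 1 -> 0 < r -> c <= x - r -> x < y -> y + r <= d ->
  `| \int[mu]_(z in `[c, d]) (f z * mollifier x r z) -
     \int[mu]_(z in `[c, d]) (f z * mollifier y r z) +
     \int[mu]_(z in `[x, y]) g z | <=
  2 * (\int[mu]_(z in `[c, d]) (`|g z| * \1_(`]x - r, x + r]) z) +
       \int[mu]_(z in `[c, d]) (`|g z| * \1_(`]y - r, y + r]) z)).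
Proof.
move=> [lf lg wd] ac d1 r0 cx xy yd.
have intf := locally_integrable_itv ac d1 lf.
have intg := locally_integrable_itv ac d1 lg.
have sub : `[c, d] `<=` `]a, 1[.
  by move=> z /=; rewrite !in_itv/= => /andP[h1 h2]; rewrite (lt_le_trans ac h1) (le_lt_trans h2 d1).
have intw : mu.-integrable `[c, d] (EFin \o (fun z => `|g z|)).
  by have := integrable_abse intg; apply: eq_integrable => // z _.
have axr : a < x - r by exact: lt_le_trans cx.
have yr1 : y + r < 1 by exact: le_lt_trans d1.
have [tphi dphi] := plateau_test r0 axr xy yr1.
have out z : z \notin `[c, d] -> z \notin `[x - r, y + r].
  apply: contra; rewrite !in_itv/= => /andP[h1 h2].
  by rewrite (le_trans cx h1) (le_trans h2 yd).
have := wd _ tphi; rewrite dphi (Rintegral_itv_support sub); last first.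
  move=> z /out; rewrite in_itv/= negb_and -!ltNge => h.
  rewrite !mollifier_out ?subrr ?mulr0// ler_normr.
    by case/orP: h => h; apply/orP; [right|left]; clear -h r0 xy; lra.
  by case/orP: h => h; apply/orP; [right|left]; clear -h r0 xy; lra.
rewrite (Rintegral_itv_support sub); last by move=> z /out h; rewrite plateau_out ?mulr0.
have -> : \int[mu]_(z in `[c, d]) (f z * (mollifier x r z - mollifier y r z)) =
    \int[mu]_(z in `[c, d]) (f z * mollifier x r z) -
    \int[mu]_(z in `[c, d]) (f z * mollifier y r z).
  rewrite -RintegralB//; try exact: integrable_mollified.
  by apply: eq_Rintegral => z _; rewrite mulrBr.
move=> ->.
have intp : mu.-integrable `[c, d] (fun z => (g z * plateau x y r z)%:E).
  apply: (@le_integrable _ _ _ mu `[c, d] _ _ (EFin \o g)) => //.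
    apply/measurable_EFinP; apply: measurable_funM.
      by apply/measurable_EFinP; exact: measurable_int intg.
    by apply: measurable_continuous => //; exact: continuous_plateau.
  move=> z _; rewrite /= lee_fin normrM ler_piMr// /plateau ler_norml.
  have /andP[? ?] := step_01 ((z - x) / r); have /andP[? ?] := step_01 ((z - y) / r).
  by apply/andP; split; lra.
have inti : mu.-integrable `[c, d] (fun z => (g z * \1_(`[x, y]) z)%:E).
  by apply: integrable_indic => //; exact: measurable_itv.
have gE : \int[mu]_(z in `[x, y]) g z = \int[mu]_(z in `[c, d]) (g z * \1_(`[x, y]) z).
  have sub2 : `[x, y] `<=` `[c, d].
    have cx' : c <= x by rewrite (le_trans cx)// lerBlDl lerDr ltW.
    have yd' : y <= d by rewrite (le_trans _ yd)// lerDl ltW.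
    by move=> z /=; rewrite !in_itv/= => /andP[h1 h2]; rewrite (le_trans cx' h1) (le_trans h2 yd').
  rewrite -[X in \int[mu]_(z in X) _ = _](setIidr sub2) Rintegral_mkcondr.
  apply: eq_Rintegral => z _; rewrite patchE indicE.
  by case: (_ \in _); rewrite ?mulr1 ?mulr0.
rewrite addrC gE -RintegralB//.
have i1 := @integrable_indic _ c d `]x - r, x + r]%classic (measurable_itv _) intw.
have i2 := @integrable_indic _ c d `]y - r, y + r]%classic (measurable_itv _) intw.
have mcd : measurable (`[c, d]%classic : set (measurableTypeR R)) by exact: measurable_itv.
have id : mu.-integrable `[c, d]
    (fun z => (g z * plateau x y r z - g z * \1_(`[x, y]) z)%:E).
  by have := integrableB mcd intp inti; apply: eq_integrable => // z _; rewrite /= EFinB.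
have i12 : mu.-integrable `[c, d] (fun z => (`|g z| * \1_(`]x - r, x + r]) z +
      `|g z| * \1_(`]y - r, y + r]) z)%:E).
  by have := integrableD mcd i1 i2; apply: eq_integrable => // z _.
rewrite -RintegralD// -RintegralZl//.
have id' : mu.-integrable `[c, d]
    (fun z => (g z * \1_(`[x, y]) z - g z * plateau x y r z)%:E).
  by have := integrableB mcd inti intp; apply: eq_integrable => // z _; rewrite /= EFinB.
apply: le_trans (le_normr_Rintegral _ _) _ => //.
apply: le_Rintegral => //.
- by have := integrable_abse id'; apply: eq_integrable => // z _.
- by have := integrableZl mcd 2 i12; apply: eq_integrable => // z _.
move=> z _; rewrite distrC -mulrBr normrM -mulrDr mulrCA ler_wpM2l//.
exact: plateau_close.
Qed.

Lemma lebesgue_pt_weak a f g x y : weak_derivative a f g ->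
  a < x -> x < y -> y < 1 -> lebesgue_pt f x -> lebesgue_pt f y ->
  f y - f x = \int[mu]_(z in `[x, y]) g z.
Proof.
move=> wd ax xy y1 fx fy; have [lf lg _] := wd.
have [c [ac cx]] : exists c, a < c /\ c < x by exists ((a + x) / 2); split; lra.
have [d [yd d1]] : exists d, y < d /\ d < 1 by exists ((y + 1) / 2); split; lra.
have intf := locally_integrable_itv ac d1 lf.
have intg := locally_integrable_itv ac d1 lg.
have intw : mu.-integrable `[c, d] (EFin \o (fun z => `|g z|)).
  by have := integrable_abse intg; apply: eq_integrable => // z _.
apply/eqP; rewrite -subr_eq0 -normr_le0; apply/ler_addgt0Pr => e e0; rewrite add0r.
have e6 : 0 < e / 6 by rewrite divr_gt0.
have cxd : c < x < d by rewrite cx (lt_trans xy yd).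
have cyd : c < y < d by rewrite yd (lt_trans cx xy).
have H1 := mollify_cvg cxd e6 intf fx.
have H2 := mollify_cvg cyd e6 intf fy.
have H3 := Rintegral_indic_small cxd e6 intw.
have H4 := Rintegral_indic_small cyd e6 intw.
have H5 : \forall r \near (0 : R)^'+, [/\ 0 < r, c <= x - r & y + r <= d].
  near=> r; split; near: r; first exact: nbhs_right_gt.
    apply/near_rightP; exists (x - c); first by rewrite subr_gt0.
    by move=> r /andP[_ h]; clear -h; lra.
  apply/near_rightP; exists (d - y); first by rewrite subr_gt0.
  by move=> r /andP[_ h]; clear -h; lra.
have [r [J1 J2 J3 J4 [r0 cr dr]]] : exists r,
   [/\ `| \int[mu]_(z in `[c, d]) (f z * mollifier x r z) - f x | < e / 6,
    `| \int[mu]_(z in `[c, d]) (f z * mollifier y r z) - f y | < e / 6,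
    `| \int[mu]_(z in `[c, d]) (`|g z| * \1_(`]x - r, x + r]) z) | < e / 6,
    `| \int[mu]_(z in `[c, d]) (`|g z| * \1_(`]y - r, y + r]) z) | < e / 6 &
    [/\ 0 < r, c <= x - r & y + r <= d]].
  by near (0 : R)^'+ => r; exists r; split; near: r.
have := weak_derivative_plateau wd ac d1 r0 cr xy dr.
move: J1 J2 J3 J4; rewrite !ltr_norml !ler_norml.
move: (Rintegral _ _ _) (Rintegral _ _ _) (Rintegral _ _ _) (Rintegral _ _ _) (Rintegral _ _ _).
move: (f x) (f y); clear => *; lra.
Unshelve. all: by end_near.
Qed.

(** At Lebesgue points of [f] the mollified values converge, so plateaus with
    steeper and steeper flanks give the formula between any two of them. *)
Lemma du_bois_reymond a f g : weak_derivative a f g ->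
  exists2 N : set R, mu.-negligible N & forall x y, a < x -> x < y -> y < 1 ->
    ~ N x -> ~ N y -> f y - f x = \int[mu]_(z in `[x, y]) g z.
Proof.
move=> wd; have [lf lg _] := wd.
have := ae_lebesgue_pt lf => hae.
exists (~` [set x | x \in `]a, 1[ -> lebesgue_pt f x]); first exact: hae.
move=> x y ax xy y1 /contrapT hx /contrapT hy.
apply: (lebesgue_pt_weak wd ax xy y1).
  by apply: hx; rewrite in_itv/= ax (lt_trans xy y1).
by apply: hy; rewrite in_itv/= y1 (lt_trans ax xy).
Qed.

End DuBoisReymond.

(** * The domain of the degenerate operator consists of potentials *)

Section Structure.
Context {R : realType}.
Local Notation mu := (@lebesgue_measure R).
Implicit Types (a b x y z r u c d e : R) (f g h w v : R -> R) (N : set R).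

Lemma near_leftP x (P : R -> Prop) : (\forall z \near x^'-, P z) ->
  exists2 d, 0 < d & forall z, x - d < z < x -> P z.
Proof.
rewrite near_withinE => /nbhs_ballP[d /= d0 h]; exists d => // z /andP[zd zx].
by apply: h => //; rewrite /ball/= gtr0_norm ?subr_gt0// ltrBlDr -ltrBlDl.
Qed.

Lemma negligible_left_dense N c x : mu.-negligible N -> c < x ->
  exists z, [/\ c < z, z < x & ~ N z].
Proof.
move=> [A [mA A0 NA]] cx; apply: contrapT => hz.
have sub : `]c, x[ `<=` A.
  move=> z /=; rewrite in_itv/= => /andP[cz zx]; apply: NA; apply: contrapT => nz.
  by apply: hz; exists z.
have : (mu (`]c, x[%classic : set R) <= 0)%E by rewrite -A0 le_measure// inE.
by rewrite lebesgue_measure_itv/= lte_fin cx -EFinB lee_fin leNgt subr_gt0 cx.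
Qed.

Lemma within_left_cvg a b v x : a < x <= b ->
  {within `[a, b], continuous v} -> v z @[z --> x^'-] --> v x.
Proof.
move=> /andP[ax xb] cv.
have : {within `[a, x], continuous v}.
  apply: continuous_subspaceW cv => z /=; rewrite !in_itv/= => /andP[-> zx] /=.
  exact: le_trans xb.
by move=> /(continuous_within_itvP _ ax)[].
Qed.

(** Every point of (a, b] is a limit from the left of points outside a
    negligible set. *)
Lemma ae_eq_continuous N a b v w : mu.-negligible N ->
  {within `[a, b], continuous v} -> {within `[a, b], continuous w} ->
  (forall z, a < z < b -> ~ N z -> v z = w z) ->
  forall x, a < x <= b -> v x = w x.
Proof.
move=> N0 cv cw vw x axb; have /andP[ax xb] := axb.
have hv := within_left_cvg axb cv; have hw := within_left_cvg axb cw.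
apply/eqP; rewrite -subr_eq0 -normr_le0; apply/ler_addgt0Pr => e e0; rewrite add0r.
have e2 : 0 < e / 2 by rewrite divr_gt0.
have h1 : \forall z \near x^'-, `|v x - v z| < e / 2 by move/cvgrPdist_lt : hv; exact.
have h2 : \forall z \near x^'-, `|w x - w z| < e / 2 by move/cvgrPdist_lt : hw; exact.
have [d1 d10 hd1] := near_leftP h1; have [d2 d20 hd2] := near_leftP h2.
have [z [z1 z2 z3]] : exists z,
    [/\ Num.max a (Num.max (x - d1) (x - d2)) < z, z < x & ~ N z].
  by apply: negligible_left_dense => //; rewrite !gt_max ax !ltrBlDr !ltrDl d10.
move: z1; rewrite !gt_max => /and3P[az zd1 zd2].
have := hd1 z; rewrite zd1 z2 => /(_ erefl).
have := hd2 z; rewrite zd2 z2 => /(_ erefl).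
have -> : v z = w z by apply: vw => //; rewrite az (lt_le_trans z2 xb).
move=> k1 k2; have -> : v x - w x = (v x - w z) - (w x - w z) by ring.
apply: le_trans (ler_normB _ _) _.
by rewrite [leRHS]splitr lerD// ltW.
Qed.

Lemma L2_integrable a h : a < 1 -> L2 a h -> mu.-integrable `[a, 1] (EFin \o h).
Proof.
move=> a1 Hh.
have fin : (leb1 a) setT \is a fin_num.
  change (mu (setT `&` `]a, 1[%classic) \is a fin_num).
  by rewrite setTI lebesgue_measure_itv/= lte_fin a1 -EFinB.
have mh : measurable_fun setT h by exact: Lfun2_measurable Hh.
have /integrableP[_] := (Lfun1_integrable _ _).1 (Lfun_subset12 fin Hh).
have mabs : measurable_fun setT (fun x => `|(h x)%:E|%E).
  by apply: measurableT_comp => //; exact/measurable_EFinP.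
rewrite (leb1_integral a mabs) => hfin.
apply/integrableP; split.
  by apply/measurable_EFinP; apply: measurable_funTS.
rewrite -integral_itv_bndo_bndc; last exact: measurable_funTS.
by rewrite -integral_itv_obnd_cbnd; last exact: measurable_funTS.
Qed.

Definition flow a h z : R := \int[mu]_(t in `[a, z]) h t.
(** The solution of ((x - a) f')' = h with f(1) = 0 and no flux at a. *)
Definition potential a h x : R := - \int[mu]_(z in `[x, 1]) (flow a h z / (z - a)).

Lemma flow_continuous a h : a < 1 -> L2 a h ->
  {within `[a, 1], continuous (flow a h)}.
Proof.
move=> a1 Hh.
exact: (parameterized_integral_continuous (ltW a1) (L2_integrable a1 Hh)).
Qed.

Lemma flow_sub a h x y : a < 1 -> L2 a h -> a < x -> x < y -> y < 1 ->
  \int[mu]_(z in `[x, y]) h z = flow a h y - flow a h x.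
Proof.
move=> a1 Hh ax xy y1; have ih := L2_integrable a1 Hh.
have sub p q : a <= p -> q <= 1 -> mu.-integrable `[p, q] (EFin \o h).
  move=> ap q1; apply: integrableS ih => //; try exact: measurable_itv.
  by move=> z /=; rewrite !in_itv/= => /andP[h1 h2]; rewrite (le_trans ap h1) (le_trans h2 q1).
have iay : mu.-integrable `[a, y] (EFin \o h) by apply: sub => //; exact: ltW.
have := @Rintegral_itvB _ h (BLeft a) (BRight y) x iay.
rewrite !bnd_simp => -> //; [|exact: ltW|exact: ltW].
rewrite Rintegral_itv_obnd_cbnd//.
apply: integrableS iay => //; try exact: measurable_itv.
by move=> z /=; rewrite !in_itv/= => /andP[h1 ->]; rewrite (le_trans (ltW ax) (ltW h1)).
Qed.

Lemma negligible1 x : mu.-negligible [set x].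
Proof. by exists [set x]; split => //; exact: lebesgue_measure_set1. Qed.

(** The function 1 / (z - a) is not integrable at a. To see this without
    logarithms: on [a, a + s] it is at least 1 / s, so that its integral over
    arbitrarily short intervals is at least 1. *)
Lemma integral_weight_contradiction a x0 c (w : R -> R) N : a < x0 -> 0 < c ->
  mu.-integrable `[a, x0] (EFin \o w) -> mu.-negligible N ->
  (forall z, a <= z -> 0 <= w z) ->
  (forall z, a < z < x0 -> ~ N z -> c / (z - a) <= w z) -> False.
Proof.
move=> ax c0 iw N0 w0 hw.
have e0 : 0 < c / 4 by rewrite divr_gt0.
have := parameterized_integral_near_left ax e0 iw.
move=> /nbhs_ballP[d /= d0 hd].
(* The interval [a, a + s] is short enough for the integral of w to be below c. *)
pose s := Num.min (d / 2) (x0 - a).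
have s0 : 0 < s by rewrite lt_min divr_gt0// subr_gt0.
have sd : s < d by rewrite gt_min; apply/orP; left; rewrite ltr_pdivrMr// ltr_pMr// ltr1n.
have sx : s <= x0 - a by rewrite ge_min lexx orbT.
have := hd (a + s); rewrite /ball/= opprD addrA subrr sub0r normrN gtr0_norm//.
rewrite lerDl => /(_ sd (ltW s0)).
rewrite /parameterized_integral.
have mD : measurable (`[a, a + s]%classic : set (measurableTypeR R)) by exact: measurable_itv.
have iws : mu.-integrable `[a, a + s] (EFin \o w).
  apply: integrableS iw => //; try exact: measurable_itv.
  move=> z /=; rewrite !in_itv/= => /andP[-> h] /=; apply: le_trans h _.
  by rewrite -lerBrDl.
have : (\int[mu]_(z in `[a, (a + s)%R]) (c / s)%:E <= \int[mu]_(z in `[a, (a + s)%R]) (w z)%:E)%E.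
  apply: ae_ge0_le_integral => //.
  - by move=> z _; rewrite lee_fin divr_ge0// ltW.
  - by move=> z /=; rewrite in_itv/= lee_fin => /andP[az _]; exact: w0.
  - exact: measurable_int iws.
  have := negligibleU N0 (negligibleU (negligible1 a) (negligible1 (a + s))).
  apply: negligibleS => z /= /not_implyP[]; rewrite in_itv/= => /andP[az zs] nw.
  apply: contrapT => /not_orP[Nz /not_orP[za zas]]; apply: nw.
  have az' : a < z by rewrite lt_neqAle az andbT; apply/eqP => e; apply: za.
  have zs' : z < a + s by rewrite lt_neqAle zs andbT; apply/eqP.
  rewrite lee_fin; apply: le_trans (hw z _ Nz); last first.
    by rewrite az' (lt_le_trans zs')// -lerBrDl.
  by rewrite ler_pM2l// lef_pV2 ?posrE ?subr_gt0// lerBlDl ltW.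
have -> : (\int[mu]_(z in `[a, (a + s)%R]) (c / s)%:E = c%:E)%E.
  have muD : mu (`[a, a + s]%classic : set (measurableTypeR R)) = s%:E.
    rewrite lebesgue_measure_itv/= lte_fin ltrDl s0 -EFinB.
    by congr (_%:E); ring.
  transitivity ((c / s)%:E * mu (`[a, (a + s)%R]%classic : set (measurableTypeR R)))%E.
    exact: integral_cst.
  by rewrite muD -EFinM divfK ?gt_eqF.
rewrite -[X in (_ <= X)%E]fineK; last by exact: integrable_fin_num iws.
rewrite lee_fin -/(Rintegral _ _ _) => h1.
by rewrite ltr_norml => /andP[_ h2]; lra.
Qed.

(** The flux (x - a) g equals c + flow a h for a constant c. If c were nonzero,
    then (x - a) |g|^2 would be at least c^2 / (4 (x - a)) near a, against the
    finiteness of the weighted energy. *)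
Lemma weak_flux_flow a g h : a < 1 ->
  measurable_fun `]a, 1[ g ->
  weak_derivative a (fun x => (x - a) * g x) h -> L2 a h ->
  (\int[lebesgue_measure]_(x in `]a, 1%R[)
       ((x - a) * `|g x| ^+ 2)%:E < +oo)%E ->
  exists2 N, mu.-negligible N &
    forall x, a < x < 1 -> ~ N x -> (x - a) * g x = flow a h x.
Proof.
move=> a1 mg wd Hh fin; have [lv lh _] := wd.
have [N N0 hN] := du_bois_reymond wd.
exists N => // x /andP[ax x1] Nx.
have [c hc] : exists c, forall z, a < z < 1 -> ~ N z -> (z - a) * g z = c + flow a h z.
  exists ((x - a) * g x - flow a h x) => z /andP[az z1] Nz.
  case: (ltgtP z x) => [zx|xz|->]; last by rewrite subrK.
    have := hN _ _ az zx x1 Nz Nx; rewrite (flow_sub a1 Hh)//; lra.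
  have := hN _ _ ax xz z1 Nx Nz; rewrite (flow_sub a1 Hh)//; lra.
suff c0 : c = 0 by rewrite hc ?c0 ?add0r// ax x1.
apply/eqP; apply: contraT => c0.
have cn : 0 < `|c| by rewrite normr_gt0.
have cn2 : 0 < `|c| / 2 by rewrite divr_gt0.
have := parameterized_integral_near_left a1 cn2 (L2_integrable a1 Hh).
move=> /nbhs_ballP[d /= d0 hd].
pose x0 := Num.min (a + d / 2) ((a + 1) / 2).
have ax0 : a < x0 by rewrite lt_min; apply/andP; split; lra.
have x01 : x0 < 1 by rewrite gt_min; apply/orP; right; lra.
have x0d : x0 <= a + d / 2 by rewrite ge_min lexx.
exfalso.
apply: (@integral_weight_contradiction a x0 (`|c| ^+ 2 / 4)
  ((fun z => (z - a) * `|g z| ^+ 2) \_ `]a, 1[) N) => //.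
- by rewrite divr_gt0// exprn_gt0.
- have mD : measurable (`]a, 1[%classic : set (measurableTypeR R)) by exact: measurable_itv.
  have iw : mu.-integrable (`]a, 1[%classic : set (measurableTypeR R))
      (EFin \o (fun z => (z - a) * `|g z| ^+ 2)).
    apply/integrableP; split.
      apply/measurable_EFinP; apply: measurable_funM.
        by apply: measurable_funTS; apply: measurable_funB.
      by apply: measurable_funX; apply: measurableT_comp.
    move: fin; apply: le_lt_trans; rewrite le_eqVlt; apply/orP; left; apply/eqP.
    apply: eq_integral => z; rewrite inE /= in_itv/= => /andP[az _].
    by rewrite ger0_norm// mulr_ge0 ?exprn_ge0// subr_ge0 ltW.
  have := (integrable_mkcond _ mD).1 iw => iw'.
  apply: (@integrableS _ _ _ mu setT) => //.
  move: iw'; apply: eq_integrable => // z _; by rewrite /= !patchE; case: ifP.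
- move=> z az; rewrite patchE; case: ifP => // _.
  by rewrite mulr_ge0 ?exprn_ge0// subr_ge0.
move=> z /andP[az zx0] Nz.
have zd : `|flow a h z| < `|c| / 2.
  apply: hd; last exact: ltW.
  by rewrite /ball/= distrC gtr0_norm ?subr_gt0//; lra.
have z1 : a < z < 1 by rewrite az (lt_trans zx0 x01).
have := hc z z1 Nz => e1.
have za : 0 < z - a by lra.
have e2 : `|c| / 2 <= `|(z - a) * g z|.
  rewrite e1; have := ler_normD (c + flow a h z) (- flow a h z).
  rewrite addrK normrN; lra.
rewrite patchE mem_set /= ?in_itv/= ?az ?z1//; last by case/andP: z1.
rewrite ler_pdivrMr//.
have -> : (z - a) * `|g z| ^+ 2 * (z - a) = `|(z - a) * g z| ^+ 2.
  by rewrite normrM (gtr0_norm za); ring.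
have -> : `|c| ^+ 2 / 4 = (`|c| / 2) ^+ 2 by field.
by rewrite ler_pXn2r ?nnegrE// ltW.
Qed.

Lemma slope_continuous a h c : a < 1 -> L2 a h -> a < c ->
  {within `[c, 1], continuous (fun z => flow a h z / (z - a))}.
Proof.
move=> a1 Hh ac.
have cV : {within `[c, 1], continuous (flow a h)}.
  apply: continuous_subspaceW (flow_continuous a1 Hh) => z /=.
  by rewrite !in_itv/= => /andP[cz ->]; rewrite (le_trans (ltW ac) cz).
have ci : {within `[c, 1], continuous (fun z => (z - a)^-1)}.
  apply: continuous_in_subspaceT => z; rewrite inE/= in_itv/= => /andP[cz _].
  apply: cvgV; first by rewrite subr_eq0 gt_eqF// (lt_le_trans ac cz).
  by apply: cvgB; [exact: cvg_id|exact: cvg_cst].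
by move=> z; apply: cvgM; [exact: cV|exact: ci].
Qed.

Lemma slope_integrable a h c : a < 1 -> L2 a h -> a < c ->
  mu.-integrable `[c, 1] (fun z => (flow a h z / (z - a))%:E).
Proof.
move=> a1 Hh ac.
apply: (@continuous_compact_integrable _ (fun z => flow a h z / (z - a))).
  exact: segment_compact.
exact: slope_continuous.
Qed.

Lemma potential_sub a h x y : a < 1 -> L2 a h -> a < x -> x <= y -> y <= 1 ->
  potential a h y - potential a h x = \int[mu]_(z in `[x, y]) (flow a h z / (z - a)).
Proof.
move=> a1 Hh ax xy y1; have iq := slope_integrable a1 Hh ax.
have := @Rintegral_itvB _ (fun z => flow a h z / (z - a)) (BLeft x) (BRight 1) y iq.
rewrite !bnd_simp => /(_ xy y1).
rewrite Rintegral_itv_obnd_cbnd; last first.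
  apply: integrableS iq => //; try exact: measurable_itv.
  by move=> z /=; rewrite !in_itv/= => /andP[h1 ->]; rewrite (le_trans xy (ltW h1)).
rewrite /potential => <-; ring.
Qed.

Lemma potential1 a h : potential a h 1 = 0.
Proof. by rewrite /potential set_itv1 Rintegral_set1 oppr0. Qed.

Lemma potential_continuous a h c : a < 1 -> L2 a h -> a < c -> c < 1 ->
  {within `[c, 1], continuous (potential a h)}.
Proof.
move=> a1 Hh ac c1; have iq := slope_integrable a1 Hh ac.
have := parameterized_integral_continuous (ltW c1) iq.
rewrite -/(parameterized_integral _ _ _ _) => cp.
apply: (@subspace_eq_continuous _ _ _ (fun z => potential a h c +
   \int[mu]_(t in `[c, z]) (flow a h t / (t - a)))).
  move=> z; rewrite inE/= in_itv/= => /andP[cz z1].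
  by rewrite -(potential_sub a1 Hh ac cz z1); ring.
by move=> z; apply: cvgD; [exact: cvg_cst|exact: cp].
Qed.

(** The function and the potential have the same weak derivative, so the two
    continuous functions differ by a constant on (a, 1]; both vanish at 1. *)
Lemma degenerate_op_potential a f h w : a < 1 -> degenerate_op a f h ->
  w = f %[ae leb1 a] -> {within `]a, 1%R], continuous w} ->
  forall x, a < x <= 1 -> w x = potential a h x.
Proof.
move=> a1 [Hf [g [wdf fin [v [vf cv v1]] Hv [wdv Hh]]]] wf cw.
have [_ [mg _ _] _] := wdf.
have [N1 N10 hN1] := weak_flux_flow a1 mg wdv Hh fin.
have [N2 N20 hN2] := du_bois_reymond wdf.
have aeN (u : R -> R) : u = f %[ae leb1 a] ->
    exists2 N, mu.-negligible N & forall x, a < x < 1 -> ~ N x -> u x = f x.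
  move=> uf; have uf' : {ae leb1 a, forall x, u x = f x}.
    case: uf => N [mN N0 hN]; exists N; split => // x /= nx.
    by apply: hN => /= hx; apply: nx; exact: hx.
  have {}uf := (leb1_ae a (fun x => u x = f x)).1 uf'.
  exists (~` [set x | x \in `]a, 1[ -> u x = f x]); first exact: uf.
  by move=> x xa /contrapT; apply; rewrite in_itv/=.
have [N3 N30 hN3] := aeN _ vf; have [N4 N40 hN4] := aeN _ wf.
have gq x y : a < x -> x < y -> y < 1 ->
    \int[mu]_(z in `[x, y]) g z = \int[mu]_(z in `[x, y]) (flow a h z / (z - a)).
  move=> ax xy y1; rewrite /Rintegral; congr fine.
  have mD : measurable (`[x, y]%classic : set (measurableTypeR R)) by exact: measurable_itv.
  have iq := slope_integrable a1 Hh ax.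
  apply: ae_eq_integral => //.
  - apply/measurable_EFinP; apply: measurable_funS mg => //.
    by move=> z /=; rewrite !in_itv/= => /andP[h1 h2]; rewrite (lt_le_trans ax h1) (le_lt_trans h2 y1).
  - apply: measurable_funS (measurable_int _ iq) => //; try exact: measurable_itv.
    by move=> z /=; rewrite !in_itv/= => /andP[-> h2]; rewrite (le_trans h2 (ltW y1)).
  apply: negligibleS N10 => z /= /not_implyP[]; rewrite in_itv/= => /andP[xz zy] ne.
  apply: contrapT => Nz; apply: ne.
  have az : a < z := lt_le_trans ax xz.
  rewrite -(hN1 z _ Nz) ?az ?(le_lt_trans zy y1)//.
  by rewrite mulrC mulKf// subr_eq0 gt_eqF.
pose N := N1 `|` (N2 `|` (N3 `|` N4)).
have N0 : mu.-negligible N by do ?apply: negligibleU.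
have dif x y : a < x -> x < y -> y < 1 -> ~ N x -> ~ N y ->
    v y - potential a h y = v x - potential a h x.
  move=> ax xy y1 /not_orP[_ /not_orP[x2 /not_orP[x3 _]]]
    /not_orP[_ /not_orP[y2 /not_orP[y3 _]]].
  have := hN2 _ _ ax xy y1 x2 y2; rewrite gq//.
  rewrite -(potential_sub a1 Hh ax (ltW xy) (ltW y1)).
  rewrite -(hN3 x) ?ax ?(lt_trans xy y1)// -(hN3 y) ?y1 ?(lt_trans ax xy)//.
  lra.
have cont (u : R -> R) c : a < c -> {within `]a, 1%R], continuous u} ->
    {within `[c, 1], continuous u}.
  move=> ac; apply: continuous_subspaceW => z /=.
  by rewrite !in_itv/= => /andP[cz ->]; rewrite (lt_le_trans ac cz).
move=> x /andP[ax x1].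
pose c := (a + x) / 2.
have ac : a < c by rewrite /c; lra.
have cx : c < x by rewrite /c; lra.
have c1 : c < 1 := lt_le_trans cx x1.
have [z0 [cz0 z01 Nz0]] := negligible_left_dense N0 c1.
have cp := potential_continuous a1 Hh ac c1.
pose k := v z0 - potential a h z0.
have vk z : c < z < 1 -> ~ N z -> v z = potential a h z + k.
  move=> /andP[cz z1] Nz; rewrite /k.
  case: (ltgtP z z0) => [zz|zz|->]; last by ring.
    by have := dif _ _ (lt_trans ac cz) zz z01 Nz Nz0; lra.
  by have := dif _ _ (lt_trans ac cz0) zz z1 Nz0 Nz; lra.
have ck : {within `[c, 1], continuous (fun z => potential a h z + k)}.
  by move=> z; apply: cvgD; [exact: cp|exact: cvg_cst].
have vE := ae_eq_continuous N0 (cont _ _ ac cv) ck vk.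
have k0 : k = 0.
  by have := vE 1; rewrite c1 lexx => /(_ erefl); rewrite v1 potential1 add0r.
have wE := ae_eq_continuous N0 (cont _ _ ac cw) (cont _ _ ac cv).
rewrite wE ?cx ?x1//; first by rewrite vE ?cx ?x1// k0 addr0.
move=> z /andP[cz z1] /not_orP[_ /not_orP[_ /not_orP[z3 z4]]].
by rewrite hN3 ?(lt_trans ac cz)// hN4 ?(lt_trans ac cz).
Qed.

End Structure.

(** * Integrals over the triangle x <= z *)

Section Triangle.
Context {R : realType}.
Local Notation mu := (@lebesgue_measure R).
Implicit Types (x y z : R) (h k u m : R -> R).
Local Notation I := (`]0, 1]%classic : set (measurableTypeR R)).

Lemma integral_patch_scale (D : set (measurableTypeR R)) u (c : R)
    (f : measurableTypeR R -> \bar R) : measurable D ->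
  mu.-integrable D (EFin \o u) ->
  (forall z, f z = if z \in D then (c * u z)%:E else 0%E) ->
  (\int[mu]_z f z = (c * \int[mu]_(z in D) u z)%:E)%E.
Proof.
move=> mD iu fE.
transitivity (\int[mu]_(z in D) (c%:E * (u z)%:E))%E.
  by rewrite [RHS]integral_mkcond; apply: eq_integral => z _; rewrite fE patchE.
rewrite integralZl// EFinM /Rintegral fineK//.
exact: integrable_fin_num iu.
Qed.

(** The bound on [k z] times the integral of [h] up to [z] is what Tonelli's
    theorem needs; [k] itself may fail to be integrable at 0. *)
Lemma fubini_triangle h k (C : R) :
  mu.-integrable I (EFin \o h) -> measurable_fun I k ->
  (forall x, I x -> mu.-integrable `[x, 1] (EFin \o k)) ->
  (forall z, I z -> `|k z| * \int[mu]_(x in `]0, z]) `|h x| <= C) ->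
  mu.-integrable I (fun x => (h x * \int[mu]_(z in `[x, 1]) k z)%:E) /\
  \int[mu]_(x in I) (h x * \int[mu]_(z in `[x, 1]) k z) =
  \int[mu]_(z in I) (k z * \int[mu]_(x in `]0, z]) h x).
Proof.
move=> ih mk ik bd.
have mI : measurable I by exact: measurable_itv.
pose tri : set (measurableTypeR R * measurableTypeR R) := [set p | p.1 <= p.2].
have mtri : measurable tri.
  have -> : tri = (fun p => p.2 - p.1) @^-1` `[0, +oo[.
    by apply/seteqP; split => p /=; rewrite /tri/= in_itv/= andbT subr_ge0.
  rewrite -[X in measurable X]setTI; apply: measurable_funB => //.
pose h0 := h \_ I; pose k0 := k \_ I.
have mh0 : measurable_fun setT h0.
  by apply/(measurable_restrictT _ mI)/measurable_EFinP; exact: measurable_int ih.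
have mk0 : measurable_fun setT k0 by apply/(measurable_restrictT _ mI).
pose K (p : measurableTypeR R * measurableTypeR R) : \bar R :=
  (h0 p.1 * k0 p.2 * \1_tri p)%:E.
have mK : measurable_fun setT K.
  apply/measurable_EFinP; apply: measurable_funM; last exact: measurable_indic.
  by apply: measurable_funM; [exact: measurableT_comp mh0 _|exact: measurableT_comp mk0 _].
have triE x z : \1_tri (x, z) = ((x <= z)%R)%:R :> R.
  by rewrite indicE; congr (_%:R); congr (nat_of_bool _); apply/idP/idP; rewrite inE.
have itvE p q z : (z \in (`[p, q]%classic : set (measurableTypeR R))) = (p <= z <= q).
  by apply/idP/idP; rewrite inE /= in_itv.
have itvoE p q z : (z \in (`]p, q]%classic : set (measurableTypeR R))) = (p < z <= q).
  by apply/idP/idP; rewrite inE /= in_itv.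
have hE x : x \in I -> h0 x = h x by rewrite /h0 patchE => ->.
have kE z : z \in I -> k0 z = k z by rewrite /k0 patchE => ->.
have E1 x : (\int[mu]_z K (x, z) =
    (((fun x => h x * \int[mu]_(z in `[x, 1]) k z) \_ I) x)%:E)%E.
  rewrite [in RHS]patchE; case: ifPn => xI; last first.
    apply: integral0_eq => z _.
    by rewrite /K/= /h0 patchE (negbTE xI) !mul0r.
  have Ix : I x by rewrite inE in xI.
  apply: integral_patch_scale; [exact: measurable_itv|exact: ik|] => z.
  rewrite /K/= hE// triE itvE; move: xI; rewrite itvoE => /andP[x0 x1].
  case: (boolP (x <= z)) => xz /=; last by rewrite mulr0.
  rewrite mulr1; case: (boolP (z <= 1)) => z1.
    by rewrite kE// itvoE z1 (lt_le_trans x0 xz).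
  by rewrite /k0 patchE itvoE (negbTE z1) andbF mulr0.
have ihz z : mu.-integrable (`]0, z] `&` I) (EFin \o h).
  by apply: integrableS ih => //; apply: measurableI => //; exact: measurable_itv.
have ihz' z : I z -> mu.-integrable `]0, z] (EFin \o h).
  move=> Iz; rewrite -[X in _.-integrable X _](_ : `]0, z] `&` I = _)//.
  apply/seteqP; split=> x /=; first by case.
  move: Iz => /=; rewrite !in_itv/= => /andP[_ z1] /andP[x0 xz].
  by rewrite x0 xz (le_trans xz z1).
have KE x z : I z -> K (x, z) = if x \in (`]0, z]%classic : set (measurableTypeR R))
    then (k z * h x)%:E else 0%E.
  move=> Iz; have zI : z \in I by rewrite inE.
  rewrite /K/= kE// triE itvoE; move: zI; rewrite itvoE => /andP[z0 z1].
  case: (boolP (x <= z)) => xz; last by rewrite andbF mulr0.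
  rewrite mulr1 andbT; case: (boolP (0 < x)) => x0.
    by rewrite hE 1?mulrC// itvoE x0 (le_trans xz z1).
  by rewrite /h0 patchE itvoE (negbTE x0) mul0r.
have E2 z : (\int[mu]_x K (x, z) =
    (((fun z => k z * \int[mu]_(x in `]0, z]) h x) \_ I) z)%:E)%E.
  rewrite [in RHS]patchE; case: ifPn => zI; last first.
    apply: integral0_eq => x _.
    by rewrite /K/= /k0 patchE (negbTE zI) mulr0 mul0r.
  have Iz : I z by rewrite inE in zI.
  apply: integral_patch_scale; [exact: measurable_itv|exact: ihz'|] => x.
  exact: KE.
have iK : (mu \x mu)%E.-integrable setT K.
  apply/integrable21ltyP => //.
  apply: (@le_lt_trans _ _ (\int[mu]_(z in I) `|C|%:E)%E); last first.
    have -> : (\int[mu]_(z in I) `|C|%:E = `|C|%:E * mu I)%E by exact: integral_cst.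
    by rewrite lte_mul_pinfty// lebesgue_measure_itv/= lte_fin ltr01 -EFinB ltry.
  rewrite [leRHS]integral_mkcond; apply: ge0_le_integral => //.
  - by move=> z _; apply: integral_ge0.
  - apply: (@measurable_fun_fubini_tonelli_G _ _ _ _ _ mu (abse \o K)).
      exact: measurableT_comp.
    by move=> p; rewrite /= lee_fin.
  - by apply: (measurable_restrictT (fun=> `|C|%:E%E) mI).1; exact: measurable_cst.
  move=> z _; rewrite patchE; case: ifPn => zI; last first.
    rewrite integral0_eq// => x _.
    by rewrite /K/= /k0 patchE (negbTE zI) mulr0 mul0r normr0.
  have Iz : I z by rewrite inE in zI.
  have -> : (\int[mu]_x `|K (x, z)| = (`|k z| * \int[mu]_(x in `]0, z]) `|h x|)%:E)%E.
    apply: integral_patch_scale; first exact: measurable_itv.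
      by have := integrable_abse (ihz' z Iz); apply: eq_integrable => //; exact: measurable_itv.
    by move=> x; rewrite KE//; case: ifP => _; rewrite /= ?normr0// normrM.
  by rewrite lee_fin (le_trans (bd z Iz))// ler_norm.
split.
  apply/(integrable_mkcond _ mI).
  have := integrable_fubini_F iK; apply: eq_integrable => // x _.
  rewrite /fubini_F E1 !patchE; by case: ifP.
have := Fubini iK.
under eq_integral do rewrite E1.
under [in RHS]eq_integral do rewrite E2.
move=> e; rewrite [LHS]Rintegral_mkcond [RHS]Rintegral_mkcond.
by congr fine; exact: e.
Qed.

(** Expansion of the integral of (u - l m)^2 / m >= 0, with the optimal
    constant l. *)
Lemma Rintegral_cauchy_schwarz (D : set (measurableTypeR R)) u m : measurable D ->
  mu.-integrable D (EFin \o u) -> mu.-integrable D (EFin \o m) ->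
  mu.-integrable D (fun z => (u z ^+ 2 / m z)%:E) ->
  (forall z, D z -> 0 < m z) -> 0 < \int[mu]_(z in D) m z ->
  (\int[mu]_(z in D) u z) ^+ 2 <=
  \int[mu]_(z in D) (u z ^+ 2 / m z) * \int[mu]_(z in D) m z.
Proof.
move=> mD iu im iq m0 M0.
set U := \int[mu]_(z in D) u z; set M := \int[mu]_(z in D) m z in M0 *.
set Q := \int[mu]_(z in D) _; pose l := U / M.
have i1 : mu.-integrable D (fun z => (2 * l * u z)%:E).
  by have := integrableZl mD (2 * l) iu; apply: eq_integrable.
have i2 : mu.-integrable D (fun z => (l ^+ 2 * m z)%:E).
  by have := integrableZl mD (l ^+ 2) im; apply: eq_integrable.
have i3 : mu.-integrable D (fun z => (u z ^+ 2 / m z - 2 * l * u z)%:E).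
  by have := integrableB mD iq i1; apply: eq_integrable => // z _; rewrite /= EFinB.
have : 0 <= \int[mu]_(z in D) (u z ^+ 2 / m z - 2 * l * u z + l ^+ 2 * m z).
  apply: Rintegral_ge0 => z Dz; have mz := m0 z Dz.
  have -> : u z ^+ 2 / m z - 2 * l * u z + l ^+ 2 * m z = (u z - l * m z) ^+ 2 / m z.
    by field; rewrite gt_eqF.
  by rewrite divr_ge0 ?sqr_ge0// ltW.
rewrite RintegralD// RintegralB// !RintegralZl// -/U -/M -/Q.
have -> : Q - 2 * l * U + l ^+ 2 * M = Q - U ^+ 2 / M.
  by rewrite /l; field; rewrite gt_eqF.
by rewrite subr_ge0 ler_pdivrMr.
Qed.

End Triangle.

Section Energy.
Context {R : realType}.
Local Notation mu := (@lebesgue_measure R).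
Implicit Types (x y z : R) (f g h k u : R -> R).
Local Notation I := (`]0, 1]%classic : set (measurableTypeR R)).
Local Notation inner0 := (inner (@leb1 R 0)).

Let mI : measurable I. Proof. exact: measurable_itv. Qed.

Lemma L2_measurable h : L2 0 h -> measurable_fun setT (h : measurableTypeR R -> R).
Proof. exact: Lfun2_measurable. Qed.

Lemma leb1_Rintegral u : measurable_fun setT (u : measurableTypeR R -> R) ->
  \int[leb1 0]_x u x = \int[mu]_(x in I) u x.
Proof.
move=> mu_; rewrite /Rintegral (leb1_integral 0); last exact/measurable_EFinP.
by rewrite integral_itv_bndo_bndc//; apply/measurable_EFinP/measurable_funTS.
Qed.

Lemma inner0E f g : L2 0 f -> L2 0 g -> inner0 f g = \int[mu]_(x in I) (f x * g x).
Proof.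
by move=> Hf Hg; rewrite -leb1_Rintegral//; apply: measurable_funM; apply: L2_measurable.
Qed.

Lemma leb1_integrable u : measurable_fun setT (u : measurableTypeR R -> R) ->
  (leb1 0).-integrable setT (EFin \o u) <-> mu.-integrable I (EFin \o u).
Proof.
move=> mu_; have mabs : measurable_fun setT (fun x : measurableTypeR R => `|(u x)%:E|%E).
  by apply: measurableT_comp => //; exact/measurable_EFinP.
split=> /integrableP[_ fin]; apply/integrableP; split.
- by apply/measurable_EFinP/measurable_funTS.
- move: fin; rewrite (leb1_integral 0 mabs) -integral_itv_bndo_bndc//.
  exact: measurable_funTS.
- exact/measurable_EFinP.
- rewrite (leb1_integral 0 mabs) integral_itv_bndo_bndc//.
  exact: measurable_funTS.
Qed.

Lemma L2_prod_integrable f g : L2 0 f -> L2 0 g ->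
  mu.-integrable I (fun x => (f x * g x)%:E).
Proof.
move=> Hf Hg; apply/(@leb1_integrable (fun x => f x * g x)).
  by apply: measurable_funM; apply: L2_measurable.
exact: inner_integrable.
Qed.

Lemma L2_int01 h : L2 0 h -> mu.-integrable I (EFin \o h).
Proof.
move=> Hh; apply: integrableS (L2_integrable ltr01 Hh) => //; try exact: measurable_itv.
by move=> z /=; rewrite !in_itv/= => /andP[/ltW -> ->].
Qed.

Lemma flowE h z : L2 0 h -> 0 < z <= 1 -> flow 0 h z = \int[mu]_(x in `]0, z]) h x.
Proof.
move=> Hh /andP[z0 z1]; rewrite Rintegral_itv_obnd_cbnd//.
apply: integrableS (L2_int01 Hh) => //; try exact: measurable_itv.
by move=> x /=; rewrite !in_itv/= => /andP[-> h2]; rewrite (le_trans h2 z1).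
Qed.

Lemma Rintegral_L2_bound h z : L2 0 h -> 0 < z <= 1 ->
  (\int[mu]_(x in `]0, z]) h x) ^+ 2 <= z * inner0 h h.
Proof.
move=> Hh /andP[z0 z1].
have sub : `]0, z] `<=` I.
  by move=> x /=; rewrite !in_itv/= => /andP[-> h2]; rewrite (le_trans h2 z1).
have mD : measurable (`]0, z]%classic : set (measurableTypeR R)) by exact: measurable_itv.
have i1 : mu.-integrable (`]0, z]%classic : set (measurableTypeR R)) (fun=> 1%:E).
  apply: (@integrableS _ _ _ mu (`[0, 1]%classic : set (measurableTypeR R))) => //.
  - by move=> x /=; rewrite !in_itv/= => /andP[/ltW -> h2]; rewrite (le_trans h2 z1).
  - exact: integrable_cst_itv.
have muD : \int[mu]_(x in `]0, z]) 1 = z.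
  transitivity (1 * fine (mu (`]0, z]%classic : set (measurableTypeR R)))).
    exact: Rintegral_cst.
  by rewrite mul1r lebesgue_measure_itv/= lte_fin z0 -EFinB /= subr0.
have i2 : mu.-integrable (`]0, z]%classic : set (measurableTypeR R)) (fun x => (h x ^+ 2 / 1)%:E).
  have := integrableS mI mD sub (L2_prod_integrable Hh Hh).
  by apply: eq_integrable => // x _; rewrite divr1.
have := @Rintegral_cauchy_schwarz R _ h (fun=> 1) mD
  (integrableS mI mD sub (L2_int01 Hh)) i1 i2 (fun _ _ => ltr01).
rewrite muD => /(_ z0) /le_trans; apply.
rewrite mulrC ler_pM2l// inner0E//.
have i2' : mu.-integrable I (fun x => (h x ^+ 2 / 1)%:E).
  by have := L2_prod_integrable Hh Hh; apply: eq_integrable => // x _; rewrite divr1.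
have -> : \int[mu]_(x in I) (h x * h x) = \int[mu]_(x in I) (h x ^+ 2 / 1).
  by apply: eq_Rintegral => x _; rewrite divr1.
rewrite /Rintegral fine_le//.
- exact: integrable_fin_num i2.
- exact: integrable_fin_num i2'.
apply: ge0_subset_integral => //.
  exact: measurable_int i2'.
by move=> x _; rewrite lee_fin divr1 sqr_ge0.
Qed.

End Energy.

(** * Symmetry and energy inequality on (0, 1) *)

Section Domain.
Context {R : realType}.
Local Notation mu := (@lebesgue_measure R).
Implicit Types (x y z : R) (f g h k u : R -> R).
Local Notation I := (`]0, 1]%classic : set (measurableTypeR R)).
Local Notation inner0 := (inner (@leb1 R 0)).

Let mI : measurable I. Proof. exact: measurable_itv. Qed.

(** The derivative of [potential 0 h]. *)
Definition slope h z : R := flow 0 h z / (z - 0).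

Lemma potentialE h x : potential 0 h x = - \int[mu]_(z in `[x, 1]) slope h z.
Proof. by []. Qed.

Lemma slope_flow h z : 0 < z -> slope h z * z = flow 0 h z.
Proof. by move=> z0; rewrite /slope subr0 divfK// gt_eqF. Qed.

Lemma measurable_slope h : L2 0 h -> measurable_fun I (slope h).
Proof.
move=> Hh; apply: subspace_continuous_measurable_fun => //.
have cV : {within I, continuous (flow 0 h)}.
  apply: continuous_subspaceW (flow_continuous ltr01 Hh) => z /=.
  by rewrite !in_itv/= => /andP[/ltW -> ->].
have ci : {within I, continuous (fun z => (z - 0)^-1)}.
  apply: continuous_in_subspaceT => z; rewrite inE/= in_itv/= => /andP[z0 _].
  apply: cvgV; first by rewrite subr0 gt_eqF.
  by apply: cvgB; [exact: cvg_id|exact: cvg_cst].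
by move=> z; apply: cvgM; [exact: cV|exact: ci].
Qed.

Lemma flow_bound h z : L2 0 h -> 0 < z <= 1 -> flow 0 h z ^+ 2 <= z * inner0 h h.
Proof. by move=> Hh z01; rewrite flowE//; exact: Rintegral_L2_bound. Qed.

Lemma L2_norm h : L2 0 h -> L2 0 (fun x => `|h x|).
Proof.
move=> /Lfun2P[mh ih]; apply/Lfun2P; split; first exact: measurableT_comp.
by apply: eq_integrable ih => // x _; rewrite /= real_normK ?num_real.
Qed.

Lemma inner_norm h : inner0 (fun x => `|h x|) (fun x => `|h x|) = inner0 h h.
Proof.
by apply: eq_Rintegral => x _; rewrite -!expr2 real_normK ?num_real.
Qed.

(** Integration by parts in the form of an exchange of integrals over the
    triangle x <= z. The integrals exist because flow(z)^2 <= z |h|^2. *)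
Lemma flow_ibp h k : L2 0 h -> L2 0 k ->
  mu.-integrable I (fun x => (h x * potential 0 k x)%:E) /\
  \int[mu]_(x in I) (h x * potential 0 k x) =
  - \int[mu]_(z in I) (slope k z * flow 0 h z).
Proof.
move=> Hh Hk.
have [i1 e1] : mu.-integrable I (fun x => (h x * \int[mu]_(z in `[x, 1]) slope k z)%:E) /\
  \int[mu]_(x in I) (h x * \int[mu]_(z in `[x, 1]) slope k z) =
  \int[mu]_(z in I) (slope k z * \int[mu]_(x in `]0, z]) h x).
  apply: (@fubini_triangle _ _ _ (1 + inner0 k k * inner0 h h)).
  - exact: L2_int01.
  - exact: measurable_slope.
  - move=> x; rewrite /= in_itv/= => /andP[x0 _].
    exact: (slope_integrable ltr01 Hk x0).
  move=> z; rewrite /= in_itv/= => z01; have /andP[z0 _] := z01.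
  have b1 := flow_bound Hk z01.
  have b2 := Rintegral_L2_bound (L2_norm Hh) z01; rewrite inner_norm in b2.
  set A := \int[mu]_(x in _) _ in b2 *.
  have A0 : 0 <= A by apply: Rintegral_ge0.
  set B := `|slope k z|; have B0 : 0 <= B by exact: normr_ge0.
  have B1 : z * B ^+ 2 <= inner0 k k.
    rewrite -(ler_pM2l z0); apply: le_trans b1.
    rewrite -(slope_flow k z0) /B real_normK ?num_real//.
    by rewrite le_eqVlt; apply/orP; left; apply/eqP; ring.
  have k0 := ip_ge0 (semi_inner_L2 (@leb1 R 0)) k.
  have h0 := ip_ge0 (semi_inner_L2 (@leb1 R 0)) h.
  have B2 : (B * A) ^+ 2 <= inner0 k k * inner0 h h.
    have -> : (B * A) ^+ 2 = (z * B ^+ 2) * (A ^+ 2 / z) by field; rewrite gt_eqF.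
    apply: ler_pM => //.
    - by rewrite mulr_ge0 ?sqr_ge0// ltW.
    - by rewrite divr_ge0 ?sqr_ge0// ltW.
    by rewrite ler_pdivrMr// mulrC.
  have := sqr_ge0 (B * A - 1); move: (B * A) B2 => y B2; nra.
split.
  have := integrableN i1; apply: eq_integrable => // x _.
  by rewrite potentialE mulrN EFinN.
rewrite -mulN1r.
have i2 : mu.-integrable I (fun x => (h x * potential 0 k x)%:E).
  have := integrableN i1; apply: eq_integrable => // x _.
  by rewrite potentialE mulrN EFinN.
have -> : \int[mu]_(z in I) (slope k z * flow 0 h z) =
    \int[mu]_(z in I) (slope k z * \int[mu]_(x in `]0, z]) h x).
  by apply: eq_Rintegral => z; rewrite inE /= in_itv/= => z01; rewrite flowE.
rewrite -e1 -RintegralZl//.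
by apply: eq_Rintegral => x _; rewrite potentialE mulN1r mulrN.
Qed.

(** The description of the graph of L that all computations use. *)
Definition in_domain f h :=
  [/\ L2 0 f, L2 0 h & {ae @leb1 R 0, forall x, f x = potential 0 h x}].

Let L2_one : L2 0 (fun=> 1 : R).
Proof.
apply/Lfun2P; split; first exact: measurable_cst.
apply/(@leb1_integrable _ (fun x => 1 ^+ 2)); first exact: measurable_cst.
have -> : (EFin \o (fun=> 1 ^+ 2 : R)) = (fun=> 1%:E) :> (R -> \bar R).
  by apply/funext => x; rewrite /= expr1n.
apply: (@integrableS _ _ _ mu (`[0, 1]%classic : set (measurableTypeR R))) => //.
- by move=> x /=; rewrite !in_itv/= => /andP[/ltW -> ->].
- exact: integrable_cst_itv.
Qed.

Lemma measurable_potential h : L2 0 h -> measurable_fun I (potential 0 h).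
Proof.
move=> Hh; have [i _] := flow_ibp L2_one Hh.
apply/measurable_EFinP; apply: eq_measurable_fun (measurable_int _ i) => x _ /=.
by rewrite mul1r.
Qed.

Lemma in_domain_ae f h : in_domain f h ->
  exists2 N, mu.-negligible N & forall x, 0 < x <= 1 -> ~ N x -> f x = potential 0 h x.
Proof.
move=> [_ _ /(leb1_ae 0) fh].
exists (~` [set x | x \in `]0, 1[ -> f x = potential 0 h x] `|` [set 1]).
  by apply: negligibleU => //; exact: negligible1.
move=> x /andP[x0 x1] /not_orP[/contrapT hx x1']; apply: hx.
by rewrite in_itv/= x0 lt_neqAle x1 andbT; apply/eqP.
Qed.

Lemma inner_potential f h k : in_domain f h -> L2 0 k ->
  inner0 k f = \int[mu]_(x in I) (k x * potential 0 h x).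
Proof.
move=> fh Hk; have [Hf Hh _] := fh; have [N N0 hN] := in_domain_ae fh.
rewrite inner0E// /Rintegral; congr fine; apply: ae_eq_integral => //.
- apply/measurable_EFinP; apply: measurable_funM; apply: measurable_funTS;
    exact: L2_measurable.
- apply/measurable_EFinP; apply: measurable_funM; last exact: measurable_potential.
  by apply: measurable_funTS; exact: L2_measurable.
apply: negligibleS N0 => z /= /not_implyP[]; rewrite in_itv/= => z01 ne.
by apply: contrapT => Nz; apply: ne; rewrite hN.
Qed.

(** Both sides equal minus the integral of flow(h) flow(k) / z. *)
Lemma in_domain_sym f h g k : in_domain f h -> in_domain g k ->
  inner0 h g = inner0 f k.
Proof.
move=> fh gk; have [Hf Hh _] := fh; have [Hg Hk _] := gk.
rewrite (ipC (semi_inner_L2 (@leb1 R 0)) f) (inner_potential gk Hh).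
rewrite (inner_potential fh Hk) (flow_ibp Hh Hk).2 (flow_ibp Hk Hh).2.
congr (- _); apply: eq_Rintegral => z; rewrite inE /= in_itv/= => /andP[z0 _].
by rewrite -(slope_flow h z0) -(slope_flow k z0); ring.
Qed.

(** The weight of the energy inequality. It is chosen so that
    the integral of 4/3 (1 - x) over (0, z) equals z m(z), while the integral
    of m over (x, 1) is at most 1 - x. *)
Let m z : R := (4 - 2 * z) / 3.

Lemma Rintegral_derive (F u : R -> R) (p q : R) : p < q ->
  (forall z : R, is_derive z 1 F (u z)) -> continuous u ->
  \int[mu]_(z in `[p, q]) u z = F q - F p.
Proof.
move=> pq dF cu; rewrite /Rintegral (@continuous_FTC2 _ _ F)//.
- exact: continuous_subspaceT.
- split.
  + by move=> z _; have h := dF z; exact: ex_derive.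
  + by apply: cvg_at_right_filter; exact: is_derive_continuous (dF p).
  + by apply: cvg_at_left_filter; exact: is_derive_continuous (dF q).
- by move=> z _; rewrite derive1E; have h := dF z; exact: derive_val.
Qed.

Lemma is_derive_quadratic (b c z : R) :
  is_derive z 1 (fun x => b * x + c * x ^+ 2) (b + 2 * c * z).
Proof.
apply: (@is_derive_quad _ _ _ _ `|c|) => t.
have -> : b * (z + t) + c * (z + t) ^+ 2 - (b * z + c * z ^+ 2) - (b + 2 * c * z) * t =
  c * t ^+ 2 by ring.
by rewrite normrM (ger0_norm (sqr_ge0 _)).
Qed.

Lemma continuous_affine_fun (b c : R) : continuous (fun z : R => b + c * z).
Proof.
move=> z; apply: cvgD; first exact: cvg_cst.
by apply: cvgM; [exact: cvg_cst|exact: cvg_id].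
Qed.

Lemma integral_weight x : x < 1 ->
  \int[mu]_(z in `[x, 1]) m z = (1 - x) * (3 - x) / 3.
Proof.
move=> x1.
have -> : \int[mu]_(z in `[x, 1]) m z =
    \int[mu]_(z in `[x, 1]) (4 / 3 + 2 * (- 1 / 3) * z).
  by apply: eq_Rintegral => z _; rewrite /m; field.
rewrite (Rintegral_derive x1 (fun z => is_derive_quadratic (4 / 3) (- 1 / 3) z)
  (@continuous_affine_fun _ _)).
by field.
Qed.

Lemma integral_weight2 z : 0 < z <= 1 ->
  \int[mu]_(x in `]0, z]) (4 / 3 * (1 - x)) = z * m z.
Proof.
move=> /andP[z0 z1].
have -> : \int[mu]_(x in `]0, z]) (4 / 3 * (1 - x)) =
    \int[mu]_(x in `]0, z]) (4 / 3 + 2 * (- 2 / 3) * x).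
  by apply: eq_Rintegral => x _; field.
rewrite Rintegral_itv_obnd_cbnd; last first.
  apply: (@integrableS _ _ _ mu (`[0, z]%classic : set (measurableTypeR R))) => //.
  - by move=> x /=; rewrite !in_itv/= => /andP[/ltW -> ->].
  - apply: (@continuous_compact_integrable _ (fun x => 4 / 3 + 2 * (- 2 / 3) * x)).
      exact: segment_compact.
    by apply: continuous_subspaceT; exact: continuous_affine_fun.
rewrite (Rintegral_derive z0 (fun x => is_derive_quadratic (4 / 3) (- 2 / 3) x)
  (@continuous_affine_fun _ _)).
by rewrite /m; field.
Qed.

Lemma weight_mass x : 0 < x < 1 -> 0 < (1 - x) * (3 - x) / 3 <= 1 - x.
Proof.
move=> /andP[x0 x1]; have y0 : 0 < 1 - x by lra.
have y1 : 0 < 3 - x by lra.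
have y2 : 0 < 3 :> R by [].
rewrite divr_gt0 ?mulr_gt0//= ler_pdivrMr// ler_pM2l//; lra.
Qed.

(** By the Cauchy-Schwarz inequality with weight m,
    potential(x)^2 <= (int_x^1 m) (int_x^1 slope^2 / m), where
    int_x^1 m = (1 - x) (3 - x) / 3 <= 1 - x. Integration in x and an exchange
    of integrals turn the factor 4/3 (1 - x) into z m(z), and
    slope^2 z = slope flow. *)
Lemma hardy_energy h : L2 0 h ->
  4 / 3 * \int[mu]_(x in I) (potential 0 h x * potential 0 h x) <=
  \int[mu]_(z in I) (slope h z * flow 0 h z).
Proof.
move=> Hh.
pose kk z := slope h z ^+ 2 / m z.
have m0 z : z <= 1 -> 0 < m z by rewrite /m => z1; lra.
have cm : continuous m.
  move=> z; apply: cvgM; last exact: cvg_cst.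
  by apply: cvgB; [exact: cvg_cst|apply: cvgM; [exact: cvg_cst|exact: cvg_id]].
have ikk x : 0 < x -> mu.-integrable `[x, 1] (EFin \o kk).
  move=> x0; apply: (@continuous_compact_integrable _ kk); first exact: segment_compact.
  have cs := slope_continuous ltr01 Hh x0.
  have ci : {within `[x, 1], continuous (fun z => (m z)^-1)}.
    apply: continuous_in_subspaceT => z; rewrite inE/= in_itv/= => /andP[_ z1].
    by apply: cvgV; [rewrite gt_eqF ?m0|exact: cm].
  by move=> z; apply: cvgM; [apply: cvgM; exact: cs|exact: ci].
have mkk : measurable_fun I kk.
  apply: measurable_funM.
    by apply: measurable_funX; exact: measurable_slope.
  apply: subspace_continuous_measurable_fun => //.
  apply: continuous_in_subspaceT => z; rewrite inE/= in_itv/= => /andP[_ z1].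
  by apply: cvgV; [rewrite gt_eqF ?m0|exact: cm].
have [i1 e1] : mu.-integrable I
    (fun x => (4 / 3 * (1 - x) * \int[mu]_(z in `[x, 1]) kk z)%:E) /\
  \int[mu]_(x in I) (4 / 3 * (1 - x) * \int[mu]_(z in `[x, 1]) kk z) =
  \int[mu]_(z in I) (kk z * \int[mu]_(x in `]0, z]) (4 / 3 * (1 - x))).
  apply: (@fubini_triangle _ _ _ (inner0 h h)) => //.
  - apply: (@integrableS _ _ _ mu (`[0, 1]%classic : set (measurableTypeR R))) => //.
      by move=> x /=; rewrite !in_itv/= => /andP[/ltW -> ->].
    apply: (@continuous_compact_integrable _ (fun x => 4 / 3 * (1 - x))).
      exact: segment_compact.
    apply: continuous_subspaceT => x; apply: cvgM; first exact: cvg_cst.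
    by apply: cvgB; [exact: cvg_cst|exact: cvg_id].
  - by move=> x; rewrite /= in_itv/= => /andP[x0 _]; exact: ikk.
  move=> z; rewrite /= in_itv/= => z01; have /andP[z0 z1] := z01.
  have -> : \int[mu]_(x in `]0, z]) `|4 / 3 * (1 - x)| = z * m z.
    rewrite -integral_weight2//; apply: eq_Rintegral => x; rewrite inE/= in_itv/= => /andP[_ xz].
    by rewrite ger0_norm//; have := le_trans xz z1; lra.
  have mz := m0 z z1.
  rewrite /kk ger0_norm; last by rewrite divr_ge0 ?sqr_ge0// ltW.
  have -> : slope h z ^+ 2 / m z * (z * m z) = (slope h z * z) ^+ 2 / z.
    by field; rewrite !gt_eqF.
  rewrite slope_flow// ler_pdivrMr// mulrC; exact: flow_bound.
have -> : \int[mu]_(z in I) (slope h z * flow 0 h z) =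
    \int[mu]_(z in I) (kk z * \int[mu]_(x in `]0, z]) (4 / 3 * (1 - x))).
  apply: eq_Rintegral => z; rewrite inE /= in_itv/= => z01; have /andP[z0 z1] := z01.
  rewrite integral_weight2// -(slope_flow h z0) /kk.
  by have mz := m0 z z1; field; rewrite gt_eqF.
rewrite -e1.
have pw x : I x -> 4 / 3 * (potential 0 h x * potential 0 h x) <=
    4 / 3 * (1 - x) * \int[mu]_(z in `[x, 1]) kk z.
  rewrite /= in_itv/= => /andP[x0]; rewrite le_eqVlt => /orP[/eqP ->|x1].
    by rewrite potential1 subrr !mulr0 mul0r.
  have /andP[M0 M1] := weight_mass (introT andP (conj x0 x1)).
  set T := \int[mu]_(z in `[x, 1]) kk z.
  have T0 : 0 <= T.
    apply: Rintegral_ge0 => z /=; rewrite in_itv/= => /andP[_ z1].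
    by apply: divr_ge0; [exact: sqr_ge0|exact: ltW (m0 z z1)].
  have mx : measurable (`[x, 1]%classic : set (measurableTypeR R)) by exact: measurable_itv.
  have im : mu.-integrable (`[x, 1]%classic : set (measurableTypeR R)) (EFin \o m).
    apply: (@continuous_compact_integrable _ m); first exact: segment_compact.
    exact: continuous_subspaceT.
  have := @Rintegral_cauchy_schwarz R _ (slope h) m mx
    (slope_integrable ltr01 Hh x0) im (ikk x x0).
  rewrite integral_weight// => /(_ _ M0) => cs.
  have {}cs : potential 0 h x ^+ 2 <= T * ((1 - x) * (3 - x) / 3).
    rewrite potentialE sqrrN; apply: cs => z /=.
    by rewrite in_itv/= => /andP[_ z1]; exact: m0.
  have : T * ((1 - x) * (3 - x) / 3) <= T * (1 - x).
    exact: ler_wpM2l.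
  rewrite -expr2 -(mulrA (4 / 3)) => h1; rewrite ler_pM2l// [(1 - x) * _]mulrC.
  exact: le_trans cs h1.
have ip2 : mu.-integrable I (fun x => (4 / 3 * (potential 0 h x * potential 0 h x))%:E).
  apply: le_integrable i1 => //.
    apply/measurable_EFinP; apply: measurable_funM => //.
    by apply: measurable_funM; exact: measurable_potential.
  move=> x Ix; have := pw x Ix; rewrite /= lee_fin.
  have p2 : 0 <= 4 / 3 * (potential 0 h x * potential 0 h x).
    by rewrite mulr_ge0// -expr2 sqr_ge0.
  by move=> h1; rewrite !ger0_norm//; exact: le_trans h1.
rewrite -RintegralZl//; last first.
  have := integrableZl mI (3 / 4) ip2; apply: eq_integrable => // x _.
  by rewrite /= -EFinM; congr (_%:E); field.
exact: le_Rintegral.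
Qed.

(** Integration by parts followed by [hardy_energy]. *)
Lemma in_domain_dissip f h : in_domain f h -> inner0 f h <= - (4 / 3) * inner0 f f.
Proof.
move=> fh; have [Hf Hh _] := fh.
rewrite (ipC (semi_inner_L2 (@leb1 R 0))) (inner_potential fh Hh) (flow_ibp Hh Hh).2.
have -> : inner0 f f = \int[mu]_(x in I) (potential 0 h x * potential 0 h x).
  rewrite inner0E// /Rintegral; congr fine; have [N N0 hN] := in_domain_ae fh.
  apply: ae_eq_integral => //.
  - apply/measurable_EFinP; apply: measurable_funM; apply: measurable_funTS;
      exact: L2_measurable.
  - by apply/measurable_EFinP; apply: measurable_funM; exact: measurable_potential.
  apply: negligibleS N0 => z /= /not_implyP[]; rewrite in_itv/= => z01 ne.
  by apply: contrapT => Nz; apply: ne; rewrite hN.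
by rewrite mulNr lerN2; exact: hardy_energy.
Qed.

End Domain.

(** * Transfer between (a, 1) and (0, 1) *)

Section Transfer.
Context {R : realType}.
Local Notation mu := (@lebesgue_measure R).
Local Notation V := (measurableTypeR R -> R^o).
Implicit Types (a x y z : R) (f g h k u : R -> R).

Lemma flow_affine a h s : a < 1 -> L2 a h -> 0 <= s <= 1 ->
  flow a h (affine a s) = flow 0 ((1 - a) *: (h \o affine a : V)) s.
Proof.
move=> a1 Hh /andP[s0 s1].
have aE : a = affine a 0 by rewrite /affine mulr0 addr0.
have le1 : affine a s <= 1.
  have : (1 - a) * s <= (1 - a) * 1 by rewrite ler_pM2l ?subr_gt0.
  rewrite /affine; lra.
have ih : mu.-integrable `[affine a 0, affine a s] (EFin \o h).
  rewrite -aE; apply: integrableS (L2_integrable a1 Hh) => //; try exact: measurable_itv.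
  by move=> z /=; rewrite !in_itv/= => /andP[-> h2]; rewrite (le_trans h2 le1).
rewrite /flow {1}aE Rintegral_affine_itv// -RintegralZl//.
have Hh0 := (L2_affine a1 h).1 Hh.
apply: integrableS (L2_integrable ltr01 Hh0) => //; try exact: measurable_itv.
by move=> z /=; rewrite !in_itv/= => /andP[-> h2]; rewrite (le_trans h2 s1).
Qed.

Lemma potential_affine a h y : a < 1 -> L2 a h -> 0 < y <= 1 ->
  potential a h (affine a y) = potential 0 ((1 - a) *: (h \o affine a : V)) y.
Proof.
move=> a1 Hh /andP[y0 y1]; have b0 : 0 < 1 - a by rewrite subr_gt0.
have aE : 1 = affine a 1 by rewrite /affine mulr1 addrC subrK.
have ay : a < affine a y by rewrite /affine ltrDl mulr_gt0.
have Hh0 : L2 0 ((1 - a) *: (h \o affine a : V)).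
  by apply: (sipZ (semi_inner_L2 _)); apply/(L2_affine a1).
rewrite /potential; congr (- _).
have iq := slope_integrable a1 Hh ay.
have -> : \int[mu]_(z in `[affine a y, 1]) (flow a h z / (z - a)) =
  (1 - a) * \int[mu]_(s in `[y, 1]) (flow a h (affine a s) / (affine a s - a)).
  have := @Rintegral_affine_itv _ a a1 y 1 (fun z => flow a h z / (z - a)).
  by rewrite -aE => ->.
have E s : s \in (`[y, 1]%classic : set R) ->
    flow a h (affine a s) / (affine a s - a) =
    (1 - a)^-1 * (flow 0 ((1 - a) *: (h \o affine a : V)) s / (s - 0)).
  rewrite inE/= in_itv/= => /andP[ys s1]; have s0 := lt_le_trans y0 ys.
  rewrite flow_affine ?(ltW s0) ?s1//; move: (flow 0 _ _) => w.
  have -> : affine a s - a = (1 - a) * s by rewrite /affine; ring.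
  by field; rewrite !gt_eqF.
transitivity ((1 - a) * \int[mu]_(s in `[y, 1])
    ((1 - a)^-1 * (flow 0 ((1 - a) *: (h \o affine a : V)) s / (s - 0)))).
  by congr (_ * _); apply: eq_Rintegral => s; exact: E.
rewrite RintegralZl//; last exact: (slope_integrable ltr01 Hh0 y0).
by rewrite mulrA divff ?mul1r// gt_eqF.
Qed.

(** The condition on the graph of A is only used through the potential, which
    scales with the substitution. *)
Lemma degenerate_op_in_domain a f h : a < 1 -> degenerate_op a f h ->
  in_domain (f \o affine a) ((1 - a) *: (h \o affine a : V)).
Proof.
move=> a1 fh; have [Hf [g [_ _ [v [vf cv _]] _ [_ Hh]]]] := fh.
split.
- exact/(L2_affine a1).
- by apply: (sipZ (semi_inner_L2 _)); exact/(L2_affine a1).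
have vE := degenerate_op_potential a1 fh vf cv.
have fE : {ae leb1 a, forall x, x \in `]a, 1[ -> f x = potential a h x}.
  case: vf => N [mN N0 hN]; exists N; split => // x /= nx.
  apply: hN => /= hx; apply: nx; rewrite in_itv/= => /andP[ax x1].
  by rewrite -vE ?ax ?(ltW x1)// hx.
have [N [mN N0 hN]] := (ae_affine a1 _).1 fE.
apply/(leb1_ae 0); have [N' [mN' N'0 hN']] : {ae mu, forall x, x \in `]0, 1%R[ ->
    affine a x \in `]a, 1[ -> f (affine a x) = potential a h (affine a x)}.
  by apply/(leb1_ae 0); exists N.
exists N'; split => // x /= /not_implyP[x01 nx]; apply: hN' => /= hx; apply: nx.
have := hx x01; rewrite affine_itv// => /(_ x01) ->.
by rewrite potential_affine//; move: x01; rewrite in_itv/= => /andP[-> /ltW ->].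
Qed.

Lemma continuous_L2 a f : a < 1 -> continuous f -> L2 a f.
Proof.
move=> a1 cf; have mf : measurable_fun setT (f : measurableTypeR R -> R).
  exact: measurable_continuous.
apply/Lfun2P; split => //.
have mf2 : measurable_fun setT (fun x : measurableTypeR R => `|(f x ^+ 2)%:E|%E).
  by apply: measurableT_comp => //; apply/measurable_EFinP; exact: measurable_funX.
apply/integrableP; split; first by apply/measurable_EFinP; exact: measurable_funX.
rewrite (leb1_integral a mf2).
have : mu.-integrable `[a, 1] (fun x => (f x ^+ 2)%:E).
  apply: (@continuous_compact_integrable _ (fun x => f x ^+ 2)).
    exact: segment_compact.
  by apply: continuous_subspaceT => x; apply: cvgM; exact: cf.
move=> /integrableP[_]; apply: le_lt_trans.
rewrite integral_itv_obnd_cbnd; last exact: measurable_funTS.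
by rewrite integral_itv_bndo_bndc//; exact: measurable_funTS.
Qed.

Lemma continuous_locally_integrable a f u : a < 1 -> continuous f ->
  measurable_fun setT (u : measurableTypeR R -> R) ->
  (forall x, x \in `]a, 1[ -> u x = f x) ->
  locally_integrable `]a, 1[ u.
Proof.
move=> a1 cf mu_ uf; apply: open_integrable_locally; first exact: interval_open.
have sub : `]a, 1[ `<=` `[a, 1].
  by move=> z /=; rewrite !in_itv/= => /andP[/ltW -> /ltW ->].
have iF : mu.-integrable `[a, 1] (EFin \o f).
  apply: (@continuous_compact_integrable _ f); first exact: segment_compact.
  exact: continuous_subspaceT.
have : mu.-integrable `]a, 1[ (EFin \o f) by apply: integrableS iF.
by apply: eq_integrable => // x xa; rewrite /= uf//; rewrite inE in xa.
Qed.

(** Only the values of [f] on (a, 1) matter, which allows [f] to be the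
    truncation of a smooth function. *)
Lemma smooth_weak_derivative a f F g : a < 1 ->
  (forall x : R, is_derive x 1 F (g x)) -> continuous g ->
  measurable_fun setT (f : measurableTypeR R -> R) ->
  (forall x, x \in `]a, 1[ -> f x = F x) ->
  weak_derivative a f g.
Proof.
move=> a1 dF cg mf fF.
have cF : continuous F by move=> x; exact: is_derive_continuous (dF x).
split.
- exact: continuous_locally_integrable cF mf fF.
- by apply: (continuous_locally_integrable a1 cg) => //; exact: measurable_continuous.
move=> phi [dphi cphi [c [d [ac d1 phi0]]]].
have phi_a : phi a = 0 by apply: phi0; rewrite in_itv/= negb_and -ltNge ac.
have phi_1 : phi 1 = 0 by apply: phi0; rewrite in_itv/= negb_and -!ltNge d1 orbT.
have Dphi x : is_derive x 1 phi (derive1 phi x).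
  by apply: DeriveDef; [exact: dphi|rewrite derive1E].
have cphi0 : continuous phi by move=> x; exact: is_derive_continuous (Dphi x).
have DFphi x : is_derive x 1 (fun x => F x * phi x) (F x * derive1 phi x + g x * phi x).
  have h1 := dF x; have h2 := Dphi x.
  have h := @is_deriveM _ _ (F : R -> R) (phi : R -> R) x 1 _ _ h1 h2.
  have -> : F x * derive1 phi x + g x * phi x =
    F x *: derive1 phi x + phi x *: (g x : R^o) by rewrite /GRing.scale/= [phi x * _]mulrC.
  exact: h.
have c1 : continuous (fun x => F x * derive1 phi x).
  by move=> x; apply: cvgM; [exact: cF|exact: cphi].
have c2 : continuous (fun x => g x * phi x).
  by move=> x; apply: cvgM; [exact: cg|exact: cphi0].
have ic (u : R -> R) : continuous u -> mu.-integrable `[a, 1] (EFin \o u).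
  move=> cu; apply: (@continuous_compact_integrable _ u); first exact: segment_compact.
  exact: continuous_subspaceT.
have toC (u : R -> R) : continuous u ->
    \int[mu]_(x in `]a, 1[) u x = \int[mu]_(x in `[a, 1]) u x.
  move=> cu; rewrite Rintegral_itv_obnd_cbnd; last first.
    apply: integrableS (ic _ cu) => //; try exact: measurable_itv.
    by move=> z /=; rewrite !in_itv/= => /andP[/ltW -> /ltW ->].
  rewrite Rintegral_itv_bndo_bndc//.
  apply: integrableS (ic _ cu) => //; try exact: measurable_itv.
  by move=> z /=; rewrite !in_itv/= => /andP[-> /ltW ->].
have -> : \int[mu]_(x in `]a, 1[) (f x * derive1 phi x) =
    \int[mu]_(x in `]a, 1[) (F x * derive1 phi x).
  by apply: eq_Rintegral => x xa; congr (_ * _); apply: fF; rewrite inE in xa.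
rewrite !toC//.
have : \int[mu]_(x in `[a, 1]) (F x * derive1 phi x + g x * phi x) =
    F 1 * phi 1 - F a * phi a.
  apply: (Rintegral_derive a1 DFphi).
  by move=> x; apply: cvgD; [exact: c1|exact: c2].
rewrite phi_a phi_1 !mulr0 subrr RintegralD//; try exact: ic.
by move=> /eqP; rewrite addr_eq0 => /eqP.
Qed.

Lemma degenerate_op_smooth a f F g h : a < 1 ->
  (forall x : R, is_derive x 1 F (g x)) -> continuous g ->
  (forall x : R, is_derive x 1 (fun x => (x - a) * g x) (h x)) -> continuous h ->
  F 1 = 0 -> L2 a f -> (forall x, x \in `]a, 1[ -> f x = F x) ->
  degenerate_op a f h.
Proof.
move=> a1 dF cg dG ch F1 Hf fF.
have cF : continuous F by move=> x; exact: is_derive_continuous (dF x).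
have cG : continuous (fun x => (x - a) * g x).
  by move=> x; exact: is_derive_continuous (dG x).
split => //; exists g; split.
- exact: smooth_weak_derivative dF cg (Lfun2_measurable Hf) fF.
- have : mu.-integrable `[a, 1] (EFin \o (fun x => (x - a) * `|g x| ^+ 2)).
    apply: (@continuous_compact_integrable _ (fun x => (x - a) * `|g x| ^+ 2)).
      exact: segment_compact.
    apply: continuous_subspaceT => x; apply: cvgM.
      by apply: cvgB; [exact: cvg_id|exact: cvg_cst].
    have cn : {for x, continuous (fun x => `|g x|)}.
      by apply: (@continuous_comp _ _ _ g Num.norm); [exact: cg|exact: norm_continuous].
    by apply: cvgM; exact: cn.
  move=> iw; have : mu.-integrable `]a, 1[ (EFin \o (fun x => (x - a) * `|g x| ^+ 2)).
    apply: integrableS iw => //.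
    by move=> z /=; rewrite !in_itv/= => /andP[/ltW -> /ltW ->].
  move=> /integrableP[_]; apply: le_lt_trans; rewrite le_eqVlt; apply/orP; left.
  apply/eqP; apply: eq_integral => x; rewrite inE/= in_itv/= => /andP[ax _].
  have hp : 0 <= (x - a) * `|g x| ^+ 2 by rewrite mulr_ge0 ?exprn_ge0// subr_ge0 ltW.
  by rewrite /= (ger0_norm hp).
- exists F; split => //; last exact: continuous_subspaceT.
  have [N [mN N0 hN]] : {ae leb1 a, forall x, F x = f x}.
    apply/(leb1_ae a); exists set0; split => // x /=; apply: contra_notP => _ xa.
    by rewrite fF.
  by exists N; split => // x /= nx; apply: hN => /= h1; apply: nx.
- exact: continuous_L2.
split; last exact: continuous_L2.
by apply: (smooth_weak_derivative a1 dG ch) => //; exact: measurable_continuous.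
Qed.

End Transfer.

(** * The one-sided derivative of a potential at 1 *)

Section BoundaryDerivative.
Context {R : realType}.
Local Notation mu := (@lebesgue_measure R).
Implicit Types (a x y z : R) (f g h k u : R -> R).

Lemma Rintegral_cst_itv (p q r : R) : p <= q ->
  \int[mu]_(z in `[p, q]) r = r * (q - p).
Proof.
move=> pq; have mD : measurable (`[p, q]%classic : set (measurableTypeR R)).
  exact: measurable_itv.
transitivity (r * fine (mu (`[p, q]%classic : set (measurableTypeR R)))).
  exact: Rintegral_cst.
rewrite lebesgue_measure_itv/= lte_fin; case: ltP => [_|qp]; first by rewrite -EFinB.
have -> : q = p by apply/eqP; rewrite eq_le qp pq.
by rewrite subrr.
Qed.

(** The derivative of the potential is flow(z) / (z - a), which is continuous
    up to z = 1. *)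
Lemma potential_left_slope a h : a < 1 -> L2 a h ->
  (potential a h x - potential a h 1) / (x - 1) @[x --> 1^'-] -->
  flow a h 1 / (1 - a).
Proof.
move=> a1 Hh; pose q z := flow a h z / (z - a).
pose c := (a + 1) / 2.
have ac : a < c by rewrite /c; lra.
have c1 : c < 1 by rewrite /c; lra.
have iq := slope_integrable a1 Hh ac.
have /continuous_within_itvP := slope_continuous a1 Hh ac.
move=> /(_ c1) [_ _ q1].
apply/cvgrPdist_le => e e0.
have [d d0 hd] := near_leftP ((@cvgrPdist_le _ _ _ _ _ _ _).1 q1 e e0).
have d'0 : 0 < Num.min d (1 - c) by rewrite lt_min d0 subr_gt0.
near=> x.
have x1 : x < 1 by near: x; exact: nbhs_left_lt.
have xd' : 1 - Num.min d (1 - c) < x.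
  by near: x; apply: nbhs_left_gt; rewrite ltrBlDr ltrDl.
have m1 : Num.min d (1 - c) <= d by rewrite ge_min lexx.
have m2 : Num.min d (1 - c) <= 1 - c by rewrite ge_min lexx orbT.
have xd : 1 - d < x by lra.
have cx : c < x by lra.
have ax : a < x := lt_trans ac cx.
have E : potential a h 1 - potential a h x = \int[mu]_(z in `[x, 1]) q z.
  exact: (potential_sub a1 Hh ax (ltW x1) (lexx 1)).
have dq z : x <= z <= 1 -> `|q 1 - q z| <= e.
  move=> /andP[xz z1]; case: (ltP z 1) => [z1'|z1'].
    by apply: hd; rewrite z1' (lt_le_trans xd xz).
  have -> : z = 1 by apply/eqP; rewrite eq_le z1 z1'.
  by rewrite subrr normr0 ltW.
have iqx : mu.-integrable `[x, 1] (fun z => (q z)%:E).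
  exact: (slope_integrable a1 Hh ax).
have mD : measurable (`[x, 1]%classic : set (measurableTypeR R)) by exact: measurable_itv.
have lo : (q 1 - e) * (1 - x) <= potential a h 1 - potential a h x.
  rewrite E -(Rintegral_cst_itv _ (ltW x1)).
  apply: le_Rintegral => //; first exact: integrable_cst_itv.
  move=> z /=; rewrite in_itv/= => /dq; rewrite ler_norml => /andP[_ h2].
  by rewrite lerBlDr -lerBlDl.
have hi : potential a h 1 - potential a h x <= (q 1 + e) * (1 - x).
  rewrite E -(Rintegral_cst_itv _ (ltW x1)).
  apply: le_Rintegral => //; first exact: integrable_cst_itv.
  move=> z /=; rewrite in_itv/= => /dq; rewrite ler_norml => /andP[h1 _].
  by rewrite -lerBlDr -lerBrDl.
have -> : (potential a h x - potential a h 1) / (x - 1) =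
    (potential a h 1 - potential a h x) / (1 - x).
  by rewrite -(opprB x 1) invrN mulrN -mulNr opprB.
have x10 : 0 < 1 - x by rewrite subr_gt0.
have l1 : q 1 - e <= (potential a h 1 - potential a h x) / (1 - x) by rewrite ler_pdivlMr.
have l2 : (potential a h 1 - potential a h x) / (1 - x) <= q 1 + e by rewrite ler_pdivrMr.
rewrite -/(q 1) ler_distl; apply/andP; split.
  by rewrite lerBlDr.
by rewrite -lerBlDr.
Unshelve. all: by end_near. Qed.

End BoundaryDerivative.

(** * The boundary flux in terms of the heat content *)

Section Flux.
Context {R : realType}.
Local Notation mu := (@lebesgue_measure R).
Local Notation V := (measurableTypeR R -> R^o).
Local Notation inner0 := (inner (@leb1 R 0)).
Local Notation semi0 := (semi_inner_L2 (@leb1 R 0)).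
Local Notation sgen0 := (sgen (@L2 R 0) inner0).
Implicit Types (a x y z t : R) (f g h k F u : R -> R) (S : R -> (R -> R) -> R -> R).

Definition cst1 : V := fun=> 1.
(** The stationary temperature with unit source: L ramp = - 1. *)
Definition ramp : V := fun y => 1 - y.
Definition parabola : R -> R := fun x => x * (1 - x).

Lemma continuous_ramp : continuous (ramp : R -> R).
Proof. by move=> x; apply: cvgB; [exact: cvg_cst|exact: cvg_id]. Qed.

Lemma L2_cst1 : L2 0 cst1.
Proof. by apply: continuous_L2 => // x; exact: cvg_cst. Qed.

Lemma L2_ramp : L2 0 ramp.
Proof. exact: (continuous_L2 ltr01 continuous_ramp). Qed.

Lemma inner0_quadratic f g (b c : R) : L2 0 f -> L2 0 g ->
  (forall x, f x * g x = b + 2 * c * x) -> inner0 f g = b + c.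
Proof.
move=> Hf Hg E; rewrite inner0E//.
transitivity (\int[mu]_(x in `]0, 1]) (b + 2 * c * x)).
  by apply: eq_Rintegral => x _; exact: E.
have cc := @continuous_affine_fun R b (2 * c).
rewrite Rintegral_itv_obnd_cbnd; last first.
  have i : mu.-integrable `[0, 1] (EFin \o (fun x => b + 2 * c * x)).
    apply: (@continuous_compact_integrable _ (fun x => b + 2 * c * x)).
      exact: segment_compact.
    exact: continuous_subspaceT.
  apply: integrableS i => //; try exact: measurable_itv.
  by move=> x /=; rewrite !in_itv/= => /andP[/ltW -> ->].
rewrite (Rintegral_derive ltr01 (fun z => is_derive_quadratic b c z) cc).
by ring.
Qed.

Lemma inner0_cst1 : inner0 cst1 cst1 = 1.
Proof.
rewrite (@inner0_quadratic _ _ 1 0) ?addr0//; try exact: L2_cst1.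
by move=> x; rewrite /cst1; ring.
Qed.

Lemma inner0_ramp_cst1 : inner0 ramp cst1 = 1 / 2.
Proof.
rewrite (@inner0_quadratic _ _ 1 (- (1 / 2)));
  [by field|exact: L2_ramp|exact: L2_cst1|].
by move=> x; rewrite /ramp /cst1; field.
Qed.

Lemma inner0_ramp : inner0 ramp ramp <= 1.
Proof.
rewrite -inner0_cst1 !inner0E; try exact: L2_ramp; try exact: L2_cst1.
apply: le_Rintegral.
- exact: measurable_itv.
- exact: L2_prod_integrable L2_ramp L2_ramp.
- exact: L2_prod_integrable L2_cst1 L2_cst1.
move=> x /=; rewrite in_itv/= /ramp /cst1 => /andP[x0 x1]; nra.
Qed.

Section OneProblem.
Variables (a : R) (S : R -> (R -> R) -> R -> R).
Hypothesis a1 : a < 1.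
Hypothesis eS : is_exp_semigroup a S.
Local Notation T := (rescale a S).
Local Notation b := (1 - a).

Let b0 : 0 < b. Proof. by rewrite subr_gt0. Qed.
Let bn0 : b != 0. Proof. by rewrite gt_eqF. Qed.
Let sT := sgroup_rescale a1 eS.1.

Lemma degenerate_op_sgen F h : degenerate_op a F h ->
  sgen0 T (F \o affine a) (b *: (h \o affine a : V)).
Proof.
move=> op; have [HF [g [_ _ _ _ [_ Hh]]]] := op.
apply/(sgen_rescaleP a1 eS.1 HF Hh); exact: (eS.2 F h).2.
Qed.

Lemma sgen_degenerate_op (f k : V) : sgen0 T f k ->
  degenerate_op a (f \o affine_inv a) (b^-1 *: (k \o affine_inv a : V)).
Proof.
move=> fk; have [Hf Hk _] := fk; apply/(eS.2 _ _).
have Hf' := (L2_affine_inv a1 f).1 Hf.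
have Hk' : L2 a (b^-1 *: (k \o affine_inv a : V)).
  by apply: (sipZ (semi_inner_L2 (leb1 a))); exact/(L2_affine_inv a1).
apply/(sgen_rescaleP a1 eS.1 Hf' Hk').
have -> : (f \o affine_inv a) \o affine a = f.
  by apply/funext => x /=; rewrite affineK.
have -> // : b *: ((b^-1 *: (k \o affine_inv a : V)) \o affine a : V) = k.
apply/funext => x; rewrite /GRing.scale/= /GRing.scale/= affineK//.
by rewrite mulrA divff// mul1r.
Qed.

Lemma sgen_in_domain (f k : V) : sgen0 T f k -> in_domain f k.
Proof.
move=> /sgen_degenerate_op /(degenerate_op_in_domain a1).
have -> : (f \o affine_inv a) \o affine a = f.
  by apply/funext => x /=; rewrite affineK.
have -> // : b *: ((b^-1 *: (k \o affine_inv a : V)) \o affine a : V) = k.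
apply/funext => x; rewrite /GRing.scale/= /GRing.scale/= affineK//.
by rewrite mulrA divff// mul1r.
Qed.

(** Whatever semigroup is generated by A, its generator after rescaling lies in
    the graph described by potentials. *)
Lemma sgen_dissip (f k : V) : sgen0 T f k -> inner0 f k <= - (4 / 3) * inner0 f f.
Proof. by move=> /sgen_in_domain; exact: in_domain_dissip. Qed.

Lemma sgen_ramp : sgen0 T ramp (- cst1).
Proof.
have op : degenerate_op a (fun x => b^-1 * (1 - x)) (fun=> - b^-1).
  apply: (@degenerate_op_smooth _ a _ (fun x => b^-1 * (1 - x)) (fun=> - b^-1)) => //.
  - move=> x; apply: (@is_derive_quad _ _ _ _ 0) => s.
    by rewrite mul0r normr_le0; apply/eqP; ring.
  - by move=> x; exact: cvg_cst.
  - move=> x; apply: (@is_derive_quad _ _ _ _ 0) => s.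
    by rewrite mul0r normr_le0; apply/eqP; ring.
  - by move=> x; exact: cvg_cst.
  - by rewrite subrr mulr0.
  apply: continuous_L2 => // x.
  by apply: cvgM; [exact: cvg_cst|exact: continuous_ramp].
have := degenerate_op_sgen op; congr (sgen _ _ _ _ _).
  by apply/funext => y /=; rewrite /affine /ramp; field.
by apply/funext => y; transitivity (b * - b^-1) => //; rewrite mulrN divff.
Qed.

Lemma degenerate_op_parabola :
  degenerate_op a (parabola \_ `]a, 1%R[) (fun x => 1 + 2 * a - 4 * x).
Proof.
have cu : continuous parabola.
  by move=> x; apply: cvgM; [exact: cvg_id|exact: continuous_ramp].
apply: (@degenerate_op_smooth _ a _ parabola (fun x => 1 - 2 * x)) => //.
- move=> x; apply: (@is_derive_quad _ _ _ _ 1) => s; rewrite /parabola.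
  have -> : (x + s) * (1 - (x + s)) - x * (1 - x) - (1 - 2 * x) * s = - (s ^+ 2) by ring.
  by rewrite normrN ger0_norm ?sqr_ge0// mul1r.
- move=> x; apply: cvgB; first exact: cvg_cst.
  by apply: cvgM; [exact: cvg_cst|exact: cvg_id].
- move=> x; apply: (@is_derive_quad _ _ _ _ 2) => s.
  have -> : (x + s - a) * (1 - 2 * (x + s)) - (x - a) * (1 - 2 * x) -
      (1 + 2 * a - 4 * x) * s = - (2 * s ^+ 2) by ring.
  by rewrite normrN ger0_norm// mulr_ge0 ?sqr_ge0.
- move=> x; apply: cvgB; first exact: cvg_cst.
  by apply: cvgM; [exact: cvg_cst|exact: cvg_id].
- by rewrite /parabola subrr mulr0.
- have /Lfun2P[mu0 iu0] := continuous_L2 a1 cu.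
  have mD : measurable (`]a, 1[%classic : set (measurableTypeR R)) by exact: measurable_itv.
  have mr : measurable_fun setT (parabola \_ `]a, 1[ : measurableTypeR R -> R).
    by apply/(measurable_restrictT _ mD); exact: measurable_funTS.
  apply/Lfun2P; split => //.
  apply: (le_integrable _ _ _ iu0) => //.
    by apply/measurable_EFinP; exact: measurable_funX.
  move=> x _; rewrite /= lee_fin !ger0_norm ?sqr_ge0// patchE.
  by case: ifP => // _; rewrite expr0n/= sqr_ge0.
- by move=> x xa; rewrite patchE mem_set.
Qed.

(** The solution at time [t] is the potential of A S_t u0 = S_t A u0, so its
    derivative at 1 is the mean of this function, namely an inner product with
    the constant 1. *)
Lemma flux_content (u : R -> R -> R -> R) t : 0 <= t ->
  (u a)^~ t = S t (parabola \_ `]a, 1%R[) %[ae leb1 a] ->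
  {within `]a, 1%R], continuous ((u a)^~ t)} ->
  boundary_flux u a t =
  4 * b * content1 inner0 T cst1 ramp (t / b) -
  (1 + 2 * b) * content inner0 T cst1 (t / b).
Proof.
move=> t0 uS cu; pose h0 x := 1 + 2 * a - 4 * x.
pose f0 := parabola \_ `]a, 1%R[.
have tb0 : 0 <= t / b by rewrite divr_ge0// ltW.
pose k := T (t / b) (b *: (h0 \o affine a : V)).
have gen : sgen0 T (T (t / b) (f0 \o affine a)) k.
  exact: (sgen_orbit semi0 sT (degenerate_op_sgen degenerate_op_parabola) tb0).
have := sgen_degenerate_op gen.
have -> : T (t / b) (f0 \o affine a) \o affine_inv a = S t f0.
  rewrite /rescale mulrC divfK//.
  have -> : (f0 \o affine a) \o affine_inv a = f0.
    by apply/funext => x /=; rewrite affine_invK.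
  by apply/funext => x /=; rewrite affine_invK.
set h' := b^-1 *: _ => op.
have Hh' : L2 a h' by have [_ [g [_ _ _ _ []]]] := op.
have uE := degenerate_op_potential a1 op uS cu.
have -> : boundary_flux u a t = flow a h' 1 / b.
  apply: cvg_lim => //; apply: cvg_trans (potential_left_slope a1 Hh').
  apply: near_eq_cvg; near=> x.
  rewrite (uE 1) ?a1 ?lexx// uE//; apply/andP; split.
    by near: x; exact: nbhs_left_gt.
  by near: x; exact: nbhs_left_le.
have -> : flow a h' 1 = inner0 k cst1.
  have -> : 1 = affine a 1 by rewrite /affine; ring.
  rewrite flow_affine ?ler01 ?lexx//.
  have -> : b *: (h' \o affine a : V) = k.
    apply/funext => x; rewrite /h' /GRing.scale/= /GRing.scale/= affineK//.
    by rewrite mulrA divff// mul1r.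
  have [_ Hk _] := gen.
  rewrite flowE ?ltr01 ?lexx// inner0E//; last exact: L2_cst1.
  by apply: eq_Rintegral => x _; rewrite /cst1 mulr1.
have kE : eqv (@L2 R 0) inner0 k
    ((4 * b ^+ 2) *: T (t / b) ramp + (- (b * (1 + 2 * b))) *: T (t / b) cst1).
  rewrite /k.
  have -> : b *: (h0 \o affine a : V) =
      (4 * b ^+ 2) *: ramp + (- (b * (1 + 2 * b))) *: cst1.
    apply/funext => x; rewrite /h0 /affine /ramp /cst1.
    transitivity (4 * b ^+ 2 * (1 - x) + - (b * (1 + 2 * b)) * 1) => //.
    transitivity (b * (1 + 2 * a - 4 * (a + b * x))) => //.
    ring.
  apply: (eqv_trans semi0) (sgL sT _ tb0 L2_ramp (sipZ semi0 _ L2_cst1)) _.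
  apply: (eqvD semi0); last exact: (sgZ semi0 sT _ tb0 L2_cst1).
  apply: (eqv_refl semi0); apply: (sipZ semi0).
  exact: (sgH sT tb0 L2_ramp).
have H1 := sgH sT tb0 L2_ramp; have H2 := sgH sT tb0 L2_cst1.
rewrite (eqv_ip semi0 kE (eqv_refl semi0 L2_cst1)).
rewrite (ipDl semi0) ?(ipZl semi0) ?L2_cst1//; try exact: (sipZ semi0).
rewrite /content /content1; field.
Unshelve. all: by end_near. Qed.

End OneProblem.
End Flux.

(** * Separation of the fluxes *)

Section FluxSeparation.
Context {R : realType}.
Local Notation V := (measurableTypeR R -> R^o).
Local Notation inner0 := (inner (@leb1 R 0)).
Local Notation semi0 := (semi_inner_L2 (@leb1 R 0)).
Local Notation cst1 := (@cst1 R).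
Local Notation ramp := (@ramp R).
Implicit Types (a t : R) (S : R -> (R -> R) -> R -> R).

Section TwoProblems.
Variables (a a' : R) (S S' : R -> (R -> R) -> R -> R).
Hypotheses (a1 : a < 1) (a'1 : a' < 1).
Hypotheses (eS : is_exp_semigroup a S) (eS' : is_exp_semigroup a' S').
Local Notation T := (rescale a S).
Local Notation T' := (rescale a' S').

Let sT := sgroup_rescale a1 eS.1.
Let sT' := sgroup_rescale a'1 eS'.1.

Lemma domain_closure_ramp : domain_closure (@L2 R 0) inner0 T ramp.
Proof. exact: (sgen_cl semi0 (sgen_ramp a1 eS)). Qed.

(** The constant 1 does not vanish at the end point 1. But it is minus the image
    of the ramp under L, hence a limit of difference quotients of elements of
    the domain. *)
Lemma domain_closure_cst1 : domain_closure (@L2 R 0) inner0 T cst1.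
Proof.
have -> : cst1 = -1 *: - cst1 by rewrite scaleN1r opprK.
apply: (domain_closureZ semi0 sT).
exact: (sgen_cl_image semi0 sT (sgen_ramp a1 eS)).
Qed.

Lemma rescale_sym f g t : domain_closure (@L2 R 0) inner0 T f ->
  domain_closure (@L2 R 0) inner0 T' g -> 0 <= t -> inner0 (T t f) g = inner0 f (T' t g).
Proof.
have lam0 : 0 <= 4 / 3 :> R by lra.
apply: (domain_closure_sym semi0 sT sT' lam0).
- by move=> f' k; exact: sgen_dissip.
- by move=> f' k; exact: sgen_dissip.
move=> f' h g' k /(sgen_in_domain a1 eS) fh /(sgen_in_domain a'1 eS') gk.
exact: in_domain_sym.
Qed.

End TwoProblems.

Section Uniqueness.
Variables (a a' : R) (S S' : R -> (R -> R) -> R -> R).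
Hypotheses (a1 : a < 1) (a'1 : a' < 1).
Hypotheses (eS : is_exp_semigroup a S) (eS' : is_exp_semigroup a' S').

Lemma content_unique t : 0 <= t ->
  content inner0 (rescale a S) cst1 t = content inner0 (rescale a' S') cst1 t.
Proof.
move=> t0; rewrite /content (rescale_sym a1 a'1 eS eS')//.
- exact: (ipC semi0).
- exact: domain_closure_cst1 eS.
- exact: domain_closure_cst1 eS'.
Qed.

(** The ramp is moved across the inner product twice, so as to pass through the
    orbit of the constant 1 under the second semigroup. *)
Lemma content1_unique t : 0 <= t ->
  content1 inner0 (rescale a S) cst1 ramp t =
  content1 inner0 (rescale a' S') cst1 ramp t.
Proof.
move=> t0; rewrite /content1.
have c1 := domain_closure_cst1 a'1 eS'.
rewrite (rescale_sym a1 a'1 eS eS' (domain_closure_ramp a1 eS) c1 t0).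
by rewrite (rescale_sym a'1 a'1 eS' eS' (domain_closure_ramp a'1 eS') c1 t0).
Qed.

End Uniqueness.

(** The times t / (1 - a) range over a bounded interval when a <= beta and
    t <= t1, where the heat content is bounded below; the condition on [t] makes
    the last factor of [flux_gap] at least 1. *)
Lemma flux_separation (u : R -> R -> R -> R) (alpha beta t1 : R) n :
  is_solution_family (@parabola R) u -> 0 < alpha -> beta < 1 ->
  t1 / (1 - beta) <= 1 / 4 * 2 ^+ n ->
  forall a1 a2 t, alpha <= a1 -> a1 <= a2 -> a2 <= beta ->
    3 / (2 * alpha) <= t -> t <= t1 ->
  (1 / 3) ^+ (2 ^ n) * (a2 - a1) <= boundary_flux u a2 t - boundary_flux u a1 t.
Proof.
move=> su al0 be1 hn a1 a2 t al1 a12 a2be lot hit.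
have t0 : 0 <= t by apply: le_trans lot; rewrite divr_ge0//; lra.
have a11 : a1 < 1 by lra.
have a21 : a2 < 1 by lra.
have i1 : 0 <= a1 < 1 by apply/andP; split => //; lra.
have i2 : 0 <= a2 < 1 by apply/andP; split => //; lra.
have [S1 e1 /(_ t t0) [u1 c1]] := su _ i1.
have [S2 e2 /(_ t t0) [u2 c2]] := su _ i2.
rewrite (flux_content a11 e1 t0 u1 c1) (flux_content a21 e2 t0 u2 c2).
pose b2 := 1 - a1; pose b1 := 1 - a2.
have b10 : 0 < b1 by rewrite subr_gt0.
have b20 : 0 < b2 by rewrite subr_gt0.
have b12 : b1 <= b2 by rewrite /b1 /b2; lra.
have b2a : b2 <= 1 - alpha by rewrite /b2; lra.
have tb2 : 0 <= t / b2 by rewrite divr_ge0// ltW.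
have tb1 : 0 <= t / b1 by rewrite divr_ge0// ltW.
rewrite -/b1 -/b2 (content_unique a11 a21 e1 e2 tb2) (content1_unique a11 a21 e1 e2 tb2).
have sT := sgroup_rescale a21 e2.1.
have symT f h g k : sgen (@L2 R 0) inner0 (rescale a2 S2) f h ->
    sgen (@L2 R 0) inner0 (rescale a2 S2) g k -> inner0 h g = inner0 f k.
  move=> /(sgen_in_domain a21 e2) fh /(sgen_in_domain a21 e2) gk.
  exact: in_domain_sym.
have gap := flux_gap semi0 sT (sgen_dissip a21 e2) symT (sgen_ramp a21 e2)
  inner0_cst1 inner0_ramp.
have low := content_gt0_bound semi0 sT (sgen_dissip a21 e2) symT (sgen_ramp a21 e2)
  inner0_cst1 inner0_ramp inner0_ramp_cst1.
have {}gap := gap alpha b1 b2 t.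
have {}gap := gap (introT andP (conj b10 b12)) b2a (ltW al0) t0.
have tn : 0 <= t / b1 <= 1 / 4 * 2 ^+ n.
  rewrite tb1 (le_trans _ hn)// (@le_trans _ _ (t / (1 - beta)))//.
    by rewrite ler_wpM2l// lef_pV2 ?posrE// /b1; lra.
  by rewrite ler_wpM2r// invr_ge0; lra.
have {}low := low _ _ tn.
have big : 1 <= 4 / 3 * alpha * t - 1.
  move: lot; rewrite ler_pdivrMr; last by lra.
  by move=> lot; lra.
have b21 : 0 <= b2 - b1 by lra.
have -> : a2 - a1 = b2 - b1 by rewrite /b1 /b2; ring.
move: gap low; move: (content _ _ _ (t / b1)) (content _ _ _ (t / b2)) => P1 P2.
move: (content1 _ _ _ _ (t / b1)) (content1 _ _ _ _ (t / b2)) => R1 R2.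
have c0 : 0 <= (1 / 3) ^+ (2 ^ n) :> R by rewrite exprn_ge0//; lra.
move: c0; set c := (1 / 3) ^+ _ => c0 gap low.
have h1 : c * (b2 - b1) <= (b2 - b1) * P1 by rewrite mulrC ler_wpM2l.
have h2 : (b2 - b1) * P1 <= (b2 - b1) * P1 * (4 / 3 * alpha * t - 1).
  by rewrite ler_peMr// mulr_ge0// (le_trans c0).
apply: le_trans (le_trans h1 (le_trans h2 gap)) _.
rewrite le_eqVlt; apply/orP; left; apply/eqP; ring.
Qed.

Lemma parabola_C1 : C1_unit_interval (@parabola R).
Proof.
exists (fun x => 1 - 2 * x); split.
  apply: continuous_subspaceT => x; apply: cvgB; first exact: cvg_cst.
  by apply: cvgM; [exact: cvg_cst|exact: cvg_id].
move=> x _.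
have h : (1 - x - y) @[y --> within `[0, 1] (x^')] --> 1 - 2 * x.
  have -> : 1 - 2 * x = 1 - x - x by ring.
  apply: cvgB; first exact: cvg_cst.
  by apply: cvg_within_filter; apply: cvg_within.
apply: cvg_trans h; apply: near_eq_cvg.
rewrite near_withinE; near=> y => _.
have yx : y != x by near: y; exact: nbhs_dnbhs_neq.
by rewrite /parabola; field; rewrite subr_eq0.
Unshelve. all: by end_near. Qed.

End FluxSeparation.

Theorem proposition5p4 (R : realType) (alpha beta : R)
  (h0alpha : 0 < alpha) (halphabeta : alpha <= beta) (hbeta1 : beta < 1) :
  let u0 : R -> R := fun x => x * (1 - x) in
  exists2 T0 : R, 0 < T0 & forall t0 t1 : R, T0 <= t0 -> t0 <= t1 ->
    admissible u0 alpha beta t0 t1 /\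
    exists2 C : R, 0 < C & forall u : R -> R -> R -> R,
      is_solution_family u0 u ->
      forall a1 a2 t : R, a1 \in `[alpha, beta] -> a2 \in `[alpha, beta] ->
        t \in `[t0, t1] ->
        `|a2 - a1| <= C * `|boundary_flux u a2 t - boundary_flux u a1 t|.
Proof.
(* 4/3 alpha t - 1 >= 1 if and only if t >= 3 / (2 alpha). *)
move=> u0; exists (3 / (2 * alpha)); first by rewrite divr_gt0//; lra.
move=> t0 t1 hT t01.
have [n hn] : exists n, t1 / (1 - beta) <= 1 / 4 * 2 ^+ n.
  (* Any n with 2^n at least the number x will do, and n <= 2^n. *)
  pose x := 4 * (t1 / (1 - beta)); exists (Num.bound `|x|).
  have hx := archi_boundP (normr_ge0 x); have lex := ler_norm x.
  have h2 : (Num.bound `|x|)%:R <= 2 ^+ Num.bound `|x| :> R.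
    by rewrite -natrX ler_nat ltnW// ltn_expl.
  rewrite /x in hx lex h2 *; lra.
pose c : R := (1 / 3) ^+ (2 ^ n).
have c0 : 0 < c by rewrite exprn_gt0//; lra.
have key u : is_solution_family u0 u ->
    forall a1 a2 t : R, a1 \in `[alpha, beta] -> a2 \in `[alpha, beta] ->
      t \in `[t0, t1] ->
      c * `|a2 - a1| <= `|boundary_flux u a2 t - boundary_flux u a1 t|.
  move=> su a1 a2 t; rewrite !in_itv/= => /andP[l1 r1] /andP[l2 r2] /andP[lt rt].
  have lT := le_trans hT lt.
  wlog a12 : a1 a2 l1 r1 l2 r2 / a1 <= a2.
    move=> W; case: (leP a1 a2) => [a12|/ltW a21]; first exact: W.
    by rewrite distrC [leRHS]distrC; exact: W.
  have sep := flux_separation su h0alpha hbeta1 hn l1 a12 r2 lT rt.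
  rewrite ger0_norm ?subr_ge0//; apply: le_trans sep _; exact: ler_norm.
split.
  split; first exact: parabola_C1.
  exists c => // u su a1 a2 t h1 h2 ht; rewrite (distrC a1).
  by rewrite (distrC (boundary_flux u a1 t)); exact: key.
exists c^-1; first by rewrite invr_gt0.
by move=> u su a1 a2 t h1 h2 ht; rewrite mulrC ler_pdivlMr// mulrC; exact: key.
Qed.
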